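(* Consider the hidden variable model, assumption and constants described in the context. Denote $$S_X=\max_{j\le p}\sqrt{\sum_{i\le N}x_{ij}(\omega_i)^2},$$ where $x_{ij}(\omega_i)$ is the $j$th coordinate of $x_i(\omega_i)$. Then for any $q_0,q_1\in(0,1)$ with $q_0+q_1<1$, with probability at least $1-q_0-q_1$, $$ \sup_{\boldsymbol{u}\in D\setminus\{\boldsymbol{\theta}\}}\frac{|[[\ell(\boldsymbol{u})-\ell(\boldsymbol{\theta})]]|}{\|\boldsymbol{u}-\boldsymbol{\theta}\|_1} \le 2\sqrt2\,R_D\,\mathsf{E}S_X\Big(A\sqrt{\ln(2p)}+2\psi_3(\psi_5+\psi_6)\Big)+\sqrt{2N}\Big(\psi_1M_X\sqrt{\ln(2p/q_0)}+2\psi_4\sqrt{\ln(p/q_1)}\Big), $$ where $A=2\psi_2(1+\psi_6)+(\psi_1+2\psi_2R_D+2\psi_3)(\psi_5+\psi_6)$.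
   Context: Model. $(\omega_1,Y_1),\ldots,(\omega_N,Y_N)$ are independent random vectors taking values in $\Omega\times\mathcal{Y}$; for each $i\le N$ there are measures $\mu_i$ on $\Omega$ and $\nu_i$ on $\mathcal{Y}$ (not necessarily the same for different $i$) such that $$\Pr\{\omega_i\in dz,\,Y_i\in dy\}=\frac{g_i(x_i(z)^\top\boldsymbol{\theta})\,k_i(z,y)\,\mu_i(dz)\,\nu_i(dy)}{Z_i(\boldsymbol{\theta})},$$ where $k_i$, $g_i$ and $x_i$ are known functions with $x_i:\Omega\to\mathbb{R}^p$, $\boldsymbol{\theta}\in\mathbb{R}^p$ is the true parameter value, and $Z_i(\boldsymbol{u})=\int g_i(x_i(z)^\top\boldsymbol{u})k_i(z,y)\,\mu_i(dz)\,\nu_i(dy)$ is the normalizing constant for $\boldsymbol{u}\in\mathbb{R}^p$. Only $Y_1,\ldots,Y_N$ are observed, and $$\ell(\boldsymbol{u})=-\sum_{i\le N}\ln\int g_i(x_i(z)^\top\boldsymbol{u})\,k_i(z,Y_i)\,\mu_i(dz)+\sum_{i\le N}\ln Z_i(\boldsymbol{u}).$$ $D\subset\mathbb{R}^p$ is the search domain, and $\boldsymbol{\theta}\in D$. Assumption. There is $M_X>0$ such that with probability 1, $\|x_i(\omega_i)\|_\infty\le M_X$ for all $i\le N$. For all $i\le N$, $g_i:\mathbb{R}\to\mathbb{R}$ is first order differentiable, and there are $0<A_g<B_g<\infty$, $F_1<\infty$, $F_2<\infty$ such that $A_g\le g_i(t)\le B_g$, $|g_i'(t)|\le F_1$ and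 $|g_i'(t)-g_i'(s)|\le F_2|t-s|$ for all $s,t\in\mathbb{R}$ and all $i\le N$. Constants. $R_D=\sup_{\boldsymbol{u}\in D}\|\boldsymbol{u}-\boldsymbol{\theta}\|_1$, $I_g=[A_g/B_g,\,B_g/A_g]$. For $z>-1$, $\varrho(z)=z^{-1}\ln(1+z)-1$ if $z\ne0$, $\varrho(0)=0$; $\varrho_0=\sup_{t\in I_g}|\varrho(t-1)|$, $\varrho_1=\sup_{t\in I_g}|\varrho'(t-1)|$. And $$\psi_1=F_1/A_g,\quad\psi_2=F_2M_X/(2A_g),\quad\psi_3=\min(2F_1,\,F_2M_XR_D/2)/A_g,$$ $$\psi_4=[\psi_1\varrho_0+\psi_3(1+\varrho_0)]M_X,\quad\psi_5=2\psi_1M_X\varrho_1,\quad\psi_6=2(\varrho_0+\psi_3M_X\varrho_1).$$ Notation. For a random variable $\xi$, $[[\xi]]=\xi-\mathsf{E}\xi$. *)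

(* Defs.v *)
From mathcomp Require Import all_boot all_order all_algebra.
From mathcomp Require Import all_classical all_reals all_analysis.

Set Implicit Arguments.
Unset Strict Implicit.
Unset Printing Implicit Defensive.
Import Order.TTheory GRing.Theory Num.Theory.
Import numFieldNormedType.Exports.

Local Open Scope classical_set_scope.
Local Open Scope ring_scope.

Definition dotv (R : realType) (p : nat) (x u : 'rV[R]_p) : R :=
  \sum_(j < p) x 0 j * u 0 j.

Definition norm1 (R : realType) (p : nat) (u : 'rV[R]_p) : R :=
  \sum_(j < p) `|u 0 j|.

(* Mutual independence of a finite family of random elements: the product rule
   over every subfamily. *)
Definition mutually_independent (R : realType) (d : measure_display)
    (T : measurableType d) (P : probability T R) (N : nat)
    (d' : measure_display) (E : measurableType d') (X : 'I_N -> T -> E) : Prop :=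
  forall (J : {set 'I_N}) (B : 'I_N -> set E),
    (forall i, measurable (B i)) ->
    P [set w | forall i, i \in J -> B i (X i w)] =
    (\prod_(i in J) P [set w | B i (X i w)])%E.

Section hidden_variable_model.
Context (R : realType) (p : nat).
Context (d1 : measure_display) (Om : measurableType d1).
Context (d2 : measure_display) (Yc : measurableType d2).

(* Normalizing constant. The value is in R: [fine] sends an infinite integral
   to 0, which [has_density] below excludes at the true parameter, and hence,
   when g is bounded away from 0 and infinity, at all parameters. *)
Definition normalizer (g : R -> R) (x : Om -> 'rV[R]_p) (k : Om -> Yc -> R)
    (mu : set Om -> \bar R) (nu : set Yc -> \bar R) (u : 'rV[R]_p) : R :=
  fine (\int[nu]_y \int[mu]_z (g (dotv (x z) u) * k z y)%:E)%E.

(* P{omega in dz, Y in dy} = g(x(z)^T theta) k(z,y) mu(dz) nu(dy) / Z(theta) *)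
Definition has_density (d : measure_display) (T : measurableType d)
    (P : probability T R) (omega : T -> Om) (Y : T -> Yc)
    (g : R -> R) (x : Om -> 'rV[R]_p) (k : Om -> Yc -> R)
    (mu : set Om -> \bar R) (nu : set Yc -> \bar R)
    (theta : 'rV[R]_p) : Prop :=
  forall B : set (Om * Yc), measurable B ->
    P [set w | B (omega w, Y w)] =
    (\int[nu]_y \int[mu]_z
       (\1_B (z, y) * (g (dotv (x z) theta) * k z y
                       / normalizer g x k mu nu theta))%:E)%E.

Definition loss (N : nat) (g : 'I_N -> R -> R) (x : 'I_N -> Om -> 'rV[R]_p)
    (k : 'I_N -> Om -> Yc -> R) (mu : 'I_N -> set Om -> \bar R)
    (nu : 'I_N -> set Yc -> \bar R) (Y : 'I_N -> Yc) (u : 'rV[R]_p) : R :=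
  - (\sum_(i < N)
       ln (fine (\int[mu i]_z (g i (dotv (x i z) u) * k i z (Y i))%:E)%E))
  + \sum_(i < N) ln (normalizer (g i) (x i) (k i) (mu i) (nu i) u).

End hidden_variable_model.

(* [[xi]] = xi - E xi *)
Definition centered (R : realType) (d : measure_display) (T : measurableType d)
    (P : probability T R) (xi : T -> R) (w : T) : R :=
  xi w - fine ('E_P[xi])%E.

(* S_X as a function of the values x_i(omega_i) *)
Definition max_col_norm (R : realType) (N p : nat) (v : 'I_N -> 'rV[R]_p) : R :=
  \big[Num.max/0]_(j < p) Num.sqrt (\sum_(i < N) (v i 0 j) ^+ 2).

(* R_D; it is +oo when D is unbounded. *)
Definition radius1 (R : realType) (p : nat) (D : set 'rV[R]_p)
    (theta : 'rV[R]_p) : \bar R :=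
  ereal_sup [set (norm1 (u - theta))%:E | u in D].

Definition varrho (R : realType) (z : R) : R :=
  if z == 0 then 0 else z^-1 * ln (1 + z) - 1.

(* Both suprema are of continuous functions over a nonempty compact interval
   when 0 < Ag < Bg, hence are genuine suprema in R. *)
Definition varrho0 (R : realType) (Ag Bg : R) : R :=
  sup [set `|varrho (t - 1)| | t in `[Ag / Bg, Bg / Ag]].

Definition varrho1 (R : realType) (Ag Bg : R) : R :=
  sup [set `|derive1 (@varrho R) (t - 1)| | t in `[Ag / Bg, Bg / Ag]].

(* Main.v *)
(* Let r_i(u, y) be the conditional mean, given Y_i = y, of the likelihood ratio
   g_i(x_i^T u) / g_i(x_i^T theta) = 1 + x_i^T (u - theta) s_i(u), where s_i(u) is the slope
   of g_i between the two arguments divided by g_i(x_i^T theta). Up to a constant,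
   l(u) - l(theta) is - sum_i ln r_i(u, Y_i), and ln t = (t - 1)(1 + varrho(t - 1)) gives
     ln r_i(u, y) = sum_j (u - theta)_j (a_ij(theta, y) + h_ij(u, y))
   with a_ij(u, y) = E(x_ij s_i(u) | Y_i = y) and
   h_ij(u, y) = a_ij(u, y)(1 + varrho(r_i(u, y) - 1)) - a_ij(theta, y).
   Dividing by |u - theta|_1 leaves the maximum over j of the centered sums of a_ij(theta, .)
   and of the suprema over u of the centered sums of h_ij(u, .). Both concentrate by
   McDiarmid's inequality, |a_ij| <= psi_1 M_X and |h_ij| <= psi_4. For the mean of the
   suprema, |h_ij(u, y) - h_ij(u', y)| is at most C times the conditional mean of
   |x_i^T (u - u')|, so Jensen's inequality and a combined symmetrization and contraction
   step, one observation at a time, replace h_ij(u, Y_i) by 2 C e_i x_i(omega_i)^T (u - theta)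
   with random signs e_i. This is linear in u, and the exponential moment bound on a maximum
   of 2p sign averages yields 2 C R_D sqrt(2 ln(2p)) E S_X. The supremum over D is reached
   through finite subsets of a countable dense subset, by Lipschitz continuity. *)
From HB Require Import structures.
Require Import Defs.
From mathcomp Require Import all_boot all_order all_algebra.
From mathcomp Require Import all_classical all_reals all_analysis.
From mathcomp Require Import measurable_realfun ring lra.
Import Order.TTheory GRing.Theory Num.Theory.
Import numFieldNormedType.Exports.
Local Open Scope classical_set_scope.
Local Open Scope ring_scope.
Set Implicit Arguments.
Unset Strict Implicit.

(** * Bounded measurable functions *)

(** All observations live on one probability space, whereas symmetrization and McDiarmid's
    inequality integrate out one of them at a time. Independence gives the observations [Z i w] the
    same joint law as [Z i t_i], for a tuple t of independent points of that space. Both arguments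
    then become inductions on tuples with Fubini's theorem, without martingales. The remainder h
    sees the hidden variables only through conditional means, whereas S_X is made of the hidden
    values themselves. This is why increments of h are compared with conditional means of |x^T (u -
    u')|: Jensen's inequality and the tower property turn these into unconditional means of a linear
    process. Two almost sure exceptions are removed beforehand: x_i is truncated at M_X, and the
    conditional mean gets a default value at observations of zero or infinite density. The estimates
    then hold at every point, and the centered processes are bounded. When R_D is infinite the
    stated bound is infinite too, except if E S_X = 0. That exception forces the finite families to
    carry a radius of their own. *)

Definition bounded_mfun (R : realType) d (T : measurableType d) (f : T -> R) :=
  measurable_fun [set: T] f /\ exists M, forall x, `|f x| <= M.

(** Where f does not vanish, 1 / f = f exp (- 2 ln |f|); where it does, both sides are 0 by the
    convention 0^-1 = 0. The right-hand side is built from measurable operations. *)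
Lemma measurable_funV (R : realType) d (T : measurableType d) (D : set T) (f : T -> R) :
  measurable_fun D f -> measurable_fun D (fun x => (f x)^-1).
Proof.
move=> mf; have -> : (fun x => (f x)^-1) =
    (fun x => f x * expR (- (ln `|f x| + ln `|f x|))).
  apply/funext => x; have [->|fx0] := eqVneq (f x) 0; first by rewrite invr0 mul0r.
  rewrite expRN expRD lnK ?posrE ?normr_gt0// -expr2 real_normK ?num_real//.
  by rewrite expr2 invfM mulrA divff// mul1r.
have mln : measurable_fun D (fun x => ln `|f x|).
  by apply: measurableT_comp => //; exact: measurableT_comp.
apply: measurable_funM => //; apply: measurableT_comp => //.
by apply: measurable_funN; exact: measurable_funD.
Qed.

Section bounded_mfun_closure.
Context {R : realType} {d} {T : measurableType d}.
Implicit Types f h : T -> R.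

Lemma bounded_mfun_cst (c : R) : bounded_mfun (fun _ : T => c).
Proof. by split=> //; exists `|c|. Qed.

Lemma bounded_mfunD f h : bounded_mfun f -> bounded_mfun h ->
  bounded_mfun (fun x => f x + h x).
Proof.
move=> [mf [M fM]] [mh [K hK]]; split; first exact: measurable_funD.
by exists (M + K) => x; rewrite (le_trans (ler_normD _ _))// lerD.
Qed.

Lemma bounded_mfunM f h : bounded_mfun f -> bounded_mfun h ->
  bounded_mfun (fun x => f x * h x).
Proof.
move=> [mf [M fM]] [mh [K hK]]; split; first exact: measurable_funM.
by exists (M * K) => x; rewrite normrM ler_pM.
Qed.

Lemma bounded_mfunZ (c : R) f : bounded_mfun f -> bounded_mfun (fun x => c * f x).
Proof. by move=> bf; apply: bounded_mfunM bf; exact: bounded_mfun_cst. Qed.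

Lemma bounded_mfunN f : bounded_mfun f -> bounded_mfun (fun x => - f x).
Proof.
move=> [mf [M fM]]; split; first exact: measurable_funN.
by exists M => x; rewrite normrN.
Qed.

Lemma bounded_mfunB f h : bounded_mfun f -> bounded_mfun h ->
  bounded_mfun (fun x => f x - h x).
Proof. by move=> bf bh; apply: bounded_mfunD bf _; exact: bounded_mfunN. Qed.

Lemma bounded_mfun_norm f : bounded_mfun f -> bounded_mfun (fun x => `|f x|).
Proof.
move=> [mf [M fM]]; split; first exact: measurableT_comp.
by exists M => x; rewrite normr_id.
Qed.

Lemma bounded_mfun_max f h : bounded_mfun f -> bounded_mfun h ->
  bounded_mfun (fun x => Num.max (f x) (h x)).
Proof.
move=> [mf [M fM]] [mh [K hK]]; split; first exact: measurable_maxr.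
exists (Num.max M K) => x; rewrite le_max.
by case: (leP (f x) (h x)) => _; rewrite ?fM ?hK ?orbT.
Qed.

Lemma bounded_mfun_expR f : bounded_mfun f -> bounded_mfun (fun x => expR (f x)).
Proof.
move=> [mf [M fM]]; split; first exact: measurableT_comp.
exists (expR M) => x; rewrite ger0_norm ?expR_ge0// ler_expR.
exact: le_trans (ler_norm _) (fM x).
Qed.

Lemma bounded_mfun_sum (I : Type) (s : seq I) (F : I -> T -> R) :
  (forall i, bounded_mfun (F i)) -> bounded_mfun (fun x => \sum_(i <- s) F i x).
Proof.
move=> bF; elim: s => [|i s IH].
  under eq_fun do rewrite big_nil; exact: bounded_mfun_cst.
by under eq_fun do rewrite big_cons; exact: bounded_mfunD.
Qed.

Lemma bounded_mfun_comp d' (T' : measurableType d') (f : T -> R) (h : T' -> T) :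
  measurable_fun [set: T'] h -> bounded_mfun f -> bounded_mfun (f \o h).
Proof.
move=> mh [mf [M fM]]; split; first exact: measurableT_comp.
by exists M => x; exact: fM.
Qed.

End bounded_mfun_closure.

Section bounded_integral.
Context {R : realType} {d} {T : measurableType d} (P : probability T R).
Implicit Types f h : T -> R.

Lemma bounded_mfun_integrable f :
  bounded_mfun f -> P.-integrable [set: T] (EFin \o f).
Proof.
move=> [mf [M fM]]; apply: measurable_bounded_integrable => //.
  by rewrite (le_lt_trans (probability_le1 _ _))// ltry.
by exists M; split; [exact: num_real|move=> K MK x _; exact: le_trans (fM x) (ltW MK)].
Qed.

Lemma EFin_Rintegral f : bounded_mfun f ->
  (\int[P]_x f x)%:E = (\int[P]_x (f x)%:E)%E.
Proof.
move=> bf; rewrite /Rintegral fineK//.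
by apply: integrable_fin_num => //; exact: bounded_mfun_integrable.
Qed.

Lemma probability_RintegralD f h : bounded_mfun f -> bounded_mfun h ->
  \int[P]_x (f x + h x) = \int[P]_x f x + \int[P]_x h x.
Proof. by move=> bf bh; apply: RintegralD => //; exact: bounded_mfun_integrable. Qed.

Lemma probability_RintegralB f h : bounded_mfun f -> bounded_mfun h ->
  \int[P]_x (f x - h x) = \int[P]_x f x - \int[P]_x h x.
Proof. by move=> bf bh; apply: RintegralB => //; exact: bounded_mfun_integrable. Qed.

Lemma probability_RintegralZ (c : R) f : bounded_mfun f ->
  \int[P]_x (c * f x) = c * \int[P]_x f x.
Proof. by move=> bf; apply: RintegralZl => //; exact: bounded_mfun_integrable. Qed.

Lemma probability_RintegralN f : bounded_mfun f ->
  \int[P]_x (- f x) = - \int[P]_x f x.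
Proof.
move=> bf; under eq_Rintegral do rewrite -mulN1r.
by rewrite probability_RintegralZ// mulN1r.
Qed.

Lemma probability_Rintegral_cst (c : R) : \int[P]_x c = c.
Proof. by rewrite Rintegral_cst//= [P _]probability_setT mulr1. Qed.

Lemma probability_le_Rintegral f h : bounded_mfun f -> bounded_mfun h ->
  (forall x, f x <= h x) -> \int[P]_x f x <= \int[P]_x h x.
Proof. by move=> bf bh fh; apply: le_Rintegral => //; exact: bounded_mfun_integrable. Qed.

Lemma probability_Rintegral_le f (c : R) : bounded_mfun f ->
  (forall x, f x <= c) -> \int[P]_x f x <= c.
Proof.
move=> bf fc; rewrite -[leRHS]probability_Rintegral_cst.
by apply: probability_le_Rintegral => //; exact: bounded_mfun_cst.
Qed.

Lemma probability_Rintegral_ge f (c : R) : bounded_mfun f ->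
  (forall x, c <= f x) -> c <= \int[P]_x f x.
Proof.
move=> bf fc; rewrite -[leLHS]probability_Rintegral_cst.
by apply: probability_le_Rintegral => //; exact: bounded_mfun_cst.
Qed.

Lemma probability_Rintegral_sum (I : Type) (s : seq I) (F : I -> T -> R) :
  (forall i, bounded_mfun (F i)) ->
  \int[P]_x (\sum_(i <- s) F i x) = \sum_(i <- s) \int[P]_x F i x.
Proof.
move=> bF; elim: s => [|i s IH].
  under eq_Rintegral do rewrite big_nil.
  by rewrite big_nil probability_Rintegral_cst.
under eq_Rintegral do rewrite big_cons.
by rewrite big_cons probability_RintegralD ?IH//; exact: bounded_mfun_sum.
Qed.

(** Chernoff's bound: exp (lam a) times the indicator of the event is at most exp (lam f). *)
Lemma probability_tail_le (f : T -> R) (lam a b : R) : bounded_mfun f -> 0 < lam ->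
  \int[P]_x expR (lam * f x) <= b ->
  (P [set x | (a < f x)%R] <= (b * expR (- (lam * a)))%:E)%E.
Proof.
move=> bf lam0 Eb; have bel : bounded_mfun (fun x => expR (lam * f x)).
  by apply: bounded_mfun_expR; exact: bounded_mfunZ.
have mA : measurable [set x | a < f x].
  rewrite -[X in measurable X]setTI.
  have -> : [set x | a < f x] = f @^-1` `]a, +oo[%classic.
    by apply/seteqP; split=> x /=; rewrite in_itv/= andbT.
  by case: bf => mf _; apply: mf => //; exact: measurable_itv.
have bI : bounded_mfun (\1_[set x | a < f x] : T -> R).
  split; first exact: measurable_indic.
  by exists 1 => x; rewrite indicE ger0_norm ?ler0n// lern1 leq_b1.
have -> : P [set x | a < f x] = (\int[P]_x \1_[set x | a < f x] x)%:E.
  by rewrite EFin_Rintegral// integral_indic// setIT.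
rewrite lee_fin -ler_pdivrMr ?expR_gt0// -expRN opprK.
apply: le_trans Eb; rewrite mulrC -probability_RintegralZ//.
apply: probability_le_Rintegral => //; first exact: bounded_mfunZ.
move=> x; rewrite indicE; case: (boolP (x \in _)) => [|_]; last first.
  by rewrite mulr0 expR_ge0.
by rewrite inE/= mulr1 ler_expR => /ltW h; rewrite ler_pM2l.
Qed.

End bounded_integral.

Section bounded_fubini.
Context {R : realType} {d1 d2} {T1 : measurableType d1} {T2 : measurableType d2}.
Context (P : probability T1 R) (Q : probability T2 R).
Variable f : T1 * T2 -> R.
Hypothesis bf : bounded_mfun f.

Lemma bounded_mfun_pair1 x : bounded_mfun (fun y => f (x, y)).
Proof. exact: (bounded_mfun_comp (measurable_pair1 x) bf). Qed.

Lemma bounded_mfun_pair2 y : bounded_mfun (fun x => f (x, y)).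
Proof. exact: (bounded_mfun_comp (measurable_pair2 y) bf). Qed.

Let intf : (P \x Q)%E.-integrable setT (EFin \o f).
Proof. exact: (bounded_mfun_integrable (P \x Q)%E). Qed.

Lemma bounded_mfun_Rintegral1 : bounded_mfun (fun x => \int[Q]_y f (x, y)).
Proof.
split.
  apply/measurable_EFinP; apply: (eq_measurable_fun (fubini_F Q (EFin \o f))).
    by move=> x _; rewrite /= EFin_Rintegral//; exact: bounded_mfun_pair1.
  exact: (measurable_fubini_F intf).
have [_ [M fM]] := bf; exists M => x.
rewrite ler_norml; apply/andP; split.
  apply: probability_Rintegral_ge => [|y]; first exact: bounded_mfun_pair1.
  by have := fM (x, y); rewrite ler_norml => /andP[].
apply: probability_Rintegral_le => [|y]; first exact: bounded_mfun_pair1.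
by have := fM (x, y); rewrite ler_norml => /andP[].
Qed.

Lemma bounded_mfun_Rintegral2 : bounded_mfun (fun y => \int[P]_x f (x, y)).
Proof.
split.
  apply/measurable_EFinP; apply: (eq_measurable_fun (fubini_G P (EFin \o f))).
    by move=> x _; rewrite /= EFin_Rintegral//; exact: bounded_mfun_pair2.
  exact: (measurable_fubini_G intf).
have [_ [M fM]] := bf; exists M => y.
rewrite ler_norml; apply/andP; split.
  apply: probability_Rintegral_ge => [|x]; first exact: bounded_mfun_pair2.
  by have := fM (x, y); rewrite ler_norml => /andP[].
apply: probability_Rintegral_le => [|x]; first exact: bounded_mfun_pair2.
by have := fM (x, y); rewrite ler_norml => /andP[].
Qed.

Lemma bounded_Fubini1 : \int[(P \x Q)%E]_z f z = \int[P]_x \int[Q]_y f (x, y).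
Proof.
rewrite /Rintegral -(integral12_prod_meas1 intf); congr fine.
by apply: eq_integral => x _; rewrite /= EFin_Rintegral//; exact: bounded_mfun_pair1.
Qed.

Lemma bounded_Fubini2 : \int[(P \x Q)%E]_z f z = \int[Q]_y \int[P]_x f (x, y).
Proof.
rewrite /Rintegral -(integral21_prod_meas1 intf); congr fine.
by apply: eq_integral => x _; rewrite /= EFin_Rintegral//; exact: bounded_mfun_pair2.
Qed.

End bounded_fubini.

(** * Independent copies on a product space *)

Lemma measurable_tuple_rect d (T : measurableType d) n (A : 'I_n -> set T) :
  (forall i, measurable (A i)) ->
  measurable [set t : n.-tuple T | forall i, A i (tnth t i)].
Proof.
move=> mA; rewrite (_ : [set _ | _] =
    \bigcap_(i in [set: 'I_n]) ((@tnth _ _)^~ i @^-1` A i)).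
  apply: fin_bigcap_measurable; first exact: finite_finset.
  by move=> i _; rewrite -[X in measurable X]setTI; exact: measurable_tnth.
by apply/seteqP; split=> [t At i _|t At i]; apply: At.
Qed.

Section tuple_power.
Context {R : realType} {d} {T : measurableType d} (P : probability T R).

Definition tcons n (z : T * n.-tuple T) : n.+1.-tuple T := [tuple of z.1 :: z.2].

Lemma measurable_tcons n : measurable_fun setT (@tcons n).
Proof. exact: measurable_cons. Qed.

HB.instance Definition _ n := isMeasurableFun.Build _ _ _ _ (@tcons n) (@measurable_tcons n).

(** The n-fold product of P, built as the law of a tuple with a fresh head, so that an induction
    splits off the first coordinate by Fubini's theorem. *)
Fixpoint tuple_power n : probability (n.-tuple T) R :=
  if n is m.+1 then distribution (P \x tuple_power m)%E (@tcons m : {mfun _ >-> _})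
  else \d_([tuple] : 0.-tuple T).

Lemma Rintegral_tuple_power0 (f : 0.-tuple T -> R) : bounded_mfun f ->
  \int[tuple_power 0]_t f t = f [tuple].
Proof.
move=> [mf _]; rewrite /Rintegral integral_dirac//=; last exact/measurable_EFinP.
by rewrite indicT mul1r.
Qed.

Lemma Rintegral_tuple_powerS n (f : n.+1.-tuple T -> R) : bounded_mfun f ->
  \int[tuple_power n.+1]_t f t =
  \int[(P \x tuple_power n)%E]_z f (tcons z).
Proof.
move=> bf; have bfc : bounded_mfun (f \o @tcons n).
  exact: bounded_mfun_comp (@measurable_tcons n) bf.
rewrite /Rintegral /= integral_pushforward//=.
- by apply/measurable_EFinP; case: bf.
- exact: (bounded_mfun_integrable (P \x tuple_power n)%E bfc).
Qed.

Lemma tuple_power_rect n (A : 'I_n -> set T) : (forall i, measurable (A i)) ->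
  tuple_power n [set t | forall i, A i (tnth t i)] = (\prod_(i < n) P (A i))%E.
Proof.
elim: n A => [|n IH] A mA.
  rewrite big_ord0 (_ : [set _ | _] = setT) ?probability_setT//.
  by apply/seteqP; split=> // t _ [].
rewrite big_ord_recl -IH; last by move=> i; exact: mA.
rewrite -product_measure1E//; last first.
  exact: (@measurable_tuple_rect _ _ _ (fun i => A (lift ord0 i))).
rewrite /= /distribution /pushforward; congr (_ _).
apply/seteqP; split=> -[w t] /=.
  move=> h; split; first by have := h ord0.
  by move=> i; have := h (lift ord0 i); rewrite /= tnthS.
move=> [h0 h] i; case: (unliftP ord0 i) => [j ->|-> //].
by have := h j; rewrite tnthS.
Qed.

End tuple_power.

Section decoupling.
Context {R : realType} {d} {T : measurableType d} (P : probability T R).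
Context {d'} {E : measurableType d'} (n : nat) (Z : 'I_n -> T -> E).
Hypothesis mZ : forall i, measurable_fun setT (Z i).
Hypothesis indZ : mutually_independent P Z.

Let joint w : n.-tuple E := [tuple Z i w | i < n].
(** Each [Z i] reads a coordinate of its own, so that under [tuple_power] its values are independent
    by construction. *)
Let split_joint (t : n.-tuple T) : n.-tuple E := [tuple Z i (tnth t i) | i < n].

Let mjoint : measurable_fun setT joint.
Proof.
apply/measurable_fun_tnthP => i; apply: eq_measurable_fun (mZ i) => w _ /=.
by rewrite tnth_mktuple.
Qed.

Let msplit : measurable_fun setT split_joint.
Proof.
apply/measurable_fun_tnthP => i.
apply: (eq_measurable_fun (Z i \o (@tnth _ _)^~ i)) => [w _ /=|].
  by rewrite tnth_mktuple.
exact: measurableT_comp (mZ i) (measurable_tnth i).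
Qed.

HB.instance Definition _ := isMeasurableFun.Build _ _ _ _ joint mjoint.
HB.instance Definition _ := isMeasurableFun.Build _ _ _ _ split_joint msplit.

Let rect := [set B | exists A : 'I_n -> set E, (forall i, measurable (A i)) /\
  B = [set t : n.-tuple E | forall i, A i (tnth t i)]].

Let measurable_rectE : measurable = <<s rect >> :> set (set (n.-tuple E)).
Proof.
apply/seteqP; split=> [B mB|]; last first.
  apply: smallest_sub; first exact: sigma_algebra_measurable.
  by move=> _ [A [mA ->]]; exact: measurable_tuple_rect.
have : measurable_fun [set: g_sigma_algebraType rect] (id : _ -> n.-tuple E).
  apply/measurable_fun_tnthP => i _ A mA; rewrite setTI.
  (* The preimage of [A] under coordinate i is the rectangle whose other sides are full. *)
  apply: sub_sigma_algebra; exists (fun j => if j == i then A else setT).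
  split=> [j|]; first by case: ifP.
  apply/seteqP; split=> [t At j|t /(_ i)]; last by rewrite eqxx.
  by case: eqP => [->|].
by move=> /(_ measurableT B mB); rewrite setTI.
Qed.

(** Rectangles are stable under intersection and generate the sigma-algebra, so it is enough to
    compare the laws on them. There both give the product of the P (Z_i in A_i): one by independence
    over the whole index set, the other by the product structure. *)
Lemma law_split_joint (B : set (n.-tuple E)) : measurable B ->
  distribution P (joint : {mfun _ >-> _}) B =
  distribution (tuple_power P n) (split_joint : {mfun _ >-> _}) B.
Proof.
apply: (measure_unique rect (fun=> setT)) => //.
- move=> _ _ [A [mA ->]] [A' [mA' ->]]; exists (fun i => A i `&` A' i).
  split=> [i|]; first exact: measurableI.
  apply/seteqP; split=> t /=; first by move=> [h h'] i.
  by move=> h; split=> i; have [] := h i.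
- by move=> _; exists (fun=> setT); split=> //; apply/seteqP.
- by rewrite bigcup_const.
- move=> _ [A [mA ->]]; rewrite /distribution /pushforward/=.
  transitivity (P [set w | forall i, i \in [set: 'I_n]%SET -> A i (Z i w)]).
    congr (P _); apply/seteqP; split=> w /= h i.
      by move=> _; have := h i; rewrite tnth_mktuple.
    by rewrite tnth_mktuple; apply: h; rewrite finset.in_setT.
  transitivity (tuple_power P n [set t | forall i, (Z i @^-1` A i) (tnth t i)]).
    rewrite indZ// (@tuple_power_rect _ _ _ _ _ (fun i => Z i @^-1` A i)) => [|i].
      by apply: eq_bigl => i; rewrite finset.in_setT.
    by rewrite -[X in measurable X]setTI; exact: mZ.
  congr (_ _); apply/seteqP; split=> t /= h i; have := h i;
    by rewrite tnth_mktuple.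
- by move=> _; rewrite [X in (X < _)%E]probability_setT ltry.
Qed.

Lemma Rintegral_split_joint (F : n.-tuple E -> R) : bounded_mfun F ->
  \int[P]_w F [tuple Z i w | i < n] =
  \int[tuple_power P n]_t F [tuple Z i (tnth t i) | i < n].
Proof.
move=> bF.
have mF : measurable_fun setT (EFin \o F) by apply/measurable_EFinP; case: bF.
rewrite /Rintegral; transitivity
  (fine (\int[distribution P (joint : {mfun _ >-> _})]_x (EFin \o F) x)).
  rewrite integral_pushforward//.
  exact: bounded_mfun_integrable (bounded_mfun_comp mjoint bF).
rewrite (eq_measure_integral
  (distribution (tuple_power P n) (split_joint : {mfun _ >-> _}))); last first.
  by move=> A mA _; exact: law_split_joint.
rewrite integral_pushforward//.
exact: bounded_mfun_integrable (bounded_mfun_comp msplit bF).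
Qed.

End decoupling.

(** * Hoeffding's lemma and McDiarmid's inequality *)

Lemma MVT_is_derive (R : realType) (f df : R -> R) (a b : R) : a <= b ->
  (forall x, a <= x <= b -> is_derive x 1 f (df x)) ->
  exists2 c, a <= c <= b & f b - f a = df c * (b - a).
Proof.
move=> ab fdf; have [||c] := @MVT_segment R f df a b ab.
- by move=> x; rewrite in_itv/= => /andP[/ltW ax /ltW xb]; apply: fdf; rewrite ax.
- apply: derivable_within_continuous => x; rewrite in_itv/= => axb.
  by have [] := fdf _ axb.
by rewrite in_itv/= => cab fE; exists c.
Qed.

Lemma is_derive_ge0_le (R : realType) (f df : R -> R) (a b : R) : a <= b ->
  (forall x, a <= x <= b -> is_derive x 1 f (df x)) ->
  (forall x, a <= x <= b -> 0 <= df x) -> f a <= f b.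
Proof.
move=> ab fdf df0; have [c cab fE] := MVT_is_derive ab fdf.
by rewrite -subr_ge0 fE mulr_ge0 ?df0// subr_ge0.
Qed.

(* The two-point case of Hoeffding's lemma. With G the left-hand side and
   q = G'/G one has q' = 1 - q ^ 2, so that the logarithmic derivative m + s - q
   of the quotient is nondecreasing and vanishes at 0. *)
Lemma two_point_mgf_le (R : realType) (m s : R) : -1 <= m <= 1 -> 0 <= s ->
  (1 + m) / 2 * expR s + (1 - m) / 2 * expR (- s) <= expR (m * s + s ^+ 2 / 2).
Proof.
move=> m1 s0.
have e1 : (1 + m) / 2 + (1 - m) / 2 = 1 by field.
have e2 : (1 + m) / 2 - (1 - m) / 2 = m by field.
pose G (y : R) := (1 + m) / 2 * expR y + (1 - m) / 2 * expR (- y).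
pose H (y : R) := (1 + m) / 2 * expR y - (1 - m) / 2 * expR (- y).
have dG (y : R) : is_derive y (1:R) G (H y).
  by rewrite /G /H; apply: is_derive_eq; rewrite /GRing.scale/=; ring.
have dH (y : R) : is_derive y (1:R) H (G y).
  by rewrite /G /H; apply: is_derive_eq; rewrite /GRing.scale/=; ring.
have G0 (y : R) : 0 < G y.
  rewrite /G; have := expR_gt0 y; have := expR_gt0 (- y).
  by move: m1; set a := expR y; set b := expR (- y); nra.
pose q y := H y / G y.
have dq (y : R) : is_derive y (1:R) q (1 - q y ^+ 2).
  have Gy := lt0r_neq0 (G0 y).
  have := is_deriveM (dH y) (is_deriveV Gy (dG y)).
  move=> h; apply: is_derive_eq.
  by rewrite /GRing.scale/= /q; field.
have E0 (y : R) : 0 <= y -> q y <= m + y.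
  move=> y0; have dE (x : R) : is_derive x (1:R) (fun y => y - q y) (q x ^+ 2).
    by apply: is_derive_eq; ring.
  have := @is_derive_ge0_le _ _ _ 0 y y0 (fun x _ => dE x) (fun x _ => sqr_ge0 _).
  rewrite /q /G /H !oppr0 expR0 !mulr1 => h.
  by move: h; rewrite e1 e2 divr1; lra.
have dL (x : R) : is_derive x (1:R) (fun y => m * y + y ^+ 2 / 2 - ln (G y)) (m + x - q x).
  have := is_derive1_comp (is_derive1_ln (G0 x)) (dG x).
  move=> h; apply: is_derive_eq.
  by rewrite /GRing.scale/= /q; field; exact: lt0r_neq0.
have := @is_derive_ge0_le _ _ _ 0 s s0 (fun x _ => dL x).
rewrite /= expr0n/= mul0r mulr0 addr0 => L0.
have : 0 <= m * s + s ^+ 2 / 2 - ln (G s).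
  apply: le_trans (L0 _) => [|x /andP[x0 _]]; last by rewrite subr_ge0 E0.
  by rewrite /G oppr0 expR0 !mulr1 e1 ln1 subr0.
rewrite subr_ge0 -ler_expR lnK// posrE; exact: G0.
Qed.

(** Convexity of exp: s y is the mean of s and -s with weights (1 + y) / 2 and (1 - y) / 2. *)
Lemma expR_chord_le (R : realType) (s y : R) : -1 <= y <= 1 ->
  expR (s * y) <= (1 + y) / 2 * expR s + (1 - y) / 2 * expR (- s).
Proof.
move=> /andP[y1 y2].
have t01 : 0 <= (1 + y) / 2 <= 1 by apply/andP; split; lra.
pose t : {i01 R} := Itv01 (andP t01).1 (andP t01).2.
have := convex_expR t s (- s).
rewrite !convRE/= /unstable.onem (_ : 1 - (1 + y) / 2 = (1 - y) / 2); last by field.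
by rewrite (_ : _ * s + _ = s * y)//; field.
Qed.

Section hoeffding.
Context {R : realType} {d} {T : measurableType d} (P : probability T R).

(** After rescaling the range into [-1, 1], the chord bound is affine, so that its integral depends
    on the mean m alone and the two-point inequality applies. Only the oscillation of f is given;
    its infimum locates the interval of length 2 c. *)
Lemma hoeffding_mgf (f : T -> R) (c lam : R) : bounded_mfun f -> 0 < c -> 0 <= lam ->
  (forall x y, f x - f y <= 2 * c) ->
  \int[P]_x expR (lam * f x) <= expR (lam * (\int[P]_x f x) + (lam * c) ^+ 2 / 2).
Proof.
move=> bf c0 lam0 fc.
have [w0 _] : [set: T] !=set0.
  apply/set0P/negP => /eqP T0; have := probability_setT P.
  by rewrite T0 measure0 => /eqP; rewrite eqe eq_sym oner_eq0.
have [_ [M fM]] := bf.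
have hi : has_inf (range f).
  split; first by exists (f w0), w0.
  by exists (- M) => _ [x _ <-]; have := fM x; rewrite ler_norml => /andP[].
pose a := inf (range f).
have fa x : a <= f x by apply: ge_inf; [case: hi|exists x].
have fac x : f x <= a + 2 * c.
  rewrite -lerBlDr; apply: lb_le_inf; first by exists (f w0), w0.
  by move=> _ [y _ <-]; have := fc x y; lra.
pose y x := (f x - (a + c)) / c.
have y1 x : -1 <= y x <= 1.
  rewrite /y ler_pdivlMr// ler_pdivrMr// mulN1r mul1r; have := fa x; have := fac x.
  by move=> ? ?; apply/andP; split; lra.
have bY : bounded_mfun y.
  rewrite /y; under eq_fun do rewrite mulrC; apply: bounded_mfunZ.
  by apply: bounded_mfunB => //; exact: bounded_mfun_cst.
pose m := \int[P]_x y x.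
have m1 : -1 <= m <= 1.
  apply/andP; split; [apply: probability_Rintegral_ge|apply: probability_Rintegral_le];
  by move=> // x; have /andP[] := y1 x.
have mE : \int[P]_x f x = a + c + c * m.
  rewrite /m -probability_RintegralZ// -[X in _ = X + _](probability_Rintegral_cst P).
  rewrite -probability_RintegralD; [|exact: bounded_mfun_cst|exact: bounded_mfunZ].
  by apply: eq_Rintegral => x _; rewrite /y; field; exact: lt0r_neq0.
have fE x : lam * f x = lam * (a + c) + lam * c * y x.
  by rewrite /y; field; exact: lt0r_neq0.
under eq_Rintegral do rewrite fE expRD.
rewrite probability_RintegralZ; last first.
  by apply: bounded_mfun_expR; exact: bounded_mfunZ.
rewrite mE (_ : lam * _ + _ = lam * (a + c) + (m * (lam * c) + (lam * c) ^+ 2 / 2));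
  last by ring.
rewrite [leRHS]expRD ler_pM2l ?expR_gt0//.
apply: le_trans (two_point_mgf_le m1 (mulr_ge0 lam0 (ltW c0))).
set s := lam * c.
have -> : (1 + m) / 2 * expR s + (1 - m) / 2 * expR (- s) =
  \int[P]_x ((expR s + expR (- s)) / 2 + (expR s - expR (- s)) / 2 * y x).
  rewrite probability_RintegralD; [|exact: bounded_mfun_cst|exact: bounded_mfunZ].
  by rewrite probability_Rintegral_cst probability_RintegralZ// -/m; field.
apply: probability_le_Rintegral.
- by apply: bounded_mfun_expR; exact: bounded_mfunZ.
- by apply: bounded_mfunD; [exact: bounded_mfun_cst|exact: bounded_mfunZ].
- by move=> x; apply: le_trans (expR_chord_le s (y1 x)) _; lra.
Qed.

End hoeffding.

Section mcdiarmid.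
Context {R : realType} {d} {T : measurableType d} (P : probability T R).

(** The bound is two-sided, since t and t' can be exchanged. *)
Definition bounded_differences n (W : n.-tuple T -> R) (c : R) :=
  forall (i : 'I_n) t t', (forall j, j != i -> tnth t j = tnth t' j) -> W t - W t' <= c.

(** With the tail of the tuple fixed, Hoeffding's lemma in the head costs a factor exp ((lam c)^2 /
    2) and leaves the partial mean [W'], which inherits the bounded differences and goes to the
    induction hypothesis. *)
Lemma mcdiarmid_mgf n (W : n.-tuple T -> R) (c lam : R) : bounded_mfun W ->
  0 < c -> 0 <= lam -> bounded_differences W (2 * c) ->
  \int[tuple_power P n]_t expR (lam * W t) <=
  expR (lam * (\int[tuple_power P n]_t W t) + n%:R * (lam * c) ^+ 2 / 2).
Proof.
move=> + c0 lam0; elim: n W => [|n IH] W bW dW.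
  have beW : bounded_mfun (fun t => expR (lam * W t)).
    by apply: bounded_mfun_expR; exact: bounded_mfunZ.
  by rewrite !Rintegral_tuple_power0// !mul0r addr0.
have bWc : bounded_mfun (W \o @tcons _ T n).
  exact: bounded_mfun_comp (@measurable_tcons _ T n) bW.
have beW : bounded_mfun (fun z => expR (lam * (W \o @tcons _ T n) z)).
  by apply: bounded_mfun_expR; exact: bounded_mfunZ.
have beW' : bounded_mfun (fun z => expR (lam * W z)).
  by apply: bounded_mfun_expR; exact: bounded_mfunZ.
rewrite !Rintegral_tuple_powerS// (bounded_Fubini2 _ _ beW) (bounded_Fubini2 _ _ bWc).
pose W' t := \int[P]_w W (tcons (w, t)).
have bW' : bounded_mfun W' by exact: (bounded_mfun_Rintegral2 P (tuple_power P n) bWc).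
have dW' : bounded_differences W' (2 * c).
  move=> i t t' tt'; rewrite /W' -probability_RintegralB; [|exact: bounded_mfun_pair2 bWc _..].
  apply: probability_Rintegral_le => [|w].
    by apply: bounded_mfunB; exact: bounded_mfun_pair2 bWc _.
  apply: (dW (lift ord0 i)) => j.
  case: (unliftP ord0 j) => [k ->|->] //.
  by rewrite (inj_eq lift_inj) !tnthS => ki; exact: tt'.
apply: (@le_trans _ _ (\int[tuple_power P n]_t (expR ((lam * c) ^+ 2 / 2) * expR (lam * W' t)))).
  apply: probability_le_Rintegral.
  - exact: (bounded_mfun_Rintegral2 P (tuple_power P n) beW).
  - by apply: bounded_mfunZ; apply: bounded_mfun_expR; exact: bounded_mfunZ.
  - move=> t; rewrite -expRD addrC; apply: hoeffding_mgf => //.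
      exact: bounded_mfun_pair2 bWc _.
    move=> x y; apply: (dW ord0) => j.
    by case: (unliftP ord0 j) => [k -> _|->]; [rewrite !tnthS|rewrite eqxx].
rewrite probability_RintegralZ; last by apply: bounded_mfun_expR; exact: bounded_mfunZ.
apply: le_trans (ler_wpM2l (expR_ge0 _) (IH W' bW' dW')) _.
by rewrite -expRD ler_expR -natr1; lra.
Qed.

Lemma mcdiarmid_tail n (W : n.-tuple T -> R) (c q : R) : bounded_mfun W -> (0 < n)%N ->
  0 < c -> 0 < q < 1 -> bounded_differences W (2 * c) ->
  (tuple_power P n [set t | (\int[tuple_power P n]_t W t +
     c * Num.sqrt (2 * n%:R) * Num.sqrt (ln q^-1) < W t)%R] <= q%:E)%E.
Proof.
move=> bW n0 c0 /andP[q0 q1] dW.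
have L0 : 0 < ln q^-1 by rewrite ln_gt0// invf_gt1.
have N0 : 0 < n%:R :> R by rewrite ltr0n.
set s := Num.sqrt (2 * n%:R); set r := Num.sqrt (ln q^-1).
have s0 : 0 < s by rewrite sqrtr_gt0 mulr_gt0.
have r0 : 0 < r by rewrite sqrtr_gt0.
have s2 : s ^+ 2 = 2 * n%:R by rewrite sqr_sqrtr// mulr_ge0.
have r2 : r ^+ 2 = ln q^-1 by rewrite sqr_sqrtr// ltW.
(* The minimizer of n (lam c)^2 / 2 - lam c s r, as n = s^2 / 2. The minimum is - r^2 = ln q. *)
pose lam := 2 * r / (s * c).
have lam0 : 0 < lam by rewrite divr_gt0 ?mulr_gt0.
apply: le_trans (probability_tail_le _ _ lam0 (mcdiarmid_mgf bW c0 (ltW lam0) dW)) _ => //.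
rewrite lee_fin -expRD.
have -> : q = expR (- r ^+ 2) by rewrite r2 lnV ?posrE// opprK lnK// posrE.
rewrite ler_expR le_eqVlt; apply/orP; left; apply/eqP.
have -> : (n%:R : R) = s ^+ 2 / 2 by rewrite s2; field.
by rewrite /lam; field; rewrite !lt0r_neq0.
Qed.

End mcdiarmid.

(** * Sign averages of finite maxima *)

Section finite_max.
Context {R : realType} {I : finType} (i0 : I).
Implicit Types F G L : I -> R.

(** Starting the maximum at [F i0], and not at 0, keeps it exact when all values are negative. *)
Definition fmax F := \big[Num.max/F i0]_(i : I) F i.

Lemma fmax_ge F i : F i <= fmax F.
Proof. by rewrite /fmax (bigD1 i)//= le_max lexx. Qed.

Lemma fmax_ex F : exists i, fmax F = F i.
Proof.
rewrite /fmax; apply: (big_ind (fun r => exists i, r = F i)); first by exists i0.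
  by move=> _ _ [i ->] [j ->]; case: (leP (F i) (F j)) => _; [exists j|exists i].
by move=> i _; exists i.
Qed.

Lemma fmax_le F c : (forall i, F i <= c) -> fmax F <= c.
Proof. by move=> Fc; have [i ->] := fmax_ex F. Qed.

Lemma le_fmax F G : (forall i, F i <= G i) -> fmax F <= fmax G.
Proof. by move=> FG; apply: fmax_le => i; exact: le_trans (FG i) (fmax_ge _ _). Qed.

Lemma bounded_mfun_fmax d (T : measurableType d) (F : I -> T -> R) :
  (forall i, bounded_mfun (F i)) -> bounded_mfun (fun x => fmax (F ^~ x)).
Proof.
move=> bF; rewrite /fmax; elim: (index_enum I) => [|i s IH].
  by under eq_fun do rewrite big_nil; exact: bF.
by under eq_fun do rewrite big_cons; exact: bounded_mfun_max.
Qed.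

(* A Rademacher average of fmax (L +- F_0 +- ... +- F_(n-1)): the signs are averaged
   out one at a time, so that no space of signs is needed and symmetrization can
   proceed by induction on the sample size. *)
Fixpoint rademacher_max n : ('I_n -> I -> R) -> (I -> R) -> R :=
  match n with
  | 0 => fun _ L => fmax L
  | m.+1 => fun (F : 'I_m.+1 -> I -> R) L =>
      (rademacher_max (fun i => F (lift ord0 i)) (fun u => L u + F ord0 u) +
       rademacher_max (fun i => F (lift ord0 i)) (fun u => L u - F ord0 u)) / 2
  end.

Lemma bounded_mfun_rademacher_max d (T : measurableType d) n
    (F : 'I_n -> I -> T -> R) (L : I -> T -> R) :
  (forall i u, bounded_mfun (F i u)) -> (forall u, bounded_mfun (L u)) ->
  bounded_mfun (fun x => rademacher_max (fun i u => F i u x) (L ^~ x)).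
Proof.
elim: n F L => [|n IH] F L bF bL /=; first exact: bounded_mfun_fmax.
under eq_fun do rewrite mulrC; apply/bounded_mfunZ/bounded_mfunD.
  apply: (IH (fun i => F (lift ord0 i)) (fun u x => L u x + F ord0 u x)) => // u.
  exact: bounded_mfunD.
apply: (IH (fun i => F (lift ord0 i)) (fun u x => L u x - F ord0 u x)) => // u.
exact: bounded_mfunB.
Qed.

(** The two-point inequality with mean 0, that is cosh b <= exp (b^2 / 2). *)
Lemma avg_expR_le (a b : R) : (expR (a + b) + expR (a - b)) / 2 <= expR (a + b ^+ 2 / 2).
Proof.
wlog b0 : b / 0 <= b.
  move=> h; case: (leP 0 b) => [/h//|b0].
  have := h (- b); rewrite oppr_ge0 (ltW b0) sqrrN opprK => /(_ isT).
  by rewrite [X in X / 2]addrC.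
have m0 : -1 <= (0 : R) <= 1 by apply/andP; split; lra.
have := two_point_mgf_le m0 b0.
rewrite mul0r add0r !addr0 subr0 !expRD => h.
have := ler_wpM2l (expR_ge0 a) h; lra.
Qed.

Lemma expR_avg_le (a b : R) : expR ((a + b) / 2) <= (expR a + expR b) / 2.
Proof.
have -> : expR a = expR ((a + b) / 2 + (a - b) / 2) by congr expR; field.
have -> : expR b = expR ((a + b) / 2 - (a - b) / 2) by congr expR; field.
set m := (a + b) / 2; set e := (a - b) / 2.
rewrite !expRD; have := expR_gt0 m; have := expR_ge1Dx e; have := expR_ge1Dx (- e).
by move=> h1 h2 h3; rewrite -mulrDr -mulrA ler_peMr ?expR_ge0//; lra.
Qed.

(** Convexity moves exp inside each sign average, the exponential of a maximum is at most the sum of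
    the exponentials, and averaging out the sign of F_i u costs a factor cosh (lam F_i u) <= exp
    (lam^2 (F_i u)^2 / 2). *)
Lemma expR_rademacher_max n (F : 'I_n -> I -> R) L lam : 0 <= lam ->
  expR (lam * rademacher_max F L) <=
  \sum_u expR (lam * L u + lam ^+ 2 / 2 * \sum_i F i u ^+ 2).
Proof.
move=> lam0; elim: n F L => [|n IH] F L /=.
  have [u ->] := fmax_ex L; rewrite (bigD1 u)//= big_ord0 mulr0 addr0 lerDl.
  by apply: sumr_ge0 => i _; exact: expR_ge0.
set a := rademacher_max _ _; set b := rademacher_max _ _.
rewrite (_ : lam * _ = (lam * a + lam * b) / 2); last by field.
apply: le_trans (expR_avg_le _ _) _.
apply: (@le_trans _ _ ((\sum_u expR (lam * (L u + F ord0 u) +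
    lam ^+ 2 / 2 * \sum_i F (lift ord0 i) u ^+ 2) +
  \sum_u expR (lam * (L u - F ord0 u) +
    lam ^+ 2 / 2 * \sum_i F (lift ord0 i) u ^+ 2)) / 2)).
  by rewrite ler_pM2r ?invr_gt0// lerD// IH.
rewrite -big_split/= mulr_suml ler_sum// => u _.
rewrite big_ord_recl/=; set s := \sum_i _.
rewrite (_ : lam * (L u + F ord0 u) + _ =
  (lam * L u + lam ^+ 2 / 2 * s) + lam * F ord0 u); last by ring.
rewrite (_ : lam * (L u - F ord0 u) + _ =
  (lam * L u + lam ^+ 2 / 2 * s) - lam * F ord0 u); last by ring.
apply: le_trans (avg_expR_le _ _) _; rewrite ler_expR le_eqVlt.
by apply/orP; left; apply/eqP; field.
Qed.

(** Massart's finite class bound: take logarithms in the exponential moment inequality and optimize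
    over lam. *)
Lemma rademacher_max_le n (F : 'I_n -> I -> R) (s : R) : (1 < #|I|)%N -> 0 <= s ->
  (forall u, \sum_i F i u ^+ 2 <= s ^+ 2) ->
  rademacher_max F (fun=> 0) <= s * Num.sqrt (2 * ln #|I|%:R).
Proof.
move=> I1 s0 Fs; set r := rademacher_max _ _.
have K1 : (1 : R) < #|I|%:R by rewrite ltr1n.
have lK : 0 < ln #|I|%:R :> R by rewrite ln_gt0.
have main lam : 0 < lam -> lam * r <= ln #|I|%:R + lam ^+ 2 / 2 * s ^+ 2.
  move=> lam0; rewrite -ler_expR expRD lnK ?posrE; last by rewrite (lt_trans _ K1).
  apply: le_trans (expR_rademacher_max F (fun=> 0) (ltW lam0)) _.
  rewrite mulr_natl -sumr_const ler_sum// => u _.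
  by rewrite ler_expR mulr0 add0r ler_wpM2l ?Fs// divr_ge0// sqr_ge0.
have [s_gt0|] := ltP 0 s; last first.
  move=> s_le0; have sE : s = 0 by apply/eqP; rewrite eq_le s_le0.
  rewrite sE mul0r leNgt; apply/negP => r0.
  (* With s = 0 no lam is optimal. This one gives 2 ln |I| <= ln |I|, impossible as |I| > 1. *)
  have := main (2 * ln #|I|%:R / r); rewrite divr_gt0 ?mulr_gt0// => /(_ isT).
  by rewrite sE expr0n/= mulr0 addr0 divfK ?lt0r_neq0//; lra.
set q := Num.sqrt _; have q0 : 0 < q by rewrite sqrtr_gt0 mulr_gt0.
have q2 : q ^+ 2 = 2 * ln #|I|%:R by rewrite sqr_sqrtr// mulr_ge0// ltW.
(* The minimizer of ln |I| / lam + lam s^2 / 2. *)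
have := main (q / s); rewrite divr_gt0// => /(_ isT).
rewrite (_ : (q / s) ^+ 2 / 2 * s ^+ 2 = q ^+ 2 / 2); last by field; rewrite lt0r_neq0.
rewrite (_ : ln _ = q ^+ 2 / 2); last by rewrite q2; field.
rewrite -splitr mulrAC ler_pdivrMr// expr2 -mulrA.
by rewrite ler_pM2l// mulrC.
Qed.

End finite_max.

(** Duality of the l1 and sup norms: a linear form is at most rho times the largest signed
    coordinate of L. A family of any size is thereby reduced to the 2p pairs (j, sign). The offset L
    is arbitrary because the induction absorbs the signed terms into it. *)
Lemma rademacher_max_linear_le (R : realType) (I : finType) (i0 : I) p (j0 : 'I_p * bool)
    n (v : I -> 'I_p -> R) (rho : R) (X : 'I_n -> 'I_p -> R) (L : 'I_p -> R) :
  (forall u, \sum_j `|v u j| <= rho) ->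
  rademacher_max i0 (fun i u => \sum_j v u j * X i j) (fun u => \sum_j v u j * L j) <=
  rho * rademacher_max j0 (fun i jb => (-1) ^+ jb.2 * X i jb.1)
                          (fun jb => (-1) ^+ jb.2 * L jb.1).
Proof.
move=> vrho; elim: n X L => [|n IH] X L /=.
  apply: fmax_le => u; set m := fmax _ _.
  have mL j : `|L j| <= m.
    rewrite ler_norml lerNl.
    have := fmax_ge j0 (fun jb => (-1) ^+ jb.2 * L jb.1) (j, true).
    have := fmax_ge j0 (fun jb => (-1) ^+ jb.2 * L jb.1) (j, false).
    by rewrite -/m/= mul1r mulN1r => -> ->.
  have m0 : 0 <= m by apply: le_trans (mL j0.1).
  apply: (@le_trans _ _ (\sum_j `|v u j| * m)).
    apply: ler_sum => j _; apply: le_trans (ler_norm _) _.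
    by rewrite normrM ler_wpM2l.
  by rewrite -mulr_suml ler_wpM2r.
rewrite mulrA ler_pM2r ?invr_gt0// mulrDr; apply: lerD.
- under [X in rademacher_max _ _ X]eq_fun do rewrite -big_split/=.
  under [X in rademacher_max _ _ X]eq_fun do under eq_bigr do rewrite -mulrDr.
  under [X in _ <= _ * rademacher_max _ _ X]eq_fun do rewrite -mulrDr.
  exact: (IH (fun i => X (lift ord0 i)) (fun j => L j + X ord0 j)).
- under [X in rademacher_max _ _ X]eq_fun do rewrite -sumrB/=.
  under [X in rademacher_max _ _ X]eq_fun do under eq_bigr do rewrite -mulrBr.
  under [X in _ <= _ * rademacher_max _ _ X]eq_fun do rewrite -mulrBr.
  exact: (IH (fun i => X (lift ord0 i)) (fun j => L j - X ord0 j)).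
Qed.

(** * Symmetrization and contraction *)

Section symmetrization.
Context {R : realType} {d} {T : measurableType d} (P : probability T R).
Context {I : finType} (i0 : I).

(** The function L stands for the contribution of all other observations, frozen while one of them
    is treated; hence the quantification over every L. *)
Definition sign_dominated (f v : I -> T -> R) := forall L : I -> R,
  \int[P]_w fmax i0 (fun u => L u + (f u w - \int[P]_w' f u w')) <=
  \int[P]_w ((fmax i0 (fun u => L u + v u w) + fmax i0 (fun u => L u - v u w)) / 2).

(* Symmetrization and contraction in one step: for maximizers u and u' the ghost
   sample contributes (f u - f u')(w) - (f u - f u')(w'), and only the increments
   |v u - v u'| are seen by the sum of the two maxima on the right. *)
Lemma increments_sign_dominated (f v : I -> T -> R) (D : I -> I -> T -> R) :
  (forall u, bounded_mfun (f u)) -> (forall u, bounded_mfun (v u)) ->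
  (forall u u', bounded_mfun (D u u')) ->
  (forall u u' w, `|f u w - f u' w| <= D u u' w) ->
  (forall L, \int[P]_w fmax (i0, i0) (fun z => L z.1 + L z.2 + 2 * D z.1 z.2 w) <=
     \int[P]_w fmax (i0, i0) (fun z => L z.1 + L z.2 + 2 * `|v z.1 w - v z.2 w|)) ->
  sign_dominated f (fun u w => 2 * v u w).
Proof.
move=> bf bv bD fD DV L.
pose S (z : T * T) := fmax i0 (fun u => L u + (f u z.1 - f u z.2)).
have bS : bounded_mfun S.
  apply: (bounded_mfun_fmax i0 (F := fun u z => L u + (f u z.1 - f u z.2))) => u.
  apply: bounded_mfunD; first exact: bounded_mfun_cst.
  by apply: bounded_mfunB;
    [exact: bounded_mfun_comp measurable_fst (bf u)|
     exact: bounded_mfun_comp measurable_snd (bf u)].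
pose G w := fmax (i0, i0) (fun z => L z.1 + L z.2 + 2 * D z.1 z.2 w).
have bG : bounded_mfun G.
  apply: (bounded_mfun_fmax (i0, i0) (F := fun z w => L z.1 + L z.2 + 2 * D z.1 z.2 w)) => z.
  by apply: bounded_mfunD; [exact: bounded_mfun_cst|exact: bounded_mfunZ].
have bK : bounded_mfun (fun w => fmax (i0, i0)
    (fun z => L z.1 + L z.2 + 2 * `|v z.1 w - v z.2 w|)).
  apply: (bounded_mfun_fmax (i0, i0)
    (F := fun z w => L z.1 + L z.2 + 2 * `|v z.1 w - v z.2 w|)) => z.
  apply: bounded_mfunD; first exact: bounded_mfun_cst.
  by apply/bounded_mfunZ/bounded_mfun_norm/bounded_mfunB.
have bM : bounded_mfun (fun w =>
    fmax i0 (fun u => L u + 2 * v u w) + fmax i0 (fun u => L u - 2 * v u w)).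
  apply: bounded_mfunD.
    apply: (bounded_mfun_fmax i0 (F := fun u w => L u + 2 * v u w)) => u.
    by apply: bounded_mfunD; [exact: bounded_mfun_cst|exact: bounded_mfunZ].
  apply: (bounded_mfun_fmax i0 (F := fun u w => L u - 2 * v u w)) => u.
  by apply: bounded_mfunB; [exact: bounded_mfun_cst|exact: bounded_mfunZ].
apply: (@le_trans _ _ (\int[P]_w \int[P]_w' S (w, w'))).
  apply: probability_le_Rintegral.
  - apply: (bounded_mfun_fmax i0 (F := fun u w => L u + (f u w - \int[P]_w' f u w'))) => u.
    apply: bounded_mfunD; first exact: bounded_mfun_cst.
    by apply: bounded_mfunB => //; exact: bounded_mfun_cst.
  - exact: (bounded_mfun_Rintegral1 P P bS).
  - move=> w; apply: fmax_le => u.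
    rewrite (_ : L u + _ = \int[P]_w' (L u + (f u w - f u w'))).
      apply: probability_le_Rintegral.
      + apply: bounded_mfunD; first exact: bounded_mfun_cst.
        by apply: bounded_mfunB => //; exact: bounded_mfun_cst.
      + exact: (bounded_mfun_pair1 bS).
      + by move=> w'; exact: (fmax_ge i0 (fun u => L u + (f u w - f u w'))).
    rewrite probability_RintegralD; [|exact: bounded_mfun_cst|]; last first.
      by apply: bounded_mfunB => //; exact: bounded_mfun_cst.
    rewrite probability_RintegralB//; last exact: bounded_mfun_cst.
    by rewrite !probability_Rintegral_cst.
rewrite -(bounded_Fubini1 P P bS).
under [leRHS]eq_Rintegral do rewrite mulrC.
rewrite [leRHS]probability_RintegralZ// mulrC ler_pdivlMr//.
apply: (@le_trans _ _ (\int[P]_w G w)); last first.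
  apply: le_trans (DV L) _; apply: probability_le_Rintegral => // w.
  apply: fmax_le => -[u u'] /=.
  have := fmax_ge i0 (fun u => L u + 2 * v u w) u.
  have := fmax_ge i0 (fun u => L u + 2 * v u w) u'.
  have := fmax_ge i0 (fun u => L u - 2 * v u w) u.
  have := fmax_ge i0 (fun u => L u - 2 * v u w) u'.
  by case: (ger0P (v u w - v u' w)) => _; lra.
have bS' : bounded_mfun (fun z : T * T => S (z.2, z.1)).
  exact: (bounded_mfun_comp (@measurable_swap _ _ T T) bS).
(* The integral is counted twice, the second time with the sample and its ghost exchanged, so that
   two maximizers u and u' come into play. *)
rewrite mulr_natr mulr2n.
rewrite {2}(_ : \int[(P \x P)%E]_z S z = \int[(P \x P)%E]_z S (z.2, z.1)); last first.
  by rewrite (bounded_Fubini2 P P bS) (bounded_Fubini1 P P bS').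
rewrite -probability_RintegralD//.
have bG1 : bounded_mfun (fun z : T * T => G z.1) := bounded_mfun_comp measurable_fst bG.
have bG2 : bounded_mfun (fun z : T * T => G z.2) := bounded_mfun_comp measurable_snd bG.
(* Half of [G] is charged to w and half to w'; this is why [G] carries twice the increment [D], and
   the origin of the factor 2 in front of v. *)
rewrite (_ : \int[P]_w G w = \int[(P \x P)%E]_z (2^-1 * (G z.1 + G z.2))); last first.
  rewrite probability_RintegralZ; last exact: bounded_mfunD.
  rewrite probability_RintegralD// (bounded_Fubini1 P P bG1) (bounded_Fubini2 P P bG2)/=.
  under [X in X + _]eq_Rintegral do rewrite probability_Rintegral_cst.
  under [X in _ + X]eq_Rintegral do rewrite probability_Rintegral_cst.
  by field.
apply: probability_le_Rintegral.
- exact: bounded_mfunD.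
- exact/bounded_mfunZ/bounded_mfunD.
- move=> [w w'] /=; rewrite /S /=.
  have [u ->] := fmax_ex i0 (fun u => L u + (f u w - f u w')).
  have [u' ->] := fmax_ex i0 (fun u => L u + (f u w' - f u w)).
  have := fmax_ge (i0, i0) (fun z => L z.1 + L z.2 + 2 * D z.1 z.2 w) (u, u').
  have := fmax_ge (i0, i0) (fun z => L z.1 + L z.2 + 2 * D z.1 z.2 w') (u, u').
  rewrite -/(G w) -/(G w') /=.
  have := fD u u' w; have := fD u u' w'; rewrite !ler_norml => /andP[? ?] /andP[? ?].
  lra.
Qed.

(** With the tail frozen into L, domination at the head replaces its centered term by a sign
    average. Then, with the head value w fixed, the induction hypothesis treats the tail for the
    offsets L + v(w) and L - v(w). *)
Lemma symmetrization_le n (f v : 'I_n -> I -> T -> R) (L : I -> R) :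
  (forall i u, bounded_mfun (f i u)) -> (forall i u, bounded_mfun (v i u)) ->
  (forall i, sign_dominated (f i) (v i)) ->
  \int[tuple_power P n]_t
    fmax i0 (fun u => L u + \sum_i (f i u (tnth t i) - \int[P]_w f i u w)) <=
  \int[tuple_power P n]_t rademacher_max i0 (fun i u => v i u (tnth t i)) L.
Proof.
elim: n f v L => [|n IH] f v L bf bv dom.
  rewrite !Rintegral_tuple_power0//=; [|exact: bounded_mfun_cst|].
    by apply: le_fmax => u; rewrite big_ord0 addr0.
  apply: (bounded_mfun_fmax i0 (F := fun u (t : 0.-tuple T) => L u +
    \sum_i (f i u (tnth t i) - \int[P]_w f i u w))) => u.
  by under eq_fun do rewrite big_ord0; exact: bounded_mfun_cst.
have btn m (g : T -> R) (i : 'I_m) : bounded_mfun g ->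
    bounded_mfun (fun t : m.-tuple T => g (tnth t i)).
  exact: bounded_mfun_comp (@measurable_tnth _ T m i).
pose f' i := f (lift ord0 i); pose v' i := v (lift ord0 i).
pose Sg (t : n.-tuple T) u := \sum_i (f' i u (tnth t i) - \int[P]_w f' i u w).
have bSg u : bounded_mfun (Sg ^~ u).
  apply: bounded_mfun_sum => i; apply: bounded_mfunB; last exact: bounded_mfun_cst.
  exact: (btn _ _ _ (bf _ _)).
have bA : bounded_mfun (fun t : n.+1.-tuple T => fmax i0 (fun u => L u +
    \sum_i (f i u (tnth t i) - \int[P]_w f i u w))).
  apply: (bounded_mfun_fmax i0 (F := fun u (t : n.+1.-tuple T) => L u +
    \sum_i (f i u (tnth t i) - \int[P]_w f i u w))) => u.
  apply: bounded_mfunD; first exact: bounded_mfun_cst.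
  apply: bounded_mfun_sum => i; apply: bounded_mfunB; last exact: bounded_mfun_cst.
  exact: (btn _ _ _ (bf _ _)).
have bB : bounded_mfun (fun t : n.+1.-tuple T =>
    rademacher_max i0 (fun i u => v i u (tnth t i)) L).
  apply: (bounded_mfun_rademacher_max i0 (F := fun i u (t : n.+1.-tuple T) =>
    v i u (tnth t i)) (L := fun u _ => L u)) => [i u|u]; first exact: (btn _ _ _ (bv _ _)).
  exact: bounded_mfun_cst.
have bAc := bounded_mfun_comp (@measurable_tcons _ T n) bA.
have bBc := bounded_mfun_comp (@measurable_tcons _ T n) bB.
rewrite !Rintegral_tuple_powerS// (bounded_Fubini2 _ _ bAc) (bounded_Fubini1 _ _ bBc).
pose Mp (z : T * n.-tuple T) := fmax i0 (fun u => L u + v ord0 u z.1 + Sg z.2 u).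
pose Mm (z : T * n.-tuple T) := fmax i0 (fun u => L u - v ord0 u z.1 + Sg z.2 u).
have b1 u : bounded_mfun (fun z : T * n.-tuple T => v ord0 u z.1).
  exact: bounded_mfun_comp measurable_fst (bv ord0 u).
have b2 u : bounded_mfun (fun z : T * n.-tuple T => Sg z.2 u).
  exact: bounded_mfun_comp measurable_snd (bSg u).
have bMp : bounded_mfun Mp.
  apply: (bounded_mfun_fmax i0
    (F := fun u (z : T * n.-tuple T) => L u + v ord0 u z.1 + Sg z.2 u)) => u.
  by apply: bounded_mfunD => //; apply: bounded_mfunD => //; exact: bounded_mfun_cst.
have bMm : bounded_mfun Mm.
  apply: (bounded_mfun_fmax i0
    (F := fun u (z : T * n.-tuple T) => L u - v ord0 u z.1 + Sg z.2 u)) => u.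
  by apply: bounded_mfunD => //; apply: bounded_mfunB => //; exact: bounded_mfun_cst.
have bMpm : bounded_mfun (fun z => 2^-1 * (Mp z + Mm z)).
  exact/bounded_mfunZ/bounded_mfunD.
apply: (@le_trans _ _ (\int[tuple_power P n]_t \int[P]_w (2^-1 * (Mp (w, t) + Mm (w, t))))).
  apply: probability_le_Rintegral.
  - exact: (bounded_mfun_Rintegral2 P (tuple_power P n) bAc).
  - exact: (bounded_mfun_Rintegral2 P (tuple_power P n) bMpm).
  move=> t; have := dom ord0 (fun u => L u + Sg t u).
  congr (_ <= _); apply: eq_Rintegral => w _ /=.
    congr fmax; apply/funext => u; rewrite big_ord_recl/= -addrA; congr (_ + _).
    rewrite addrC; congr (_ + _).
    by apply: eq_bigr => i _; rewrite /f' /tcons tnthS.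
  rewrite mulrC; congr (_ * (_ + _)); congr fmax; apply/funext => u /=.
    by rewrite -!addrA; congr (_ + _); rewrite addrC.
  by rewrite -!addrA; congr (_ + _); rewrite addrC.
rewrite -(bounded_Fubini2 _ _ bMpm) (bounded_Fubini1 _ _ bMpm).
apply: probability_le_Rintegral.
- exact: (bounded_mfun_Rintegral1 P (tuple_power P n) bMpm).
- exact: (bounded_mfun_Rintegral1 P (tuple_power P n) bBc).
move=> w; pose Rp t := rademacher_max i0 (fun i u => v' i u (tnth t i)) (fun u => L u + v ord0 u w).
pose Rm t := rademacher_max i0 (fun i u => v' i u (tnth t i)) (fun u => L u - v ord0 u w).
have bRp : bounded_mfun Rp.
  apply: (bounded_mfun_rademacher_max i0 (F := fun i u t => v' i u (tnth t i))
    (L := fun u _ => L u + v ord0 u w)) => [i u|u]; [exact: (btn _ _ _ (bv _ _))|exact: bounded_mfun_cst].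
have bRm : bounded_mfun Rm.
  apply: (bounded_mfun_rademacher_max i0 (F := fun i u t => v' i u (tnth t i))
    (L := fun u _ => L u - v ord0 u w)) => [i u|u]; [exact: (btn _ _ _ (bv _ _))|exact: bounded_mfun_cst].
rewrite [leRHS](_ : _ = \int[tuple_power P n]_t (2^-1 * (Rp t + Rm t))); last first.
  apply: eq_Rintegral => t _; rewrite /= mulrC; congr (_ * (_ + _));
  congr rademacher_max; apply/funext => i; apply/funext => u; by rewrite /tcons tnthS.
rewrite !probability_RintegralZ; [|exact: bounded_mfunD|]; last first.
  by apply: bounded_mfunD; [exact: bounded_mfun_pair1 bMp _|exact: bounded_mfun_pair1 bMm _].
rewrite ler_pM2l ?invr_gt0// !probability_RintegralD//; last first.
- exact: bounded_mfun_pair1 bMm _.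
- exact: bounded_mfun_pair1 bMp _.
have IH' L' := IH f' v' L' (fun i => bf _) (fun i => bv _) (fun i => dom _).
apply: lerD; first exact: (IH' (fun u => L u + v ord0 u w)).
exact: (IH' (fun u => L u - v ord0 u w)).
Qed.

End symmetrization.

(** * The slope of g and the function varrho *)

Lemma near_dist_le (R : realType) (x e : R) : 0 < e -> \forall y \near x, `|x - y| <= e.
Proof. exact: (@cvgr_dist_le _ _ _ (nbhs x) _ id x). Qed.

Section slope.
Context {R : realType} (g : R -> R) (F1 F2 : R).
Hypothesis g_diff : forall t, derivable g t 1.
Hypothesis dg_bnd : forall t, `|derive1 g t| <= F1.
Hypothesis dg_lip : forall t s, `|derive1 g t - derive1 g s| <= F2 * `|t - s|.

Definition slope (t v : R) : R := if v == 0 then derive1 g t else (g (t + v) - g t) / v.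

Lemma slopeE t v : v * slope t v = g (t + v) - g t.
Proof.
rewrite /slope; case: eqP => [->|/eqP v0]; first by rewrite mul0r addr0 subrr.
by rewrite mulrC divfK.
Qed.

Let dg (t : R) : is_derive t (1 : R) g (derive1 g t).
Proof. by split; [exact: g_diff|rewrite derive1E]. Qed.

(* A primitive of tau |-> g'(t + tau v) with increment slope t v over [0, 1]. *)
Let prim (t v tau : R) : R := if v == 0 then derive1 g t * tau else g (t + tau * v) / v.

Let prim01 t v : prim t v 1 - prim t v 0 = slope t v.
Proof.
rewrite /prim /slope; case: eqP => _; first by rewrite mulr1 mulr0 subr0.
by rewrite mul1r mul0r addr0 mulrBl.
Qed.

Let dprim t v (tau : R) : is_derive tau (1 : R) (prim t v) (derive1 g (t + tau * v)).
Proof.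
rewrite /prim; have [->|v0] := eqVneq v 0.
  by apply: is_derive_eq; rewrite mulr0 addr0 /GRing.scale/= mulr1.
have da : is_derive tau (1 : R) (fun s : R => t + s * v) v.
  by apply: is_derive_eq; rewrite /GRing.scale/=; ring.
have dc := @is_derive1_comp R g (fun s => t + s * v) tau _ _ (dg (t + tau * v)) da.
have -> : (fun s => g (t + s * v) / v) = (fun s => v^-1 * g (t + s * v)).
  by apply/funext => s; rewrite mulrC.
apply: is_derive_eq.
by rewrite /GRing.scale/= mulrCA mulVf// mulr1.
Qed.

Lemma normr_slope_le t v : `|slope t v| <= F1.
Proof.
have [c _] := MVT_is_derive (@ler01 R) (fun x _ => dprim t v x).
by rewrite prim01 subr0 mulr1 => ->.
Qed.

(** The slope is the mean of g'(t + tau v) over tau in [0, 1], and the integrands for v and w differ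
    by at most F2 tau |v - w|; the mean of tau gives the factor 1/2. The monotone function [K] takes
    the place of that integration. *)
Lemma slope_lip t v w : `|slope t v - slope t w| <= F2 / 2 * `|v - w|.
Proof.
wlog suff le : v w / slope t v - slope t w <= F2 / 2 * `|v - w|.
  by rewrite ler_norml lerNl opprB -{1}(distrC w) !le.
pose K tau := F2 / 2 * `|v - w| * tau ^+ 2 - (prim t v tau - prim t w tau).
have dK (tau : R) : is_derive tau (1 : R) K
    (F2 * `|v - w| * tau - (derive1 g (t + tau * v) - derive1 g (t + tau * w))).
  have d1 := dprim t v tau; have d2 := dprim t w tau.
  rewrite /K; apply: is_derive_eq; rewrite /GRing.scale/=.
  by congr (_ - _); field.
have := @is_derive_ge0_le _ _ _ 0 1 ler01 (fun x _ => dK x).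
have -> : K 0 = - (prim t v 0 - prim t w 0) by rewrite /K expr0n mulr0 sub0r.
have -> : K 1 = F2 / 2 * `|v - w| - (prim t v 1 - prim t w 1).
  by rewrite /K expr1n mulr1.
rewrite -!prim01 => h; suff /h : forall x, 0 <= x <= 1 -> 0 <= F2 * `|v - w| * x -
  (derive1 g (t + x * v) - derive1 g (t + x * w)) by lra.
move=> x /andP[x0 _]; rewrite subr_ge0; apply: le_trans (ler_norm _) _.
apply: le_trans (dg_lip _ _) _.
rewrite (_ : t + x * v - _ = x * (v - w)); last by ring.
by rewrite normrM (ger0_norm x0) [x * _]mulrC mulrA.
Qed.

Lemma measurable_derivable : measurable_fun setT g.
Proof.
apply: continuous_measurable_fun => x.
exact/differentiable_continuous/derivable1_diffP.
Qed.

Lemma measurable_derive1_lip : measurable_fun setT (derive1 g).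
Proof.
apply: continuous_measurable_fun => x; apply/cvgrPdist_le => /= e e0.
have F20 : 0 <= F2.
  by have := le_trans (normr_ge0 _) (dg_lip 1 0); rewrite subr0 normr1 mulr1.
near=> y; apply: le_trans (dg_lip _ _) _.
(* F2 may be 0, hence the division by F2 + 1. *)
apply: (@le_trans _ _ ((F2 + 1) * `|x - y|)); first by rewrite ler_wpM2r// lerDl.
rewrite mulrC -ler_pdivlMr ?ltr_wpDl//.
by near: y; apply: near_dist_le; rewrite divr_gt0// ltr_wpDl.
Unshelve. all: by end_near. Qed.

Lemma measurable_slope d (T : measurableType d) (t v : T -> R) :
  measurable_fun setT t -> measurable_fun setT v ->
  measurable_fun setT (fun x => slope (t x) (v x)).
Proof.
move=> mt mv; apply: measurable_fun_ifT.
- exact: measurable_fun_eqr.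
- exact: measurableT_comp measurable_derive1_lip mt.
- apply: measurable_funM; last exact: measurable_funV.
  apply: measurable_funB; last exact: measurableT_comp measurable_derivable mt.
  by apply: measurableT_comp measurable_derivable _; exact: measurable_funD.
Qed.

End slope.

Section varrho_bounds.
Context {R : realType}.
Local Notation varrho := (@varrho R).

Lemma ln_varrho (t : R) : ln t = (t - 1) * (1 + varrho (t - 1)).
Proof.
rewrite /Defs.varrho subr_eq0; case: eqVneq => [->|t1]; first by rewrite ln1 subrr mul0r.
rewrite [1 + (t - 1)]addrC subrK; field; by rewrite subr_eq0.
Qed.

Lemma ln_ge_1BV (t : R) : 0 < t -> 1 - t^-1 <= ln t.
Proof.
move=> t0; have ti : 0 < t^-1 by rewrite invr_gt0.
have := @le_ln1Dx _ (t^-1 - 1).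
rewrite ltrBrDl subrr => /(_ ti); rewrite addrC subrK lnV ?posrE//; lra.
Qed.

Lemma ln_le_B1 (t : R) : 0 < t -> ln t <= t - 1.
Proof.
by move=> t0; have := @le_ln1Dx _ (t - 1); rewrite ltrBrDl subrr addrC subrK => /(_ t0).
Qed.

(** From 1 - 1/t <= ln t <= t - 1 follows 0 <= (t - 1) - ln t <= (t - 1)^2 / t, to be divided by |t
    - 1|. *)
Lemma normr_varrho_le (t : R) : 0 < t -> `|varrho (t - 1)| <= `|t - 1| / t.
Proof.
move=> t0; rewrite /Defs.varrho; case: eqVneq => [->|t1].
  by rewrite normr0 mul0r.
rewrite [1 + (t - 1)]addrC subrK.
have ti : 0 < t^-1 by rewrite invr_gt0.
have tt : t * t^-1 = 1 by rewrite divff// lt0r_neq0.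
have h1 := ln_ge_1BV t0; have h2 := ln_le_B1 t0.
rewrite (_ : (t - 1)^-1 * ln t - 1 = (ln t - (t - 1)) / (t - 1)); last by field.
rewrite normrM normfV ler_pdivrMr ?normr_gt0//.
rewrite ler0_norm; last by lra.
rewrite mulrAC -expr2 real_normK ?num_real//.
by nra.
Qed.

Lemma is_derive_varrho (t : R) : 0 < t -> t != 1 ->
  is_derive (t - 1) (1 : R) varrho ((1 - t^-1 - ln t) / (t - 1) ^+ 2).
Proof.
move=> t0 t1; have t10 : t - 1 != 0 by rewrite subr_eq0.
have h : is_derive (t - 1) (1 : R) (fun z => z^-1 * ln (1 + z) - 1)
    ((1 - t^-1 - ln t) / (t - 1) ^+ 2).
  have e1 : 1 + (t - 1) = t by ring.
  have d1 : is_derive (1 + (t - 1)) (1 : R) (@ln R) t^-1.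
    by rewrite e1; exact: (is_derive1_ln t0).
  have d2 : is_derive (t - 1) (1 : R) (cst 1 + id : R -> R) 1.
    by apply: is_derive_eq; rewrite add0r.
  have d3 : is_derive (t - 1) (1 : R) (fun z => ln (1 + z)) (t^-1 * 1).
    exact: (@is_derive1_comp R (@ln R) _ _ _ _ d1 d2).
  have d4 : is_derive (t - 1) (1 : R) (fun z => z^-1) (- (t - 1) ^- 2 *: 1).
    exact: (@is_deriveV R id _ _ _ t10 (is_derive_id (t - 1) (1 : R))).
  apply: is_derive_eq; rewrite /GRing.scale/= e1; field.
  by rewrite t10 lt0r_neq0.
apply: (near_eq_is_derive _ h).
have : nbhs (t - 1) (~` [set (0 : R)]).
  apply: open_nbhs_nbhs; split; last exact/eqP.
  by apply: closed_openC; exact: closed_eq.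
apply: filterS => z /= /eqP z0; rewrite /Defs.varrho.
by rewrite (negbTE z0).
Qed.

(** The same two bounds on ln put the numerator 1 - 1/t - ln t between - (t - 1)^2 / t and 0. *)
Lemma normr_derive1_varrho_le (t : R) : 0 < t -> t != 1 ->
  `|derive1 varrho (t - 1)| <= t^-1.
Proof.
move=> t0 t1; have [_ dv] := is_derive_varrho t0 t1.
have t10 : t - 1 != 0 by rewrite subr_eq0.
have ti : 0 < t^-1 by rewrite invr_gt0.
have tt : t * t^-1 = 1 by rewrite divff// lt0r_neq0.
have h1 := ln_ge_1BV t0; have h2 := ln_le_B1 t0.
rewrite derive1E dv normrM normfV ler_pdivrMr; last first.
  by rewrite normr_gt0 expf_neq0.
rewrite (ger0_norm (sqr_ge0 _)) ler0_norm; last by lra.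
nra.
Qed.

Context (Ag Bg : R).
Hypotheses (Ag0 : 0 < Ag) (AgBg : Ag < Bg).
Local Notation rho0 := (varrho0 Ag Bg).
Local Notation rho1 := (varrho1 Ag Bg).

Let Bg0 : 0 < Bg. Proof. exact: lt_trans AgBg. Qed.

Let lo0 : 0 < Ag / Bg. Proof. exact: divr_gt0. Qed.

Let itv_gt0 t : Ag / Bg <= t -> 0 < t. Proof. exact: lt_le_trans. Qed.

Let itv_inv t : Ag / Bg <= t -> t^-1 <= Bg / Ag.
Proof.
move=> h; rewrite -(invf_div Ag Bg) lef_pV2// posrE//; exact: itv_gt0.
Qed.

Let ratio1 : 1 < Bg / Ag. Proof. by rewrite ltr_pdivlMr// mul1r. Qed.

Lemma varrho0_ge t : Ag / Bg <= t <= Bg / Ag -> `|varrho (t - 1)| <= rho0.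
Proof.
move=> /andP[h1 h2]; apply: ub_le_sup; last first.
  by exists t => //=; rewrite in_itv/= h1.
(* A crude bound, which makes [sup] a true supremum and not a default value. *)
exists ((Bg / Ag + 1) * (Bg / Ag)) => _ [s + <-]; rewrite /= in_itv/= => /andP[s1 s2].
have s0 := itv_gt0 s1; apply: le_trans (normr_varrho_le s0) _.
apply: ler_pM; rewrite ?normr_ge0 ?invr_ge0 ?(ltW s0) ?itv_inv//.
by rewrite (le_trans (ler_normB _ _))// normr1 lerD2r ger0_norm// ltW.
Qed.

Lemma varrho1_ge t : Ag / Bg <= t <= Bg / Ag -> `|derive1 varrho (t - 1)| <= rho1.
Proof.
move=> /andP[h1 h2]; apply: ub_le_sup; last first.
  by exists t => //=; rewrite in_itv/= h1.
(* Whatever value [derive1] has at 0, it is a single number and enters the bound as it stands;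
   elsewhere 1/t <= Bg / Ag applies. *)
exists (Num.max `|derive1 varrho 0| (Bg / Ag)) => _ [s + <-].
rewrite /= in_itv/= => /andP[s1 s2]; have s0 := itv_gt0 s1.
rewrite le_max; have [->|sN1] := eqVneq s 1; first by rewrite subrr lexx.
by apply/orP; right; exact: le_trans (normr_derive1_varrho_le s0 sN1) (itv_inv s1).
Qed.

(** At t = Bg / Ag > 1 the inequality ln t < t - 1 is strict. Positivity makes psi_4 an admissible
    constant in McDiarmid's inequality and psi_6 positive. *)
Lemma varrho0_gt0 : 0 < rho0.
Proof.
have h : Ag / Bg <= Bg / Ag <= Bg / Ag.
  rewrite lexx andbT (@le_trans _ _ 1)// ?(ltW ratio1)//.
  by rewrite ler_pdivrMr// mul1r ltW.
apply: lt_le_trans (varrho0_ge h); rewrite normr_gt0.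
have t0 : Bg / Ag - 1 != 0 by rewrite subr_eq0 gt_eqF.
rewrite /Defs.varrho (negbTE t0) [1 + (_ - 1)]addrC subrK.
have lt1 : ln (Bg / Ag) < Bg / Ag - 1.
  rewrite -ltr_expR lnK ?posrE; last exact: lt_trans ratio1.
  by have := expR_gt1Dx t0; rewrite addrC subrK.
rewrite subr_eq0; apply/eqP => /(congr1 (fun r => (Bg / Ag - 1) * r)).
by rewrite mulrA divff// mul1r mulr1 => e; rewrite e ltxx in lt1.
Qed.

Lemma varrho1_ge0 : 0 <= rho1.
Proof.
apply: le_trans (@varrho1_ge 1 _); first exact: normr_ge0.
by rewrite ler_pdivrMr// mul1r ler_pdivlMr// mul1r !ltW.
Qed.

Lemma varrho_lip t s : Ag / Bg <= t <= Bg / Ag -> Ag / Bg <= s <= Bg / Ag ->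
  `|varrho (t - 1) - varrho (s - 1)| <= rho1 * `|t - s|.
Proof.
wlog st : s t / s <= t.
  move=> h ti si; case: (leP s t) => [st|/ltW ts]; first exact: h.
  by rewrite distrC [`|t - s|]distrC; exact: h.
(* varrho is not known to be differentiable at 0, hence the split at 1. *)
have away a b : Ag / Bg <= a -> a <= b -> b <= Bg / Ag -> 1 <= a \/ b <= 1 ->
    `|varrho (b - 1) - varrho (a - 1)| <= rho1 * (b - a).
  move=> ha ab hb one; have a0 := itv_gt0 ha.
  have [c cab] : exists2 c, c \in `[a - 1, b - 1]%R &
      varrho (b - 1) - varrho (a - 1) = derive1 varrho c * (b - 1 - (a - 1)).
    apply: MVT_segment; first by rewrite lerB.
      move=> x; rewrite in_itv/= => /andP[x1 x2].
      have x10 : x + 1 != 1 by rewrite addrC -subr_eq0 addrAC subrr add0r; apply/eqP => x0; case: one; lra.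
      have xp : 0 < x + 1 by lra.
      have := is_derive_varrho xp x10; rewrite addrK => -[dx _].
      by split=> //; rewrite derive1E.
    apply: continuous_in_subspaceT => x; rewrite inE/= in_itv/= => /andP[x1 x2].
    have xp : 0 < x + 1 by lra.
    have [x10|x10] := eqVneq (x + 1) 1; last first.
      have := is_derive_varrho xp x10; rewrite addrK => -[dx _].
      exact/differentiable_continuous/derivable1_diffP.
    have -> : x = 0 by lra.
    (* Continuity at 0: if |y| is at most 1/2 and e/2, then |varrho y| <= |y| / (1 + y) <= 2 |y| <=
       e. *)
    apply/cvgrPdist_le => /= e e0; near=> y.
    rewrite {1}/Defs.varrho eqxx sub0r normrN.
    have y1 : 2^-1 <= y + 1.
      have : `|0 - y| <= 2^-1 :> R.
        by near: y; apply: near_dist_le; rewrite invr_gt0.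
      by rewrite sub0r normrN ler_norml => /andP[]; lra.
    have yp : 0 < y + 1 by lra.
    have := normr_varrho_le yp; rewrite addrK => /le_trans; apply.
    rewrite ler_pdivrMr// (@le_trans _ _ (e / 2))//; last by nra.
    have : `|0 - y| <= e / 2.
      by near: y; apply: near_dist_le; rewrite divr_gt0.
    by rewrite sub0r normrN.
  move: cab; rewrite in_itv/= => /andP[c1 c2] ->.
  rewrite normrM (_ : b - 1 - (a - 1) = b - a); last by ring.
  rewrite (ger0_norm (_ : 0 <= b - a)) ?subr_ge0// ler_wpM2r ?subr_ge0//.
  have := @varrho1_ge (c + 1); rewrite addrK; apply; lra.
move=> /andP[t1 t2] /andP[s1 s2]; rewrite (ger0_norm (_ : 0 <= t - s)) ?subr_ge0//.
case: (leP 1 s) => s1'; first by apply: away => //; left.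
case: (leP t 1) => t1'; first by apply: away => //; right.
have := away s 1 s1 (ltW s1') _ (or_intror (lexx _)); rewrite (ltW ratio1) => /(_ isT) h1.
have := away 1 t _ (ltW t1') t2 (or_introl (lexx _)).
rewrite ler_pdivrMr// mul1r (ltW AgBg) => /(_ isT) h2.
rewrite (_ : varrho (t - 1) - varrho (s - 1) = (varrho (t - 1) - varrho (1 - 1)) +
  (varrho (1 - 1) - varrho (s - 1))); last by ring.
apply: le_trans (ler_normD _ _) _; lra.
Unshelve. all: by end_near. Qed.

End varrho_bounds.

(** * Laws with a density and conditional means *)

Section sfinite_partial_integral.
Local Open Scope ereal_scope.
Context {R : realType} {d1 d2} {X : measurableType d1} {Y : measurableType d2}.
Context (mu : {sfinite_measure set X -> \bar R}).

(** Tonelli's measurability for an s-finite measure: mu is a countable sum of finite measures, and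
    the partial integrals against these are summed. *)
Lemma measurable_partial_integral (F : X * Y -> \bar R) :
  measurable_fun setT F -> (forall z, 0 <= F z) ->
  measurable_fun setT (fun y => \int[mu]_x F (x, y)).
Proof.
move=> mF F0; pose s := sfinite_measure_seq mu.
rewrite (_ : (fun _ => _) = (fun y => \sum_(n <oo) \int[s n]_x F (x, y))).
  apply: ge0_emeasurable_sum; first by move=> k x *; exact: integral_ge0.
  by move=> k _; exact: measurable_fun_fubini_tonelli_G.
apply/funext => y; rewrite (eq_measure_integral (mseries s 0)).
  by rewrite ge0_integral_measure_series//; exact: measurableT_comp.
by move=> A mA _; exact: sfinite_measure_seqP.
Qed.

End sfinite_partial_integral.

Section law_with_density.
Local Open Scope ereal_scope.
Context {R : realType} {d1 d2} {X : measurableType d1} {Y : measurableType d2}.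
Context (mu : {sfinite_measure set X -> \bar R}) (nu : {sfinite_measure set Y -> \bar R}).
Context (Lam : {measure set (X * Y) -> \bar R}) (r : X * Y -> R).
Hypothesis mr : measurable_fun setT r.
Hypothesis r0 : forall z, (0 <= r z)%R.
Hypothesis LamE : forall B, measurable B ->
  Lam B = \int[nu]_y \int[mu]_x (\1_B (x, y) * r (x, y))%:E.

Let J (F : X * Y -> \bar R) := \int[nu]_y \int[mu]_x (F (x, y) * (r (x, y))%:E).

Let mFr F : measurable_fun setT F -> measurable_fun setT (fun z => F z * (r z)%:E).
Proof. by move=> mF; apply: emeasurable_funM => //; exact/measurable_EFinP. Qed.

Let Fr0 F : (forall z, 0 <= F z) -> forall z, 0 <= F z * (r z)%:E.
Proof. by move=> F0 z; rewrite mule_ge0// lee_fin. Qed.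

Let mJ F : measurable_fun setT F -> (forall z, 0 <= F z) ->
  measurable_fun setT (fun y => \int[mu]_x (F (x, y) * (r (x, y))%:E)).
Proof.
move=> mF F0.
exact: (measurable_partial_integral mu (mFr mF) (Fr0 F0)).
Qed.

Let JZ (c : R) F : measurable_fun setT F -> (forall z, 0 <= F z) -> (0 <= c)%R ->
  J (fun z => c%:E * F z) = c%:E * J F.
Proof.
move=> mF F0 c0; rewrite /J -ge0_integralZl//; last 2 first.
- exact: (mJ mF F0).
- by move=> y _; apply: integral_ge0 => x _; exact: Fr0.
apply: eq_integral => y _; rewrite -ge0_integralZl//.
- by apply: eq_integral => x _; rewrite muleA.
- exact: (measurableT_comp (mFr mF) (measurable_pair2 y)).
- by move=> x _; exact: Fr0.
Qed.

Let J_indic B : measurable B -> J (EFin \o \1_B) = Lam B.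
Proof. by move=> mB; rewrite LamE. Qed.

Import HBNNSimple.

Let J_nnsfun (h : {nnsfun (X * Y)%type >-> R}) : J (EFin \o h) = \int[Lam]_z (h z)%:E.
Proof.
have hE z : (h z)%:E = \sum_(c \in range h) c%:E * (\1_(h @^-1` [set c]) z)%:E.
  by rewrite [in LHS]fimfunE -fsumEFin//.
have m1 c : measurable_fun setT (fun z => c%:E * (\1_(h @^-1` [set c]) z)%:E : \bar R).
  by apply: measurable_funeM; exact/measurable_EFinP/measurable_indic.
have g1 c z : 0 <= c%:E * (\1_(h @^-1` [set c]) z)%:E :> \bar R.
  by rewrite -EFinM nnfun_muleindic_ge0.
transitivity (\sum_(c \in range h) J (fun z => c%:E * (\1_(h @^-1` [set c]) z)%:E)).
  rewrite /J -ge0_integral_fsum//; last 2 first.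
  - by move=> c; exact: (mJ (m1 c) (g1 c)).
  - by move=> c y _; apply: integral_ge0 => x _; exact: (Fr0 (g1 c)).
  apply: eq_integral => y _; rewrite -ge0_integral_fsum//; last 2 first.
  - by move=> c; exact: (measurableT_comp (mFr (m1 c)) (measurable_pair2 y)).
  - by move=> c x _; exact: (Fr0 (g1 c)).
  by apply: eq_integral => x _; rewrite /= hE ge0_mule_fsuml.
under [RHS]eq_integral do rewrite hE.
rewrite ge0_integral_fsum//; apply: eq_fsbigr => c _.
have [c0|c0] := leP 0%R c.
  have mI : measurable_fun setT (fun z => (\1_(h @^-1` [set c]) z)%:E : \bar R).
    exact/measurable_EFinP/measurable_indic.
  rewrite JZ// ge0_integralZl// integral_indic// setIT.
  by rewrite -J_indic.
(* A negative value is never taken by [h]: its level set is empty and both sides vanish. *)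
have e0 (z : X * Y) : c%:E * (\1_(set0 : set (X * Y)) z)%:E = 0 :> \bar R.
  by rewrite indicE in_set0 mule0.
rewrite preimage_nnfun0// [RHS]integral0_eq// /J integral0_eq// => y _.
by rewrite integral0_eq// => x _; rewrite e0 mul0e.
Qed.

(** Indicators are covered by [LamE], simple functions by linearity, and general F by monotone
    convergence, used for both integrals of the iterated one. *)
Lemma ge0_integral_law_with_density F : measurable_fun setT F -> (forall z, 0 <= F z) ->
  \int[Lam]_z F z = \int[nu]_y \int[mu]_x (F (x, y) * (r (x, y))%:E).
Proof.
move=> mF F0; pose f_ := nnsfun_approx measurableT mF.
have mf_ n : measurable_fun setT (fun z => (f_ n z)%:E) by exact/measurable_EFinP.
have f_0 n z : 0 <= (f_ n z)%:E by rewrite lee_fin.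
have f_nd z : {homo (fun n => (f_ n z)%:E) : m n / (m <= n)%N >-> m <= n}.
  by move=> a b ab; rewrite lee_fin; exact/lefP/nd_nnsfun_approx.
have f_lim z : F z = limn (fun n => (f_ n z)%:E).
  by apply/esym/cvg_lim => //; exact: cvg_nnsfun_approx.
transitivity (limn (fun n => \int[Lam]_z (f_ n z)%:E)).
  rewrite -monotone_convergence//.
  by apply: eq_integral => z _; rewrite f_lim.
transitivity (limn (fun n => J (EFin \o f_ n))).
  by congr (limn _); apply/funext => n; rewrite J_nnsfun.
rewrite /J -monotone_convergence//; last 3 first.
- by move=> n; exact: (mJ (mf_ n) (f_0 n)).
- by move=> n y _; apply: integral_ge0 => x _; exact: (Fr0 (f_0 n)).
- move=> y _ a b ab; apply: ge0_le_integral => //.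
  + by move=> x _; exact: (Fr0 (f_0 a)).
  + exact: (measurableT_comp (mFr (mf_ a)) (measurable_pair2 y)).
  + exact: (measurableT_comp (mFr (mf_ b)) (measurable_pair2 y)).
  + by move=> x _; apply: lee_wpmul2r; [rewrite lee_fin|exact: f_nd].
apply: eq_integral => y _; rewrite -monotone_convergence//; last 3 first.
- by move=> n; exact: (measurableT_comp (mFr (mf_ n)) (measurable_pair2 y)).
- by move=> n x _; exact: (Fr0 (f_0 n)).
- by move=> x _ a b ab; apply: lee_wpmul2r; [rewrite lee_fin|exact: f_nd].
apply: eq_integral => x _; apply/cvg_lim => //.
apply: cvgeZr => //; exact: cvg_nnsfun_approx.
Qed.

End law_with_density.

(** * Bayes' formula and the tower property *)

Section posterior.
Context {R : realType} {d} {T : measurableType d} (P : probability T R).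
Context {d1 d2} {X : measurableType d1} {Y : measurableType d2}.
Context (omega : {mfun T >-> X}) (obs : {mfun T >-> Y}).
Context (mu : {sfinite_measure set X -> \bar R}) (nu : {sfinite_measure set Y -> \bar R}).
Context (r : X * Y -> R) (x0 : X).
Hypothesis mr : measurable_fun setT r.
Hypothesis r0 : forall z, 0 <= r z.
Hypothesis lawE : forall B, measurable B -> P [set w | B (omega w, obs w)] =
  (\int[nu]_y \int[mu]_x (\1_B (x, y) * r (x, y))%:E)%E.

Let pair w := (omega w, obs w).
Let mpair : measurable_fun setT pair.
Proof. by apply: measurable_fun_pair. Qed.
HB.instance Definition _ := isMeasurableFun.Build _ _ _ _ pair mpair.

(** With r the joint density, this is the marginal density of the observation with respect to nu. *)
Definition evidence y : \bar R := (\int[mu]_x (r (x, y))%:E)%E.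

Definition evidence_ok y := (0 < evidence y)%E && (evidence y < +oo)%E.

(* Conditional expectation of K(omega) given obs = y; an evaluation at x0 makes
   it a normalized positive functional also for the exceptional y. *)
Definition posterior (K : X -> R) y : R :=
  if evidence_ok y then (\int[mu]_x (K x * r (x, y))) / fine (evidence y) else K x0.

Let mr1 y : measurable_fun setT (fun x => r (x, y)).
Proof. exact: (measurableT_comp mr (measurable_pair2 y)). Qed.

Let mKr (K : X -> R) : measurable_fun setT K -> measurable_fun setT (fun z => K z.1 * r z).
Proof.
by move=> mK; apply: measurable_funM => //; exact: measurableT_comp mK measurable_fst.
Qed.

Lemma measurable_evidence : measurable_fun setT evidence.
Proof.
apply: (measurable_partial_integral mu (F := fun z => (r z)%:E)).
  exact/measurable_EFinP.
by move=> z; rewrite lee_fin.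
Qed.

Lemma evidence_ge0 y : (0 <= evidence y)%E.
Proof. by apply: integral_ge0 => x _; rewrite lee_fin. Qed.

Lemma measurable_evidence_ok : measurable_fun setT evidence_ok.
Proof.
apply: measurable_and; apply: measurable_fun_lte => //;
  exact: measurable_evidence.
Qed.

Lemma evidence_ok_gt0 y : evidence_ok y -> 0 < fine (evidence y).
Proof. by move=> /andP[? ?]; apply: fine_gt0; apply/andP. Qed.

Lemma posterior_integrable K y : bounded_mfun K -> (evidence y < +oo)%E ->
  mu.-integrable setT (EFin \o (fun x => K x * r (x, y))).
Proof.
move=> [mK [M KM]] ey; have mK1 : measurable_fun setT (fun x => K x * r (x, y)).
  by apply: measurable_funM.
apply/integrableP; split; first exact/measurable_EFinP.
have M0 : 0 <= M by apply: le_trans (KM x0).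
apply: (@le_lt_trans _ _ (M%:E * evidence y)%E).
  rewrite -ge0_integralZl//; last first.
    by move=> x _; rewrite lee_fin.
    by apply/measurable_EFinP.
  apply: ge0_le_integral => //.
  - by apply: measurableT_comp => //; exact/measurable_EFinP.
  - by apply: measurable_funeM; exact/measurable_EFinP.
  - move=> x _; rewrite /= -EFinM lee_fin normrM (ger0_norm (r0 _)).
    by rewrite ler_wpM2r.
by rewrite lte_mul_pinfty.
Qed.

Lemma posterior_cst (c : R) y : posterior (fun=> c) y = c.
Proof.
rewrite /posterior; case: ifPn => // oky; have := evidence_ok_gt0 oky.
case/andP: (oky) => _ ey e0; rewrite RintegralZl//.
  by rewrite mulfK// lt0r_neq0.
have := posterior_integrable (bounded_mfun_cst 1) ey.
by apply: eq_integrable => // x _; rewrite /= mul1r.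
Qed.

Lemma posteriorD K K' y : bounded_mfun K -> bounded_mfun K' ->
  posterior (fun x => K x + K' x) y = posterior K y + posterior K' y.
Proof.
move=> bK bK'; rewrite /posterior; case: ifPn => // /andP[_ ey].
rewrite -mulrDl -RintegralD//; [|exact: posterior_integrable..].
by congr (_ / _); apply: eq_Rintegral => x _; rewrite mulrDl.
Qed.

Lemma posteriorZ (c : R) K y : bounded_mfun K ->
  posterior (fun x => c * K x) y = c * posterior K y.
Proof.
move=> bK; rewrite /posterior; case: ifPn => // /andP[_ ey].
rewrite mulrA -RintegralZl//; last exact: posterior_integrable.
by congr (_ / _); apply: eq_Rintegral => x _; rewrite mulrA.
Qed.

Lemma posteriorB K K' y : bounded_mfun K -> bounded_mfun K' ->
  posterior (fun x => K x - K' x) y = posterior K y - posterior K' y.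
Proof.
move=> bK bK'; have bN := bounded_mfunZ (-1) bK'.
rewrite -mulN1r -posteriorZ// -posteriorD//.
by congr posterior; apply/funext => x; rewrite mulN1r.
Qed.

Lemma posterior_sum (I : Type) (s : seq I) (K : I -> X -> R) y :
  (forall i, bounded_mfun (K i)) ->
  posterior (fun x => \sum_(i <- s) K i x) y = \sum_(i <- s) posterior (K i) y.
Proof.
move=> bK; elim: s => [|i s IH].
  by rewrite big_nil; under eq_fun do rewrite big_nil; exact: posterior_cst.
rewrite big_cons -IH -posteriorD//; last exact: bounded_mfun_sum.
by congr posterior; apply/funext => x; rewrite big_cons.
Qed.

Lemma posterior_le K K' y : bounded_mfun K -> bounded_mfun K' ->
  (forall x, K x <= K' x) -> posterior K y <= posterior K' y.
Proof.
move=> bK bK' KK'; rewrite /posterior; case: ifPn => // oky.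
case/andP: (oky) => _ ey; rewrite ler_pM2r ?invr_gt0 ?evidence_ok_gt0//.
by apply: le_Rintegral => // [||x _]; [exact: posterior_integrable..|rewrite ler_wpM2r].
Qed.

Lemma posterior_normr_le K M y : bounded_mfun K -> (forall x, `|K x| <= M) ->
  `|posterior K y| <= M.
Proof.
move=> bK KM; rewrite ler_norml; apply/andP; split.
  rewrite -(posterior_cst (- M) y); apply: posterior_le => // [|x].
    exact: bounded_mfun_cst.
  by have := KM x; rewrite ler_norml => /andP[].
rewrite -[leRHS](posterior_cst M y); apply: posterior_le => // [|x].
  exact: bounded_mfun_cst.
exact: le_trans (ler_norm _) (KM x).
Qed.

Lemma posterior_normr K y : bounded_mfun K ->
  `|posterior K y| <= posterior (fun x => `|K x|) y.
Proof.
move=> bK; have bN := bounded_mfun_norm bK.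
rewrite ler_norml; apply/andP; split; last first.
  by apply: posterior_le => // x; exact: ler_norm.
rewrite -mulN1r -posteriorZ//; apply: posterior_le => // [|x].
  exact: bounded_mfunZ.
by rewrite mulN1r lerNl ler_normr lexx orbT.
Qed.

Lemma bounded_mfun_posterior K : bounded_mfun K -> bounded_mfun (posterior K).
Proof.
move=> bK; have [mK [M KM]] := bK; split; last first.
  by exists M => y; exact: posterior_normr_le.
(* Adding the bound M makes the integrand nonnegative, where partial integrals are known to be
   measurable. *)
rewrite (_ : posterior K = (fun y => posterior (fun x => K x + M) y - M)); last first.
  apply/funext => y; rewrite posteriorD//; last exact: bounded_mfun_cst.
  by rewrite posterior_cst addrK.
apply: measurable_funB => //.
apply: measurable_fun_ifT => //; first exact: measurable_evidence_ok.
apply: measurable_funM.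
  apply: measurableT_comp => //.
  apply: (measurable_partial_integral mu (F := fun z => ((K z.1 + M) * r z)%:E)).
    apply/measurable_EFinP; exact: (mKr (measurable_funD mK (measurable_cst M))).
  move=> z; rewrite lee_fin mulr_ge0//.
  by have := KM z.1; rewrite ler_norml => /andP[]; lra.
by apply: measurable_funV; apply: measurableT_comp => //; exact: measurable_evidence.
Qed.

Let ge0_integral_pair (F : X * Y -> \bar R) : measurable_fun setT F ->
  (forall z, 0 <= F z)%E ->
  (\int[P]_w F (omega w, obs w) =
   \int[nu]_y \int[mu]_x (F (x, y) * (r (x, y))%:E))%E.
Proof.
move=> mF F0.
rewrite -(@ge0_integral_law_with_density _ _ _ _ _ mu nu
  (distribution P (pair : {mfun _ >-> _})) r)//.
by rewrite ge0_integral_pushforward.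
Qed.

Let integral_evidence : (\int[nu]_y evidence y = 1)%E.
Proof.
rewrite -(probability_setT P) (_ : setT = [set w | [set: X * Y] (omega w, obs w)])//.
rewrite lawE//; apply: eq_integral => y _; apply: eq_integral => x _.
by rewrite indicT mul1r.
Qed.

Let ae_evidence_fin : {ae nu, forall y, (evidence y < +oo)%E}.
Proof.
have ie : nu.-integrable setT evidence.
  apply/integrableP; split; first exact: measurable_evidence.
  under eq_integral do rewrite gee0_abs ?evidence_ge0//.
  by rewrite integral_evidence ltry.
apply: filterS (integrable_ae measurableT ie) => y /(_ Logic.I).
by rewrite ge0_fin_numE ?evidence_ge0.
Qed.

(** The tower property. Both sides are iterated integrals against the joint density, and for almost
    every y the inner ones agree: [posterior K y] times the evidence is the integral of K r. A shift
    by a bound of K reduces the claim to K >= 0. *)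
Lemma Rintegral_posterior K : bounded_mfun K ->
  \int[P]_w posterior K (obs w) = \int[P]_w K (omega w).
Proof.
wlog K0 : K / forall x, 0 <= K x.
  move=> h bK; have [mK [M KM]] := bK.
  have bKM : bounded_mfun (fun x => K x + M).
    by apply: bounded_mfunD => //; exact: bounded_mfun_cst.
  have KM0 x : 0 <= K x + M by have := KM x; rewrite ler_norml => /andP[]; lra.
  have := h _ KM0 bKM.
  have pE y : posterior (fun x => K x + M) y = posterior K y + M.
    by rewrite posteriorD ?posterior_cst//; exact: bounded_mfun_cst.
  under eq_Rintegral do rewrite pE.
  rewrite !probability_RintegralD; first by move/addIr.
  - exact: (bounded_mfun_comp (measurable_funPT omega) bK).
  - exact: bounded_mfun_cst.
  - exact: (bounded_mfun_comp (measurable_funPT obs) (bounded_mfun_posterior bK)).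
  - exact: bounded_mfun_cst.
move=> bK; have [mK [M KM]] := bK; have bpost := bounded_mfun_posterior bK.
have post0 y : 0 <= posterior K y.
  rewrite -(posterior_cst 0 y); apply: posterior_le => //; exact: bounded_mfun_cst.
have mKp : measurable_fun setT (fun z : X * Y => (K z.1)%:E).
  by apply/measurable_EFinP; exact: measurableT_comp mK measurable_fst.
have mpp : measurable_fun setT (fun z : X * Y => (posterior K z.2)%:E).
  by apply/measurable_EFinP; exact: measurableT_comp bpost.1 measurable_snd.
rewrite /Rintegral; congr fine.
rewrite (ge0_integral_pair mKp); last by move=> z; rewrite lee_fin.
rewrite (ge0_integral_pair mpp); last by move=> z; rewrite lee_fin.
have mA (F : X * Y -> \bar R) : measurable_fun setT F ->
    measurable_fun setT (fun z => F z * (r z)%:E)%E.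
  by move=> mF; apply: emeasurable_funM => //; exact/measurable_EFinP.
apply: ge0_ae_eq_integral => //.
- by apply: (measurable_partial_integral mu (mA _ mpp)) => z; rewrite mule_ge0 ?lee_fin.
- by apply: (measurable_partial_integral mu (mA _ mKp)) => z; rewrite mule_ge0 ?lee_fin.
- by move=> y _; apply: integral_ge0 => x _; rewrite mule_ge0 ?lee_fin.
- by move=> y _; apply: integral_ge0 => x _; rewrite mule_ge0 ?lee_fin.
apply: filterS ae_evidence_fin => y ey _ /=.
rewrite ge0_integralZl ?lee_fin//; [|exact/measurable_EFinP|by move=> x _; rewrite lee_fin].
rewrite -/(evidence y).
have iK := posterior_integrable bK ey.
have [ok|nok] := boolP (evidence_ok y).
  rewrite /posterior ok EFinM fineK; last exact: integrable_fin_num.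
  have e0 := evidence_ok_gt0 ok.
  rewrite -{2}(@fineK _ (evidence y)); last by rewrite ge0_fin_numE// evidence_ge0.
  rewrite -muleA -EFinM mulVf ?lt0r_neq0// mule1.
  by apply: eq_integral => x _; rewrite EFinM.
(* Here the default value of [posterior] is multiplied by 0, and the integral of K r vanishes
   because 0 <= K r <= M r. *)
have e0 : evidence y = 0%E.
  by apply/eqP; rewrite eq_le evidence_ge0 andbT leNgt; move: nok; rewrite /evidence_ok ey andbT.
rewrite e0 mule0; apply/esym/eqP; rewrite eq_le; apply/andP; split; last first.
  by apply: integral_ge0 => x _; rewrite mule_ge0 ?lee_fin.
apply: (@le_trans _ _ (M%:E * evidence y)%E); last by rewrite e0 mule0.
have M0 : 0 <= M by apply: le_trans (KM x0).
rewrite -ge0_integralZl//; [|exact/measurable_EFinP|by move=> x _; rewrite lee_fin].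
apply: ge0_le_integral => //.
- by move=> x _; rewrite mule_ge0 ?lee_fin.
- exact: (measurableT_comp (mA _ mKp) (measurable_pair2 y)).
- by apply: measurable_funeM; exact/measurable_EFinP.
- move=> x _; rewrite -!EFinM lee_fin ler_wpM2r//.
  exact: le_trans (ler_norm _) (KM x).
Qed.

(** The evidence integrates to 1, so it is finite nu-almost everywhere; and where it is 0 the joint
    density puts no mass. *)
Lemma ae_evidence_ok : {ae P, forall w, evidence_ok (obs w)}.
Proof.
have mB : measurable [set y | ~~ evidence_ok y].
  rewrite -[X in measurable X]setTI.
  have -> : [set y | ~~ evidence_ok y] = (fun y => ~~ evidence_ok y) @^-1` [set true].
    by apply/seteqP; split=> y /=.
  by apply: (measurable_neg measurable_evidence_ok) => //.
have mC : measurable [set w | ~~ evidence_ok (obs w)].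
  exact: (measurable_funPTI obs mB).
exists [set w | ~~ evidence_ok (obs w)]; split=> //; last by move=> w /= /negP.
have := lawE (measurableX (@measurableT _ X) mB).
rewrite (_ : [set w | _] = [set w | ~~ evidence_ok (obs w)]); last first.
  by apply/seteqP; split=> w /=; [move=> []|].
move=> ->; have mI : measurable_fun setT (\1_(setT `*` [set y | ~~ evidence_ok y]) : X * Y -> R).
  by apply: measurable_indic; exact: measurableX.
have mF : measurable_fun setT
    (fun z => (\1_(setT `*` [set y | ~~ evidence_ok y]) z * r z)%:E).
  by apply/measurable_EFinP/measurable_funM.
rewrite -[RHS](integral0 nu setT); apply: ge0_ae_eq_integral => //.
- by apply: (measurable_partial_integral mu mF) => z; rewrite lee_fin mulr_ge0.
- by move=> y _; apply: integral_ge0 => x _; rewrite lee_fin mulr_ge0.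
apply: filterS ae_evidence_fin => y ey _ /=.
have [ok|nok] := boolP (evidence_ok y).
  apply: integral0_eq => x _; rewrite indicE (_ : _ \in _ = false) ?mul0r//.
  by apply/negbTE; rewrite notin_setE => -[_] /=; rewrite ok.
have e0 : evidence y = 0%E.
  apply/eqP; rewrite eq_le evidence_ge0 andbT leNgt.
  by move: nok; rewrite /evidence_ok ey andbT.
apply/eqP; rewrite eq_le; apply/andP; split; last first.
  by apply: integral_ge0 => x _; rewrite lee_fin mulr_ge0.
rewrite -[leRHS]e0; apply: ge0_le_integral => //.
- by move=> x _; rewrite lee_fin mulr_ge0.
- exact: (measurableT_comp mF (measurable_pair2 y)).
- exact/measurable_EFinP.
- by move=> x _; rewrite lee_fin ler_piMl// indicE lern1 leq_b1.
Qed.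

End posterior.

(** * Factorization of the log-likelihood ratio *)

Section score.
Context {R : realType} {d1 d2} {X : measurableType d1} {Y : measurableType d2}.
Context (mu : {sfinite_measure set X -> \bar R}) (r : X * Y -> R) (x0 : X).
Hypothesis mr : measurable_fun setT r.
Hypothesis r0 : forall z, 0 <= r z.
Context {p : nat} (x : X -> 'rV[R]_p) (g : R -> R) (theta : 'rV[R]_p).
Context (MX Ag Bg F1 F2 : R).
Hypothesis mx : forall j, measurable_fun setT (fun z => x z 0 j).
Hypothesis MX_ge0 : 0 <= MX.
Hypothesis x_bnd : forall z j, `|x z 0 j| <= MX.
Hypothesis g_diff : forall t, derivable g t 1.
Hypotheses (Ag_gt0 : 0 < Ag) (AgBg : Ag < Bg).
Hypothesis g_bnd : forall t, Ag <= g t <= Bg.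
Hypothesis dg_bnd : forall t, `|derive1 g t| <= F1.
Hypothesis dg_lip : forall t s, `|derive1 g t - derive1 g s| <= F2 * `|t - s|.

Local Notation post K y := (posterior mu r x0 K y).

(* With v = x^T(u - theta), the likelihood ratio is 1 + v * rel_slope u. *)
Definition shift u z := dotv (x z) (u - theta).
Definition rel_slope u z := slope g (dotv (x z) theta) (shift u z) / g (dotv (x z) theta).
Definition lik_ratio u z := g (dotv (x z) u) / g (dotv (x z) theta).
Definition score_coef j u y := post (fun z => x z 0 j * rel_slope u z) y.
Definition lik_excess u y := post (fun z => lik_ratio u z - 1) y.
Definition score_rem j u y :=
  score_coef j u y * (1 + varrho (lik_excess u y)) - score_coef j theta y.

Let g_gt0 t : 0 < g t.
Proof. by have /andP[h _] := g_bnd t; exact: lt_le_trans h. Qed.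

Let Bg0 : 0 < Bg. Proof. exact: lt_trans AgBg. Qed.

Let F1_ge0 : 0 <= F1. Proof. exact: le_trans (dg_bnd 0). Qed.

Let F2_ge0 : 0 <= F2.
Proof. by have := le_trans (normr_ge0 _) (dg_lip 1 0); rewrite subr0 normr1 mulr1. Qed.

Let gV_le t : `|(g t)^-1| <= Ag^-1.
Proof.
rewrite ger0_norm; last by rewrite invr_ge0 ltW.
by rewrite lef_pV2 ?posrE//; have /andP[] := g_bnd t.
Qed.

Lemma dotvB (a b c : 'rV[R]_p) : dotv a (b - c) = dotv a b - dotv a c.
Proof. by rewrite /dotv -sumrB; apply: eq_bigr => j _; rewrite !mxE mulrBr. Qed.

Lemma normr_dotv_le z (a : 'rV[R]_p) : `|dotv (x z) a| <= MX * norm1 a.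
Proof.
rewrite /dotv /norm1 mulr_sumr; apply: le_trans (ler_norm_sum _ _ _) _.
by apply: ler_sum => j _; rewrite normrM ler_wpM2r.
Qed.

Lemma shift_theta z : shift theta z = 0.
Proof. by rewrite /shift dotvB subrr. Qed.

Lemma lik_ratioE u z : lik_ratio u z = 1 + shift u z * rel_slope u z.
Proof.
rewrite /lik_ratio /rel_slope mulrA slopeE /shift dotvB [dotv _ _ + _]addrC subrK.
by field; rewrite lt0r_neq0.
Qed.

Lemma normr_rel_slope_le u z : `|rel_slope u z| <= F1 / Ag.
Proof. by rewrite /rel_slope normrM ler_pM// normr_slope_le. Qed.

Lemma rel_slope_lip u u' z :
  `|rel_slope u z - rel_slope u' z| <= F2 / (2 * Ag) * `|shift u z - shift u' z|.
Proof.
rewrite /rel_slope -mulrBl normrM; apply: le_trans (ler_pM _ _ (slope_lip _ _ _ _ _) (gV_le _)) _ => //.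
by rewrite mulrAC invfM mulrA.
Qed.

Section rel_slope_bound.
Context (rho psi3 : R).
(** One disjunct for each term of the minimum in psi_3: the triangle inequality uses the first, the
    Lipschitz bound on the slope together with |x^T (u - theta)| <= MX rho the second. In this form
    rho can be any finite radius, even if R_D is infinite. *)
Hypothesis psi3P : 2 * F1 <= psi3 * Ag \/ F2 * MX / 2 * rho <= psi3 * Ag.

Lemma rel_slope_diff_le u z : norm1 (u - theta) <= rho ->
  `|rel_slope u z - rel_slope theta z| <= psi3.
Proof.
move=> urho; rewrite /rel_slope -mulrBl normrM.
rewrite -[leRHS](mulfK (lt0r_neq0 Ag_gt0)); apply: ler_pM => //.
case: psi3P => [h|h]; apply: le_trans h.
  rewrite mulr_natl mulr2n; apply: le_trans (ler_normB _ _) _.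
  by rewrite lerD// normr_slope_le.
apply: le_trans (slope_lip g_diff dg_lip _ _ _) _.
rewrite shift_theta subr0 (_ : F2 * MX / 2 * rho = F2 / 2 * (MX * rho)); last by ring.
rewrite ler_wpM2l ?divr_ge0//; apply: le_trans (normr_dotv_le _ _) _.
by rewrite ler_wpM2l.
Qed.

End rel_slope_bound.

Lemma measurable_dotv (a : 'rV[R]_p) : measurable_fun setT (fun z => dotv (x z) a).
Proof.
rewrite /dotv; elim: (index_enum _) => [|j s IH].
  by under eq_fun do rewrite big_nil; exact: measurable_cst.
under eq_fun do rewrite big_cons.
by apply: measurable_funD => //; apply: measurable_funM.
Qed.

Lemma bounded_mfun_coord j : bounded_mfun (fun z => x z 0 j).
Proof. by split=> //; exists MX. Qed.

Lemma bounded_mfun_shift u : bounded_mfun (shift u).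
Proof.
by split; [exact: measurable_dotv|exists (MX * norm1 (u - theta)) => z; exact: normr_dotv_le].
Qed.

Let mg_dotv (a : 'rV[R]_p) : measurable_fun setT (fun z => g (dotv (x z) a)).
Proof. exact: measurableT_comp (measurable_derivable g_diff) (measurable_dotv a). Qed.

Lemma bounded_mfun_rel_slope u : bounded_mfun (rel_slope u).
Proof.
split; last by exists (F1 / Ag) => z; exact: normr_rel_slope_le.
apply: measurable_funM; last exact: measurable_funV.
by apply: (measurable_slope g_diff dg_lip) => //; exact: measurable_dotv.
Qed.

Lemma lik_ratio_itv u z : Ag / Bg <= lik_ratio u z <= Bg / Ag.
Proof.
have /andP[a1 a2] := g_bnd (dotv (x z) u); have /andP[b1 b2] := g_bnd (dotv (x z) theta).
have i1 : 0 < (g (dotv (x z) theta))^-1 by rewrite invr_gt0.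
rewrite /lik_ratio; apply/andP; split; apply: ler_pM => //;
  by [exact: ltW|rewrite invr_ge0 ltW|rewrite lef_pV2 ?posrE].
Qed.

Lemma bounded_mfun_lik_ratio u : bounded_mfun (lik_ratio u).
Proof.
split; first by apply: measurable_funM => //; exact: measurable_funV.
exists (Bg / Ag) => z; have /andP[h1 h2] := lik_ratio_itv u z.
by rewrite ger0_norm// (le_trans _ h1)// divr_ge0 ?ltW.
Qed.

Lemma lik_ratio_lip u u' z :
  `|lik_ratio u z - lik_ratio u' z| <= F1 / Ag * `|shift u z - shift u' z|.
Proof.
rewrite /lik_ratio -mulrBl normrM mulrAC; apply: ler_pM => //.
set s := dotv (x z) u; set s' := dotv (x z) u'.
have := slopeE g s' (s - s'); rewrite [s' + _]addrC subrK => <-.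
rewrite normrM mulrC /shift !dotvB opprB addrA subrK ler_wpM2r//.
exact: normr_slope_le.
Qed.

Let bM (K K' : X -> R) : bounded_mfun K -> bounded_mfun K' -> bounded_mfun (fun z => K z * K' z).
Proof. exact: bounded_mfunM. Qed.

Let b_coef j u : bounded_mfun (fun z => x z 0 j * rel_slope u z).
Proof. by apply: bM; [exact: bounded_mfun_coord|exact: bounded_mfun_rel_slope]. Qed.

Let b_excess u : bounded_mfun (fun z => lik_ratio u z - 1).
Proof. by apply: bounded_mfunB; [exact: bounded_mfun_lik_ratio|exact: bounded_mfun_cst]. Qed.

Let b_inc u u' : bounded_mfun (fun z => `|shift u z - shift u' z|).
Proof. by apply/bounded_mfun_norm/bounded_mfunB; exact: bounded_mfun_shift. Qed.

(** The increment of x^T u stays inside the conditional mean, and is not bounded by MX |u - u'|_1: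
    only so can it later be turned back into the linear process that produces S_X. *)
Definition mean_increment u u' y := post (fun z => `|shift u z - shift u' z|) y.

Lemma normr_score_coef_le j u y : `|score_coef j u y| <= MX * (F1 / Ag).
Proof.
apply: posterior_normr_le => // z; rewrite normrM ler_pM//.
exact: normr_rel_slope_le.
Qed.

Lemma score_coef_diff_le rho psi3 j u y :
  2 * F1 <= psi3 * Ag \/ F2 * MX / 2 * rho <= psi3 * Ag ->
  norm1 (u - theta) <= rho -> `|score_coef j u y - score_coef j theta y| <= MX * psi3.
Proof.
move=> h urho; rewrite /score_coef -posteriorB//.
apply: posterior_normr_le => //; first exact: bounded_mfunB.
move=> z; rewrite -mulrBr normrM ler_pM//; exact: (rel_slope_diff_le h).
Qed.

Lemma score_coef_lip j u u' y : `|score_coef j u y - score_coef j u' y| <=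
  F2 * MX / (2 * Ag) * mean_increment u u' y.
Proof.
rewrite /score_coef -posteriorB// /mean_increment -posteriorZ//.
apply: le_trans (posterior_normr _ _ _ _ _ _) _ => //; first exact: bounded_mfunB.
apply: posterior_le => //; first exact/bounded_mfun_norm/bounded_mfunB.
  exact: bounded_mfunZ.
move=> z; rewrite -mulrBr normrM.
apply: le_trans (ler_pM _ _ (x_bnd z j) (rel_slope_lip u u' z)) _ => //.
by rewrite !mulrA [MX * F2]mulrC.
Qed.

Lemma lik_excess_lip u u' y :
  `|lik_excess u y - lik_excess u' y| <= F1 / Ag * mean_increment u u' y.
Proof.
rewrite /lik_excess -posteriorB// /mean_increment -posteriorZ//.
apply: le_trans (posterior_normr _ _ _ _ _ _) _ => //; first exact: bounded_mfunB.
apply: posterior_le => //; first exact/bounded_mfun_norm/bounded_mfunB.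
  exact: bounded_mfunZ.
by move=> z; rewrite opprB addrA subrK; exact: lik_ratio_lip.
Qed.

Lemma lik_excessE u y : 1 + lik_excess u y = post (lik_ratio u) y.
Proof.
rewrite /lik_excess posteriorB//; [|exact: bounded_mfun_lik_ratio|exact: bounded_mfun_cst].
by rewrite posterior_cst// addrC subrK.
Qed.

Lemma posterior_lik_ratio_itv u y : Ag / Bg <= post (lik_ratio u) y <= Bg / Ag.
Proof.
have bl := bounded_mfun_lik_ratio u.
apply/andP; split.
  rewrite -[leLHS](posterior_cst mu x0 mr r0 _ y); apply: posterior_le => //.
    exact: bounded_mfun_cst.
  by move=> z; have /andP[] := lik_ratio_itv u z.
rewrite -[leRHS](posterior_cst mu x0 mr r0 _ y); apply: posterior_le => //.
  exact: bounded_mfun_cst.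
by move=> z; have /andP[] := lik_ratio_itv u z.
Qed.

Let excessE u y : lik_excess u y = post (lik_ratio u) y - 1.
Proof. by rewrite -lik_excessE addrAC subrr add0r. Qed.

Lemma normr_varrho_excess_le u y : `|varrho (lik_excess u y)| <= varrho0 Ag Bg.
Proof. by rewrite excessE; apply: varrho0_ge => //; exact: posterior_lik_ratio_itv. Qed.

Lemma varrho_excess_lip u u' y :
  `|varrho (lik_excess u y) - varrho (lik_excess u' y)| <=
  varrho1 Ag Bg * (F1 / Ag * mean_increment u u' y).
Proof.
rewrite 2!excessE; apply: le_trans (varrho_lip Ag_gt0 AgBg _ _) _;
  [exact: posterior_lik_ratio_itv..|].
rewrite ler_wpM2l ?varrho1_ge0// -!lik_excessE.
by rewrite opprD addrACA subrr add0r; exact: lik_excess_lip.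
Qed.

Lemma lik_excess_theta y : lik_excess theta y = 0.
Proof.
rewrite -(posterior_cst mu x0 mr r0 0 y) /lik_excess; congr posterior.
by apply/funext => z; rewrite /lik_ratio divff ?subrr// lt0r_neq0.
Qed.

Lemma score_rem_theta j y : score_rem j theta y = 0.
Proof. by rewrite /score_rem lik_excess_theta /varrho eqxx addr0 mulr1 subrr. Qed.

(** With a and varrho evaluated at u, h = a(theta) varrho + (a - a(theta)) (1 + varrho), and the two
    summands give the two terms of psi_4. *)
Lemma normr_score_rem_le rho psi3 j u y :
  2 * F1 <= psi3 * Ag \/ F2 * MX / 2 * rho <= psi3 * Ag ->
  norm1 (u - theta) <= rho ->
  `|score_rem j u y| <=
    (F1 / Ag * varrho0 Ag Bg + psi3 * (1 + varrho0 Ag Bg)) * MX.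
Proof.
move=> h urho.
have h1 := score_coef_diff_le j y h urho.
have h2 := normr_score_coef_le j theta y.
have h3 := normr_varrho_excess_le u y.
rewrite /score_rem (_ : _ - _ = score_coef j theta y * varrho (lik_excess u y) +
  (score_coef j u y - score_coef j theta y) * (1 + varrho (lik_excess u y))); last by ring.
apply: le_trans (ler_normD _ _) _; rewrite !normrM mulrDl; apply: lerD.
  rewrite [leRHS]mulrC mulrA; exact: ler_pM.
rewrite [leRHS]mulrC mulrA; apply: ler_pM => //.
by apply: le_trans (ler_normD _ _) _; rewrite normr1 lerD2l.
Qed.

(** The constant C of the overview. In the notation of the theorem, 2 C = 2 psi_2 (1 + varrho_0) +
    psi_1 psi_5. *)
Definition score_lip := (1 + varrho0 Ag Bg) * (F2 * MX / (2 * Ag)) +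
  MX * (F1 / Ag) * (varrho1 Ag Bg * (F1 / Ag)).

Lemma score_lip_ge0 : 0 <= score_lip.
Proof.
have v0 := varrho0_gt0 Ag_gt0 AgBg; have v1 := varrho1_ge0 Ag_gt0 AgBg.
by rewrite /score_lip addr_ge0// !mulr_ge0// ?invr_ge0 ?mulr_ge0 ?addr_ge0// ltW.
Qed.

Lemma score_rem_lip j u u' y :
  `|score_rem j u y - score_rem j u' y| <= score_lip * mean_increment u u' y.
Proof.
have h1 := score_coef_lip j u u' y; have h2 := normr_score_coef_le j u' y.
have h3 := normr_varrho_excess_le u y; have h4 := varrho_excess_lip u u' y.
rewrite /score_rem (_ : _ - _ - _ =
  (1 + varrho (lik_excess u y)) * (score_coef j u y - score_coef j u' y) +
  score_coef j u' y * (varrho (lik_excess u y) - varrho (lik_excess u' y))); last by ring.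
apply: le_trans (ler_normD _ _) _; rewrite !normrM /score_lip mulrDl; apply: lerD.
  rewrite -mulrA; apply: ler_pM => //.
  by apply: le_trans (ler_normD _ _) _; rewrite normr1 lerD2l.
by rewrite -[leRHS]mulrA; apply: ler_pM => //; rewrite -mulrA.
Qed.

Lemma ln_posterior_lik_ratio u y : ln (post (lik_ratio u) y) =
  \sum_j (u - theta) 0 j * (score_coef j theta y + score_rem j u y).
Proof.
rewrite ln_varrho -excessE.
have e j : score_coef j theta y + score_rem j u y =
    score_coef j u y * (1 + varrho (lik_excess u y)) by rewrite addrC subrK.
under eq_bigr do rewrite e mulrA.
rewrite -mulr_suml; congr (_ * _).
rewrite /score_coef; under eq_bigr do rewrite -posteriorZ//.
rewrite -posterior_sum//; last by move=> j; exact: bounded_mfunZ.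
congr posterior; apply/funext => z.
rewrite lik_ratioE addrAC subrr add0r /shift /dotv mulr_suml.
by apply: eq_bigr => j _; ring.
Qed.

Lemma bounded_mfun_score_coef j u : bounded_mfun (score_coef j u).
Proof. exact: bounded_mfun_posterior. Qed.

Lemma measurable_varrho : measurable_fun setT (@varrho R).
Proof.
apply: measurable_fun_ifT => //; first exact: measurable_fun_eqr.
apply: measurable_funB => //; apply: measurable_funM; first exact: measurable_funV.
by apply: measurableT_comp => //; exact: measurable_funD.
Qed.

Lemma bounded_mfun_score_rem j u : bounded_mfun (score_rem j u).
Proof.
apply: bounded_mfunB; last exact: bounded_mfun_score_coef.
apply: bounded_mfunM; first exact: bounded_mfun_score_coef.
apply: bounded_mfunD; first exact: bounded_mfun_cst.
split; last by exists (varrho0 Ag Bg) => y; exact: normr_varrho_excess_le.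
apply: measurableT_comp measurable_varrho _.
by have [] := bounded_mfun_posterior mu x0 mr r0 (b_excess u).
Qed.

Lemma bounded_mfun_mean_increment u u' : bounded_mfun (mean_increment u u').
Proof. exact: bounded_mfun_posterior. Qed.

Lemma bounded_mfun_ln_posterior u : bounded_mfun (fun y => ln (post (lik_ratio u) y)).
Proof.
under eq_fun do rewrite ln_posterior_lik_ratio.
apply: bounded_mfun_sum => j; apply: bounded_mfunZ; apply: bounded_mfunD.
  exact: bounded_mfun_score_coef.
exact: bounded_mfun_score_rem.
Qed.

(** A crude bound in the l1 norm, for the passage from a dense sequence to D. It rests on ln (a / b)
    <= (a - b) / b and 1 / b <= Bg / Ag. *)
Lemma ln_posterior_lip u u' y :
  `|ln (post (lik_ratio u) y) - ln (post (lik_ratio u') y)| <=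
  Bg / Ag * (F1 / Ag * (MX * norm1 (u - u'))).
Proof.
have inc s s' : `|lik_excess s y - lik_excess s' y| <= F1 / Ag * (MX * norm1 (s - s')).
  apply: le_trans (lik_excess_lip s s' y) _; rewrite ler_wpM2l ?divr_ge0//.
    exact: ltW.
  apply: le_trans (ler_norm _) _; apply: posterior_normr_le => // z.
  rewrite normr_id /shift !dotvB opprB addrA subrK -dotvB.
  exact: normr_dotv_le.
wlog suff le : u u' / ln (post (lik_ratio u) y) - ln (post (lik_ratio u') y) <=
    Bg / Ag * (F1 / Ag * (MX * norm1 (u - u'))).
  rewrite ler_norml lerNl opprB le andbT.
  have -> : norm1 (u - u') = norm1 (u' - u); last exact: le.
  by rewrite /norm1; apply: eq_bigr => j _; rewrite !mxE distrC.
have /andP[a1 a2] := posterior_lik_ratio_itv u y.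
have /andP[b1 b2] := posterior_lik_ratio_itv u' y.
have lo : 0 < Ag / Bg by exact: divr_gt0.
have a0 := lt_le_trans lo a1; have b0 := lt_le_trans lo b1.
rewrite -ln_div ?posrE//; apply: le_trans (ln_le_B1 (divr_gt0 a0 b0)) _.
rewrite -(divff (lt0r_neq0 b0)) -mulrBl mulrC.
apply: le_trans (ler_norm _) _; rewrite normrM; apply: ler_pM => //.
  rewrite ger0_norm; last by rewrite invr_ge0 ltW.
  by rewrite -(invf_div Ag Bg) lef_pV2 ?posrE.
have := inc u u'; rewrite !excessE.
by rewrite opprB addrA subrK.
Qed.

End score.

(** * Suprema over finitely many parameters *)

Lemma measure_bigsetU_le (R : realType) d (T : measurableType d)
    (m : {measure set T -> \bar R}) (I : Type) (s : seq I) (A : I -> set T) :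
  (forall i, measurable (A i)) ->
  (m (\big[setU/set0]_(i <- s) A i) <= \sum_(i <- s) m (A i))%E.
Proof.
move=> mA; elim: s => [|i s IH]; first by rewrite !big_nil measure0.
rewrite !big_cons; apply: le_trans (measureU2 _ _ _) (leeD _ IH) => //.
by apply: bigsetU_measurable.
Qed.

Section independent_mcdiarmid.
Context {R : realType} {d} {T : measurableType d} (P : probability T R).
Context {d'} {E : measurableType d'} (n : nat) (Z : 'I_n -> T -> E).
Hypothesis mZ : forall i, measurable_fun setT (Z i).
Hypothesis indZ : mutually_independent P Z.

Let joint w : n.-tuple E := [tuple Z i w | i < n].
Let split_joint (t : n.-tuple T) : n.-tuple E := [tuple Z i (tnth t i) | i < n].

Let msplit : measurable_fun setT split_joint.
Proof.
apply/measurable_fun_tnthP => i.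
apply: (eq_measurable_fun (Z i \o (@tnth _ _)^~ i)) => [w _ /=|].
  by rewrite tnth_mktuple.
exact: measurableT_comp (mZ i) (measurable_tnth i).
Qed.

Lemma measurable_superlevel d0 (S : measurableType d0) (f : S -> R) a :
  measurable_fun setT f -> measurable [set x | a < f x].
Proof.
move=> mf; rewrite -[X in measurable X]setTI.
have -> : [set x | a < f x] = f @^-1` `]a, +oo[%classic.
  by apply/seteqP; split=> x /=; rewrite in_itv/= andbT.
by apply: mf => //; exact: measurable_itv.
Qed.

(** The event and the mean depend only on the joint law of the [Z i], so both may be computed with
    independent copies. *)
Lemma mcdiarmid_independent (F : n.-tuple E -> R) (c q : R) : bounded_mfun F ->
  (0 < n)%N -> 0 < c -> 0 < q < 1 -> bounded_differences F (2 * c) ->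
  (P [set w | (\int[P]_w F [tuple Z i w | i < n] +
     c * Num.sqrt (2 * n%:R) * Num.sqrt (ln q^-1) < F [tuple Z i w | i < n])%R] <= q%:E)%E.
Proof.
move=> bF n0 c0 q01 dF; rewrite (Rintegral_split_joint mZ indZ bF).
set a := _ + _; have mB : measurable [set e | a < F e].
  by apply: measurable_superlevel; case: bF.
have -> : P [set w | (a < F [tuple Z i w | i < n])%R] =
    tuple_power P n [set t | (a < F (split_joint t))%R].
  exact: (law_split_joint mZ indZ mB).
apply: mcdiarmid_tail => //.
- exact: bounded_mfun_comp msplit bF.
- by move=> i t t' tt'; apply: (dF i) => j ji; rewrite !tnth_mktuple tt'.
Qed.

End independent_mcdiarmid.

(** In the application [dir u] is u - theta, [a] and [h] are the coefficients in the expansion of ln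
    r_i, [X] holds the truncated covariates, and [i0] is the index of theta, where the remainder
    vanishes. *)
Section finite_supremum.
Context {R : realType} {d} {T : measurableType d} (P : probability T R).
Context {d'} {E : measurableType d'} (N p : nat) (Z : 'I_N -> T -> E).
Hypothesis mZ : forall i, measurable_fun setT (Z i).
Hypothesis indZ : mutually_independent P Z.
Hypotheses (N0 : (0 < N)%N) (p0 : (0 < p)%N).
Context {I : finType} (i0 : I) (dir : I -> 'I_p -> R) (rho : R).
Hypothesis dir_rho : forall u, \sum_k `|dir u k| <= rho.
Context (a X : 'I_N -> 'I_p -> E -> R) (h : 'I_N -> 'I_p -> I -> E -> R) (ca ch C : R).
Hypotheses (ba : forall i j, bounded_mfun (a i j)) (bX : forall i j, bounded_mfun (X i j)).
Hypothesis bh : forall i j u, bounded_mfun (h i j u).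
Hypotheses (ca0 : 0 < ca) (ch0 : 0 < ch) (C0 : 0 <= C).
Hypothesis a_le : forall i j e, `|a i j e| <= ca.
Hypothesis h_le : forall i j u e, `|h i j u e| <= ch.
Hypothesis h_i0 : forall i j e, h i j i0 e = 0.

Let v i u w := 2 * (C * \sum_k X i k (Z i w) * dir u k).

Hypothesis h_dom : forall i j,
  sign_dominated P i0 (fun u w => h i j u (Z i w)) (v i).
Hypothesis hN_dom : forall i j,
  sign_dominated P i0 (fun u w => - h i j u (Z i w)) (v i).

Let joint w : N.-tuple E := [tuple Z i w | i < N].
Let split_joint (t : N.-tuple T) : N.-tuple E := [tuple Z i (tnth t i) | i < N].

Let S (e : N.-tuple E) : R :=
  \big[Num.max/0]_(j < p) Num.sqrt (\sum_i X i j (tnth e i) ^+ 2).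

Let coord_bounded (f : E -> R) i : bounded_mfun f ->
  bounded_mfun (fun e : N.-tuple E => f (tnth e i)).
Proof. exact: (bounded_mfun_comp (@measurable_tnth _ E N i)). Qed.

Let coordT_bounded (f : T -> R) i : bounded_mfun f ->
  bounded_mfun (fun t : N.-tuple T => f (tnth t i)).
Proof. exact: (bounded_mfun_comp (@measurable_tnth _ T N i)). Qed.

Let bhZ i j u : bounded_mfun (fun w => h i j u (Z i w)).
Proof. exact: bounded_mfun_comp (mZ i) (bh i j u). Qed.

Let S_ge j e : \sum_i X i j (tnth e i) ^+ 2 <= S e ^+ 2.
Proof.
have s0 : 0 <= \sum_i X i j (tnth e i) ^+ 2 by apply: sumr_ge0 => i _; exact: sqr_ge0.
rewrite -[leLHS](sqr_sqrtr s0) lerXn2r ?nnegrE ?sqrtr_ge0//; last first.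
  exact: (le_bigmax _ (fun j => Num.sqrt (\sum_i X i j (tnth e i) ^+ 2)) j).
apply: le_trans (sqrtr_ge0 _) _.
exact: (le_bigmax _ (fun j => Num.sqrt (\sum_i X i j (tnth e i) ^+ 2)) j).
Qed.

Let S_ge0 e : 0 <= S e.
Proof. exact: bigmax_ge_id. Qed.

Lemma bounded_mfun_sqrt d0 (S0 : measurableType d0) (f : S0 -> R) :
  bounded_mfun f -> bounded_mfun (fun x => Num.sqrt (f x)).
Proof.
move=> [mf [M fM]]; split.
  apply: measurableT_comp mf; apply: continuous_measurable_fun; exact: sqrt_continuous.
exists (Num.sqrt M) => x; rewrite ger0_norm ?sqrtr_ge0// ler_wsqrtr//.
exact: le_trans (ler_norm _) (fM x).
Qed.

Let bS : bounded_mfun S.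
Proof.
rewrite /S; elim: (index_enum _) => [|j s IH].
  by under eq_fun do rewrite big_nil; exact: bounded_mfun_cst.
under eq_fun do rewrite big_cons; apply: bounded_mfun_max => //.
apply: bounded_mfun_sqrt; apply: bounded_mfun_sum => i.
by under eq_fun do rewrite expr2; apply: bounded_mfunM; exact: coord_bounded.
Qed.

Let cent i j u e := h i j u e - \int[P]_w h i j u (Z i w).
Let sumh j u (e : N.-tuple E) := \sum_i cent i j u (tnth e i).
Let W j (e : N.-tuple E) := fmax i0 (fun u => `|sumh j u e|).
Let linear j (e : N.-tuple E) := \sum_i (a i j (tnth e i) - \int[P]_w a i j (Z i w)).

Let bsumh j u : bounded_mfun (sumh j u).
Proof.
apply: (bounded_mfun_sum _ (F := fun i (e : N.-tuple E) => cent i j u (tnth e i))) => i.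
by apply: bounded_mfunB; [exact: coord_bounded|exact: bounded_mfun_cst].
Qed.

Let bW j : bounded_mfun (W j).
Proof.
apply: (bounded_mfun_fmax i0 (F := fun u e => `|sumh j u e|)) => u.
exact: bounded_mfun_norm.
Qed.

Let blinear j : bounded_mfun (linear j).
Proof.
apply: (bounded_mfun_sum _ (F := fun i (e : N.-tuple E) =>
  a i j (tnth e i) - \int[P]_w a i j (Z i w))) => i.
by apply: bounded_mfunB; [exact: coord_bounded|exact: bounded_mfun_cst].
Qed.

Let msplit : measurable_fun setT split_joint.
Proof.
apply/measurable_fun_tnthP => i.
apply: (eq_measurable_fun (Z i \o (@tnth _ _)^~ i)) => [w _ /=|].
  by rewrite tnth_mktuple.
exact: measurableT_comp (mZ i) (measurable_tnth i).
Qed.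

Let rademacher_bound (t : N.-tuple T) :
  rademacher_max i0 (fun i u => v i u (tnth t i)) (fun=> 0) <=
  2 * C * rho * (S (split_joint t) * Num.sqrt (2 * ln (2 * p%:R))).
Proof.
pose j0 : 'I_p * bool := (Ordinal p0, true).
have dir2 u : \sum_k `|2 * C * dir u k| <= 2 * C * rho.
  under eq_bigr do rewrite normrM ger0_norm ?mulr_ge0//.
  by rewrite -mulr_sumr ler_wpM2l// mulr_ge0.
have := rademacher_max_linear_le i0 j0 (fun i k => X i k (Z i (tnth t i))) (fun=> 0) dir2.
have -> : (fun (i : 'I_N) u => \sum_k 2 * C * dir u k * X i k (Z i (tnth t i))) =
    (fun i u => v i u (tnth t i)).
  apply/funext => i; apply/funext => u; rewrite /v 2!mulr_sumr.
  by apply: eq_bigr => k _; ring.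
have -> : (fun u : I => \sum_k 2 * C * dir u k * 0) = (fun=> 0).
  by apply/funext => u; rewrite big1// => k _; rewrite mulr0.
have -> : (fun jb : 'I_p * bool => (-1) ^+ jb.2 * 0) = (fun=> 0 : R).
  by apply/funext => jb; rewrite mulr0.
move=> /le_trans; apply; rewrite ler_wpM2l//.
  rewrite !mulr_ge0//; apply: le_trans (dir_rho i0).
  by apply: sumr_ge0.
have card2p : #|{: 'I_p * bool}| = (2 * p)%N.
  by rewrite card_prod card_ord card_bool mulnC.
rewrite -natrM -card2p; apply: rademacher_max_le => //.
  by rewrite card2p; case: (p) p0 => // m _; rewrite mulnS.
move=> [j b] /=; apply: le_trans (S_ge j _).
apply: ler_sum => i _; rewrite exprMn -exprM mulnC exprM sqrrN expr1n expr1n mul1r.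
by rewrite tnth_mktuple.
Qed.

Let bv i u : bounded_mfun (v i u).
Proof.
do 2 apply: bounded_mfunZ.
apply: (bounded_mfun_sum _ (F := fun k w => X i k (Z i w) * dir u k)) => k.
apply: bounded_mfunM; last exact: bounded_mfun_cst.
exact: bounded_mfun_comp (mZ i) (bX i k).
Qed.

Let mean_rademacher : \int[tuple_power P N]_t
    rademacher_max i0 (fun i u => v i u (tnth t i)) (fun=> 0) <=
  2 * C * rho * Num.sqrt (2 * ln (2 * p%:R)) * \int[P]_w S (joint w).
Proof.
rewrite (Rintegral_split_joint mZ indZ bS) -probability_RintegralZ; last first.
  exact: bounded_mfun_comp msplit bS.
apply: probability_le_Rintegral.
- apply: (bounded_mfun_rademacher_max i0 (F := fun i u t => v i u (tnth t i))
    (L := fun _ _ => 0)) => [i u|u]; [exact: coordT_bounded|exact: bounded_mfun_cst].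
- by apply: bounded_mfunZ; exact: bounded_mfun_comp msplit bS.
- by move=> t; apply: le_trans (rademacher_bound t) _; rewrite le_eqVlt;
    apply/orP; left; apply/eqP; ring.
Qed.

(** The outer factor 2 pays for the absolute value: the maximum over h and the maximum over -h are
    symmetrized separately. *)
Let mean_W j : \int[P]_w W j (joint w) <=
  2 * (2 * C * rho * Num.sqrt (2 * ln (2 * p%:R)) * \int[P]_w S (joint w)).
Proof.
rewrite (Rintegral_split_joint mZ indZ (bW j)).
have bZN i u : bounded_mfun (fun w => - h i j u (Z i w)) by exact: bounded_mfunN.
have sp := symmetrization_le (fun=> 0) (fun i => bhZ i j) bv (fun i => h_dom i j).
have sm := symmetrization_le (fun=> 0) bZN bv (fun i => hN_dom i j).
rewrite [leRHS]mulr_natl mulr2n.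
apply: le_trans (lerD (le_trans sp mean_rademacher) (le_trans sm mean_rademacher)).
pose Fp (t : N.-tuple T) := fmax i0 (fun u => 0 +
  \sum_i (h i j u (Z i (tnth t i)) - \int[P]_w h i j u (Z i w))).
pose Fm (t : N.-tuple T) := fmax i0 (fun u => 0 +
  \sum_i (- h i j u (Z i (tnth t i)) - \int[P]_w - h i j u (Z i w))).
have bFp : bounded_mfun Fp.
  apply: (bounded_mfun_fmax i0 (F := fun u (t : N.-tuple T) => 0 +
    \sum_i (h i j u (Z i (tnth t i)) - \int[P]_w h i j u (Z i w)))) => u.
  apply: bounded_mfunD; first exact: bounded_mfun_cst.
  apply: (bounded_mfun_sum _ (F := fun i (t : N.-tuple T) =>
    h i j u (Z i (tnth t i)) - \int[P]_w h i j u (Z i w))) => i.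
  by apply: bounded_mfunB; [exact: coordT_bounded (bhZ i j u)|exact: bounded_mfun_cst].
have bFm : bounded_mfun Fm.
  apply: (bounded_mfun_fmax i0 (F := fun u (t : N.-tuple T) => 0 +
    \sum_i (- h i j u (Z i (tnth t i)) - \int[P]_w - h i j u (Z i w)))) => u.
  apply: bounded_mfunD; first exact: bounded_mfun_cst.
  apply: (bounded_mfun_sum _ (F := fun i (t : N.-tuple T) =>
    - h i j u (Z i (tnth t i)) - \int[P]_w - h i j u (Z i w))) => i.
  by apply: bounded_mfunB; [exact: coordT_bounded (bZN i u)|exact: bounded_mfun_cst].
rewrite -(probability_RintegralD (tuple_power P N) bFp bFm).
apply: probability_le_Rintegral.
- exact: bounded_mfun_comp msplit (bW j).
- exact: bounded_mfunD.
move=> t; apply: fmax_le => u.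
have sE s : sumh j s (split_joint t) =
    0 + \sum_i (h i j s (Z i (tnth t i)) - \int[P]_w h i j s (Z i w)).
  by rewrite add0r; apply: eq_bigr => i _; rewrite /cent tnth_mktuple.
have smE s : - sumh j s (split_joint t) =
    0 + \sum_i (- h i j s (Z i (tnth t i)) - \int[P]_w - h i j s (Z i w)).
  rewrite sE !add0r -sumrN; apply: eq_bigr => i _.
  by rewrite probability_RintegralN// opprB opprK addrC.
(* The value 0 at [i0] makes both one-sided maxima nonnegative, so that their sum dominates the
   maximum of the absolute values. *)
have z0 : sumh j i0 (split_joint t) = 0.
  rewrite sE add0r big1// => i _; rewrite h_i0.
  by under eq_Rintegral do rewrite h_i0; rewrite probability_Rintegral_cst subrr.
have p_ge s : sumh j s (split_joint t) <= Fp t.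
  by rewrite sE; exact: (fmax_ge i0 (fun u => 0 +
    \sum_i (h i j u (Z i (tnth t i)) - \int[P]_w h i j u (Z i w)))).
have m_ge s : - sumh j s (split_joint t) <= Fm t.
  by rewrite smE; exact: (fmax_ge i0 (fun u => 0 +
    \sum_i (- h i j u (Z i (tnth t i)) - \int[P]_w - h i j u (Z i w)))).
have := p_ge i0; have := m_ge i0; rewrite z0 oppr0 => Fm0 Fp0.
rewrite ler_norml; have := p_ge u; have := m_ge u; lra.
Qed.

Let coord_change (f : 'I_N -> E -> R) i (t t' : N.-tuple E) :
  (forall k, k != i -> tnth t k = tnth t' k) ->
  \sum_k f k (tnth t k) - \sum_k f k (tnth t' k) = f i (tnth t i) - f i (tnth t' i).
Proof.
move=> tt'; rewrite -sumrB (bigD1 i)//= big1 ?addr0// => k ki.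
by rewrite tt'// subrr.
Qed.

Let dlinear j : bounded_differences (linear j) (2 * ca).
Proof.
move=> i t t' tt'; rewrite (coord_change (fun i e => a i j e - \int[P]_w a i j (Z i w)) tt').
have := a_le i j (tnth t i); have := a_le i j (tnth t' i).
by rewrite !ler_norml => /andP[? ?] /andP[? ?]; lra.
Qed.

Let dlinearN j : bounded_differences (fun e => - linear j e) (2 * ca).
Proof.
move=> i t t' tt'; have := @dlinear j i t' t; rewrite opprK addrC; apply.
by move=> k ki; rewrite tt'.
Qed.

Let dW j : bounded_differences (W j) (2 * ch).
Proof.
move=> i t t' tt'; rewrite /W.
have [u ->] := fmax_ex i0 (fun u => `|sumh j u t|).
apply: (@le_trans _ _ (`|sumh j u t| - `|sumh j u t'|)).
  by rewrite lerB//; exact: (fmax_ge i0 (fun u => `|sumh j u t'|)).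
apply: le_trans (lerB_dist _ _) _.
rewrite /sumh (coord_change (fun i e => cent i j u e) tt') /cent.
rewrite opprB addrA subrK; apply: le_trans (ler_normB _ _) _.
by rewrite mulr_natl mulr2n lerD.
Qed.

Let mean_linear j : \int[P]_w linear j (joint w) = 0.
Proof.
rewrite /linear.
under eq_Rintegral do under eq_bigr do rewrite tnth_mktuple.
rewrite (probability_Rintegral_sum P _ (F := fun i w =>
  a i j (Z i w) - \int[P]_w' a i j (Z i w'))); last first.
  move=> i; apply: bounded_mfunB; last exact: bounded_mfun_cst.
  exact: bounded_mfun_comp (mZ i) (ba i j).
rewrite big1// => i _; rewrite probability_RintegralB ?probability_Rintegral_cst ?subrr//.
  exact: bounded_mfun_comp (mZ i) (ba i j).
exact: bounded_mfun_cst.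
Qed.

Let mjoint : measurable_fun setT joint.
Proof.
apply/measurable_fun_tnthP => i; apply: eq_measurable_fun (mZ i) => w _ /=.
by rewrite tnth_mktuple.
Qed.

Lemma finite_supremum_bound (q0 q1 : R) : 0 < q0 < 1 -> 0 < q1 < 1 ->
  exists Ev : set T, [/\ measurable Ev, ((1 - q0 - q1)%:E <= P Ev)%E &
    forall w, Ev w -> forall u,
      `|\sum_i (\sum_j dir u j * (a i j (Z i w) + h i j u (Z i w)) -
         \int[P]_w' (\sum_j dir u j * (a i j (Z i w') + h i j u (Z i w'))))| <=
      (\sum_j `|dir u j|) *
      (2 * (2 * C * rho * Num.sqrt (2 * ln (2 * p%:R)) *
         \int[P]_w (\big[Num.max/0]_(j < p) Num.sqrt (\sum_i X i j (Z i w) ^+ 2))) +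
       Num.sqrt (2 * N%:R) * (ca * Num.sqrt (ln (2 * p%:R / q0)) +
         ch * Num.sqrt (ln (p%:R / q1))))].
Proof.
move=> /andP[q00 q01] /andP[q10 q11].
have pR : 0 < p%:R :> R by rewrite ltr0n.
have p1 : 1 <= p%:R :> R by rewrite ler1n.
(* The two tails of each of the p linear sums share q0, and the single upper tail of each of the p
   maxima shares q1. Hence ln (2p / q0) and ln (p / q1). *)
pose r0 := q0 / (2 * p%:R); pose r1 := q1 / p%:R.
have r0P : 0 < r0 < 1.
  by rewrite divr_gt0 ?mulr_gt0//= ltr_pdivrMr ?mulr_gt0// mul1r; lra.
have r1P : 0 < r1 < 1.
  by rewrite divr_gt0//= ltr_pdivrMr// mul1r; lra.
have r0V : r0^-1 = 2 * p%:R / q0 by rewrite invf_div.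
have r1V : r1^-1 = p%:R / q1 by rewrite invf_div.
pose t0 := ca * Num.sqrt (2 * N%:R) * Num.sqrt (ln r0^-1).
pose t1 := ch * Num.sqrt (2 * N%:R) * Num.sqrt (ln r1^-1).
pose B1 j := [set w | t0 < linear j (joint w)].
pose B2 j := [set w | t0 < - linear j (joint w)].
pose B3 j := [set w | \int[P]_w W j (joint w) + t1 < W j (joint w)].
have blin j : bounded_mfun (fun w => linear j (joint w)).
  exact: bounded_mfun_comp mjoint (blinear j).
have mB1 j : measurable (B1 j) by apply: measurable_superlevel; case: (blin j).
have mB2 j : measurable (B2 j).
  by apply: measurable_superlevel; apply: measurable_funN; case: (blin j).
have mB3 j : measurable (B3 j).
  by apply: measurable_superlevel; case: (bounded_mfun_comp mjoint (bW j)).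
have PB1 j : (P (B1 j) <= r0%:E)%E.
  have := mcdiarmid_independent mZ indZ (blinear j) N0 ca0 r0P (@dlinear j).
  by rewrite mean_linear add0r.
have PB2 j : (P (B2 j) <= r0%:E)%E.
  have := mcdiarmid_independent mZ indZ (bounded_mfunN (blinear j)) N0 ca0 r0P (@dlinearN j).
  by rewrite probability_RintegralN// mean_linear oppr0 add0r.
have PB3 j : (P (B3 j) <= r1%:E)%E.
  exact: (mcdiarmid_independent mZ indZ (bW j) N0 ch0 r1P (@dW j)).
pose Bad := \big[setU/set0]_(j < p) (B1 j `|` B2 j `|` B3 j).
have mBj j : measurable (B1 j `|` B2 j `|` B3 j).
  by apply: measurableU => //; exact: measurableU.
have mBad : measurable Bad by exact: bigsetU_measurable.
have PBad : (P Bad <= (q0 + q1)%:E)%E.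
  apply: (@le_trans _ _ (\sum_(j < p) P (B1 j `|` B2 j `|` B3 j))%E).
    exact: measure_bigsetU_le.
  apply: (@le_trans _ _ (\sum_(j < p) (r0 + r0 + r1)%:E)%E).
    apply: lee_sum => j _; rewrite !EFinD.
    have U12 : (P (B1 j `|` B2 j) <= r0%:E + r0%:E)%E.
      exact: le_trans (measureU2 _ (mB1 j) (mB2 j)) (leeD (PB1 j) (PB2 j)).
    exact: le_trans (measureU2 _ (measurableU _ _ (mB1 j) (mB2 j)) (mB3 j))
      (leeD U12 (PB3 j)).
  rewrite sumEFin lee_fin sumr_const card_ord -mulr_natr /r0 /r1.
  by rewrite le_eqVlt; apply/orP; left; apply/eqP; field; rewrite lt0r_neq0.
exists (~` Bad); split; first exact: measurableC.
  rewrite probability_setC// -addrA -opprD EFinD EFinN.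
  by apply: leeB => //.
move=> w nBad u.
have nB j : ~ (B1 j `|` B2 j `|` B3 j) w.
  by move=> Bw; apply: nBad; rewrite /Bad (bigD1 j)//=; left.
have lin_le j : `|linear j (joint w)| <= t0.
  rewrite ler_norml lerNl; apply/andP; split; rewrite leNgt; apply/negP => h0;
    apply: (nB j); left; [right|left]; exact: h0.
have rem_le j : `|sumh j u (joint w)| <= \int[P]_w W j (joint w) + t1.
  apply: (@le_trans _ _ (W j (joint w))).
    exact: (fmax_ge i0 (fun u => `|sumh j u (joint w)|)).
  by rewrite leNgt; apply/negP => h0; apply: (nB j); right.
set beta := _ + _.
have term_le j : `|linear j (joint w) + sumh j u (joint w)| <= beta.
  apply: le_trans (ler_normD _ _) _.
  have SE : \int[P]_w S (joint w) =
      \int[P]_w (\big[Num.max/0]_(j < p) Num.sqrt (\sum_i X i j (Z i w) ^+ 2)).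
    apply: eq_Rintegral => w' _; apply: eq_bigr => k _; congr Num.sqrt.
    by apply: eq_bigr => i _; rewrite tnth_mktuple.
  have := mean_W j; rewrite SE => mW.
  have := lin_le j; have := rem_le j; rewrite /t0 /t1 r0V r1V /beta.
  move: mW; set m := \int[P]_w W j _; set b := 2 * (_ * _).
  by set s := Num.sqrt (2 * N%:R); set s0 := Num.sqrt _; set s1 := Num.sqrt _; lra.
have bF i j : bounded_mfun (fun w => a i j (Z i w) + h i j u (Z i w)).
  by apply: bounded_mfunD => //; exact: bounded_mfun_comp (mZ i) (ba i j).
rewrite (_ : \sum_i _ = \sum_j dir u j * (linear j (joint w) + sumh j u (joint w))).
  apply: le_trans (ler_norm_sum _ _ _) _; rewrite mulr_suml; apply: ler_sum => j _.
  by rewrite normrM ler_wpM2l.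
rewrite /linear /sumh /cent; under [RHS]eq_bigr do rewrite -big_split/= mulr_sumr.
rewrite exchange_big; apply: eq_bigr => i _/=.
rewrite (probability_Rintegral_sum P _ (F := fun j w' =>
  dir u j * (a i j (Z i w') + h i j u (Z i w')))); last by move=> j; exact: bounded_mfunZ.
rewrite -sumrB; apply: eq_bigr => j _; rewrite probability_RintegralZ//.
rewrite probability_RintegralD//; last exact: bounded_mfun_comp (mZ i) (ba i j).
by rewrite !tnth_mktuple; ring.
Qed.

End finite_supremum.

(** * The hidden variable model *)

Section observation.
Context {R : realType} {d} {T : measurableType d} (P : probability T R).
Context {d1 d2} {X : measurableType d1} {Y : measurableType d2}.
Context (omega : {mfun T >-> X}) (obs : {mfun T >-> Y}).
Context (mu : {sfinite_measure set X -> \bar R}) (nu : {sfinite_measure set Y -> \bar R}).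
Context {p : nat} (g : R -> R) (x : X -> 'rV[R]_p) (k : X -> Y -> R) (theta : 'rV[R]_p).
Context (MX Ag Bg : R) (x0 : X).
Hypothesis mx : forall j, measurable_fun setT (fun z => x z 0 j).
Hypothesis mk : measurable_fun setT (fun zy => k zy.1 zy.2).
Hypothesis k_ge0 : forall z y, 0 <= k z y.
Hypothesis dens : has_density P omega obs g x k mu nu theta.
Hypothesis MX_ge0 : 0 <= MX.
Hypothesis x_bnd : {ae P, forall w, `|x (omega w)| <= MX}.
Hypothesis g_diff : forall t, derivable g t 1.
Hypotheses (Ag_gt0 : 0 < Ag) (AgBg : Ag < Bg).
Hypothesis g_bnd : forall t, Ag <= g t <= Bg.

Local Notation Zth := (normalizer g x k mu nu theta).

(** The covariates are bounded by MX only almost surely, whereas the estimates on conditional means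
    ask for a bound at every point. *)
Definition truncated z : 'rV[R]_p := \row_j (if `|x z 0 j| <= MX then x z 0 j else 0).

Definition density (zy : X * Y) := g (dotv (x zy.1) theta) * k zy.1 zy.2 / Zth.

Let g_gt0 t : 0 < g t.
Proof. by have /andP[h _] := g_bnd t; exact: lt_le_trans h. Qed.

(** If it were 0, the density would be identically 0 by 0^-1 = 0, against total mass 1. An infinite
    integral is excluded as well, because [fine] sends it to 0. *)
Lemma normalizer_gt0 : 0 < Zth.
Proof.
rewrite lt0r; apply/andP; split; last first.
  apply: fine_ge0; apply: integral_ge0 => y _; apply: integral_ge0 => z _.
  by rewrite lee_fin mulr_ge0// ltW.
apply/eqP => Z0; have := dens measurableT.
rewrite (_ : [set w | _] = setT)// probability_setT Z0.
rewrite integral0_eq => [/eqP|y _]; first by rewrite eqe oner_eq0.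
by rewrite integral0_eq// => z _; rewrite invr0 !mulr0.
Qed.

Lemma density_ge0 zy : 0 <= density zy.
Proof. by rewrite /density divr_ge0 ?mulr_ge0// ltW// normalizer_gt0. Qed.

Let mg_x u : measurable_fun setT (fun z => g (dotv (x z) u)).
Proof. exact: measurableT_comp (measurable_derivable g_diff) (measurable_dotv mx u). Qed.

Lemma measurable_density : measurable_fun setT density.
Proof.
apply: measurable_funM; last exact: measurable_cst.
by apply: measurable_funM => //; exact: measurableT_comp (mg_x theta) measurable_fst.
Qed.

Lemma density_law B : measurable B -> P [set w | B (omega w, obs w)] =
  (\int[nu]_y \int[mu]_z (\1_B (z, y) * density (z, y))%:E)%E.
Proof. exact: dens. Qed.

Lemma truncated_le z j : `|truncated z 0 j| <= MX.
Proof. by rewrite mxE; case: ifPn => // _; rewrite normr0. Qed.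

Lemma measurable_truncated j : measurable_fun setT (fun z => truncated z 0 j).
Proof.
under eq_fun do rewrite mxE; apply: measurable_fun_ifT => //.
by apply: measurable_fun_ler => //; exact: measurableT_comp.
Qed.

Let bad : set X := [set z | truncated z != x z].

Let mbad : measurable bad.
Proof.
have -> : bad = \bigcup_(j in [set: 'I_p]) [set z | MX < `|x z 0 j|].
  apply/seteqP; split=> [z /= /eqP zx|z [j _ /= MXj]].
    apply: contrapT => h; apply: zx; apply/rowP => j; rewrite mxE.
    by case: ifPn => //; rewrite -ltNge => MXj; case: h; exists j.
  apply/eqP => /rowP /(_ j); rewrite mxE leNgt MXj/= => xj.
  by move: MXj; rewrite -xj normr0 ltNge MX_ge0.
apply: fin_bigcup_measurable => [|j _]; first exact: finite_finset.
by apply: measurable_superlevel; exact: measurableT_comp.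
Qed.

Lemma truncated_id z : `|x z| <= MX -> truncated z = x z.
Proof.
move=> xz; apply/rowP => j; rewrite mxE ifT//.
apply: le_trans xz; rewrite [leRHS]mx_normrE.
exact: (le_bigmax _ (fun ij => `|x z ij.1 ij.2|) (0, j)).
Qed.

Local Notation post K y := (posterior mu density x0 K y).

Let bI : bounded_mfun (\1_bad : X -> R).
Proof.
split; first exact: measurable_indic.
by exists 1 => z; rewrite indicE ger0_norm ?ler0n// lern1 leq_b1.
Qed.

(** By the tower property the mean of this nonnegative function is the probability that omega lies
    in [bad], which is 0. *)
Let ae_post_bad : {ae P, forall w, post \1_bad (obs w) = 0}.
Proof.
have bp := bounded_mfun_posterior mu x0 measurable_density density_ge0 bI.
have bpo := bounded_mfun_comp (measurable_funPT obs) bp.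
have := Rintegral_posterior x0 measurable_density density_ge0 density_law bI.
have -> : \int[P]_w \1_bad (omega w) = 0 :> R.
  rewrite /Rintegral (ae_eq_integral (cst 0%E))//.
  - by rewrite integral0.
  - apply/measurable_EFinP; apply: measurableT_comp (measurable_funPT omega).
    exact: measurable_indic.
  - apply: filterS x_bnd => w wx _; rewrite indicE memNset//= => /eqP.
    by apply; exact: truncated_id.
move=> I0; have : ae_eq P setT (fun w => (post \1_bad (obs w))%:E) (cst 0%E).
  apply/ae_eq_integral_abs => //; first by apply/measurable_EFinP; case: bpo.
  rewrite (eq_integral (fun w => (post \1_bad (obs w))%:E)).
    by rewrite -EFin_Rintegral// I0.
  move=> w _; rewrite gee0_abs// lee_fin.
  rewrite -(posterior_cst mu x0 measurable_density density_ge0 0 (obs w)).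
  apply: (posterior_le mu x0 measurable_density density_ge0) => //.
    exact: bounded_mfun_cst.
by apply: filterS => w /(_ Logic.I) [].
Qed.

Local Notation ratio u := (lik_ratio truncated g theta u).
Local Notation ratio_x u := (lik_ratio x g theta u).

Let b_ratio u : bounded_mfun (ratio u).
Proof.
exact: (bounded_mfun_lik_ratio theta measurable_truncated g_diff Ag_gt0 AgBg g_bnd u).
Qed.

Let b_ratio_x u : bounded_mfun (ratio_x u).
Proof. exact: (bounded_mfun_lik_ratio theta mx g_diff Ag_gt0 AgBg g_bnd u). Qed.

(** A single null set serves all u, as a supremum over D requires. The ratios with original and with
    truncated covariates differ by at most Bg / Ag, and only on [bad], whose posterior probability
    is 0. *)
Lemma marginal_likelihoodE : {ae P, forall w, 0 < fine (evidence mu density (obs w)) /\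
  forall u, fine (\int[mu]_z (g (dotv (x z) u) * k z (obs w))%:E)%E =
    Zth * fine (evidence mu density (obs w)) * post (ratio u) (obs w)}.
Proof.
apply: filterS2 (ae_evidence_ok measurable_density density_ge0 density_law) ae_post_bad.
move=> w ok bad0; have e0 := evidence_ok_gt0 ok; split=> // u.
have [_ ey] := andP ok.
have trunc_eq : post (ratio u) (obs w) = post (ratio_x u) (obs w).
  apply/eqP; rewrite -subr_eq0 -normr_le0.
  rewrite -(posteriorB mu x0 measurable_density density_ge0)//.
  apply: le_trans (posterior_normr mu x0 measurable_density density_ge0 _ _) _.
    exact: bounded_mfunB.
  apply: (@le_trans _ _ (post (fun z => (Bg / Ag) * \1_bad z) (obs w))).
    apply: (posterior_le mu x0 measurable_density density_ge0).
    - exact/bounded_mfun_norm/bounded_mfunB.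
    - exact: bounded_mfunZ.
    - move=> z; rewrite indicE; case: (boolP (z \in bad)) => [_|].
        have /andP[h1 h2] := lik_ratio_itv truncated theta Ag_gt0 AgBg g_bnd u z.
        have /andP[h3 h4] := lik_ratio_itv x theta Ag_gt0 AgBg g_bnd u z.
        have h5 : 0 < Ag / Bg by rewrite divr_gt0// (lt_trans Ag_gt0).
        by rewrite mulr1 ler_norml; apply/andP; split; lra.
      rewrite notin_setE /bad /= => /negP; rewrite negbK => /eqP zx.
      by rewrite /lik_ratio zx subrr normr0 mulr0.
  by rewrite (posteriorZ mu x0 measurable_density density_ge0)// bad0 mulr0.
rewrite trunc_eq /posterior ok; set ev := fine (evidence _ _ _); set J := \int[mu]_z _.
have -> : Zth * ev * (J / ev) = Zth * J.
  by rewrite -mulrA [ev * _]mulrC divfK// lt0r_neq0.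
rewrite -RintegralZl//; last exact: (posterior_integrable x0 measurable_density density_ge0).
apply: eq_Rintegral => z _; rewrite /lik_ratio /density/=.
have Z0 := lt0r_neq0 normalizer_gt0; have G0 := lt0r_neq0 (g_gt0 (dotv (x z) theta)).
by field; rewrite Z0 G0.
Qed.

End observation.

(** * Null sets and countable dense sequences *)

Lemma ae_ord d (T : measurableType d) (R : realType) (m : {measure set T -> \bar R})
    n (Q : 'I_n -> T -> Prop) :
  (forall i, {ae m, forall w, Q i w}) -> {ae m, forall w, forall i, Q i w}.
Proof.
move=> aeQ; have : {ae m, forall w, forall k (kn : (k < n)%N), Q (Ordinal kn) w}.
  apply/ae_foralln => k; case: (pselect (k < n)%N) => [kn|nk]; last first.
    by apply: aeW => w kn; case: nk.
  apply: filterS (aeQ (Ordinal kn)) => w Qw kn'.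
  by rewrite (_ : Ordinal kn' = Ordinal kn)//; exact: val_inj.
by apply: filterS => w h [k kn]; exact: h.
Qed.

(** The set where Q holds may fail to be measurable; a measurable null set covering the exceptions
    is removed instead. *)
Lemma probability_ae_restrict d (T : measurableType d) (R : realType) (P : probability T R)
    (Ev : set T) (c : \bar R) (Q : T -> Prop) :
  measurable Ev -> (c <= P Ev)%E -> {ae P, forall w, Q w} ->
  exists Ev', [/\ measurable Ev', (c <= P Ev')%E & forall w, Ev' w -> Ev w /\ Q w].
Proof.
move=> mEv cEv [A [mA A0 QA]]; exists (Ev `\` A); split; first exact: measurableD.
  have e0 : P (Ev `&` A) = 0%E.
    by apply: (subset_measure0 _ mA _ A0) => //; exact: measurableI.
  by move: cEv; rewrite (measureDI P mEv mA) [X in (_ + X)%E]e0 adde0.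
by move=> w [Ew nAw]; split=> //; apply: contrapT => nQ; apply: nAw; exact: QA.
Qed.

Lemma norm1_ge0 (R : realType) p (u : 'rV[R]_p) : 0 <= norm1 u.
Proof. exact: sumr_ge0. Qed.

(** Rational points may all miss D. For every rational center and every radius 1 / (m + 1) a point
    of D in that ball is chosen, if there is one. *)
Lemma countable_dense_norm1 (R : realType) p (D : set 'rV[R]_p) (v0 : 'rV[R]_p) : D v0 ->
  exists pts : nat -> 'rV[R]_p, (forall n, D (pts n)) /\
    forall u e, D u -> 0 < e -> exists n, norm1 (u - pts n) < e.
Proof.
move=> Dv0.
pose near_rat (qm : 'rV[rat]_p * nat) v := D v /\
  norm1 (v - map_mx ratr qm.1) < (qm.2.+1%:R : R)^-1.
have ex qm : exists v, D v /\ ((exists v', near_rat qm v') -> near_rat qm v).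
  have [[v [Dv nv]]|no] := pselect (exists v', near_rat qm v'); first by exists v.
  by exists v0.
have [f fP] := choice ex.
exists (fun n => if unpickle n is Some qm then f qm else v0); split.
  by move=> n; case: unpickle => // qm; have [] := fP qm.
move=> u e Du e0; have [m me] : exists m : nat, (m.+1%:R : R)^-1 < e / 2.
  have e20 : 0 < e / 2 by rewrite divr_gt0.
  exists (Num.truncn (e / 2)^-1); rewrite invf_plt ?posrE//.
  exact: truncnS_gt.
(* Dividing by p + 1 and not by p covers p = 0 and makes the sum over the p coordinates strictly
   smaller than the radius. *)
have dlt : 0 < (m.+1%:R : R)^-1 / p.+1%:R by rewrite divr_gt0// ?invr_gt0 ltr0n.
have [q qP] : exists q : 'rV[rat]_p, forall j, `|u 0 j - ratr (q 0 j)| < (m.+1%:R : R)^-1 / p.+1%:R.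
  move: dlt; set delta := _ / _ => dlt.
  have /choice[q qP] : forall j, exists s : rat, `|u 0 j - ratr s| < delta.
    move=> j; have : u 0 j - delta < u 0 j + delta by lra.
    move=> /rat_in_itvoo[s]; rewrite in_itv/= => /andP[s1 s2]; exists s.
    by rewrite ltr_norml; apply/andP; split; lra.
  by exists (\row_j q j) => j; rewrite mxE.
have uq : norm1 (u - map_mx ratr q) < (m.+1%:R : R)^-1.
  apply: (@le_lt_trans _ _ (\sum_(j < p) (m.+1%:R : R)^-1 / p.+1%:R)).
    by apply: ler_sum => j _; rewrite !mxE ltW// qP.
  rewrite sumr_const card_ord -[ltLHS]mulr_natr -mulrA gtr_pMr ?invr_gt0 ?ltr0n//.
  by rewrite mulrC ltr_pdivrMr ?ltr0n// mul1r ltr_nat.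
exists (pickle (q, m)); rewrite pickleK; set v := f _.
have [_ [Dv vq]] : D v /\ near_rat (q, m) v.
  by have [Dv nv] := fP (q, m); split=> //; apply: nv; exists u.
rewrite /= in vq; apply: (@le_lt_trans _ _ (norm1 (u - map_mx ratr q) + norm1 (v - map_mx ratr q))).
  rewrite /norm1 -big_split; apply: ler_sum => j _; rewrite /= !mxE.
  rewrite (_ : _ - _ = (u 0 j - ratr (q 0 j)) - (v 0 j - ratr (q 0 j))); last by ring.
  exact: ler_normB.
by apply: lt_trans (ltrD uq vq) _; rewrite [ltRHS]splitr ltrD.
Qed.

(** * The centered log-likelihood over the search domain *)

Section model.
Context {R : realType} {N p : nat}.
Context {d} {T : measurableType d} (P : probability T R).
Context {d1} {Om : measurableType d1} {d2} {Yc : measurableType d2}.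
Context (omega : 'I_N -> {mfun T >-> Om}) (Y : 'I_N -> {mfun T >-> Yc}).
Context (mu : 'I_N -> {sfinite_measure set Om -> \bar R}).
Context (nu : 'I_N -> {sfinite_measure set Yc -> \bar R}).
Context (g : 'I_N -> R -> R) (x : 'I_N -> Om -> 'rV[R]_p) (k : 'I_N -> Om -> Yc -> R).
Context (theta : 'rV[R]_p) (MX Ag Bg F1 F2 : R) (x0 : Om).
Hypothesis mx : forall i j, measurable_fun [set: Om] (fun z => x i z 0 j).
Hypothesis mk : forall i, measurable_fun [set: Om * Yc] (fun zy => k i zy.1 zy.2).
Hypothesis k_ge0 : forall i z y, 0 <= k i z y.
Hypothesis indep : mutually_independent P (fun i w => (omega i w, Y i w)).
Hypothesis dens : forall i, has_density P (omega i) (Y i)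
  (g i) (x i) (k i) (mu i) (nu i) theta.
Hypothesis MX_gt0 : 0 < MX.
Hypothesis x_bnd : {ae P, forall w, forall i, `|x i (omega i w)| <= MX}.
Hypothesis g_diff : forall i t, derivable (g i) t 1.
Hypotheses (Ag_gt0 : 0 < Ag) (AgBg : Ag < Bg).
Hypothesis g_bnd : forall i t, Ag <= g i t <= Bg.
Hypothesis dg_bnd : forall i t, `|derive1 (g i) t| <= F1.
Hypothesis dg_lip : forall i t s,
  `|derive1 (g i) t - derive1 (g i) s| <= F2 * `|t - s|.

Let xt i := truncated (x i) MX.
Let r i := density (mu i) (nu i) (g i) (x i) (k i) theta.
Let MX_ge0 : 0 <= MX. Proof. exact: ltW. Qed.
Let mxt i := measurable_truncated MX (mx i).
Let xt_le i := truncated_le (x i) MX_ge0.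
Let mr i : measurable_fun setT (r i) :=
  measurable_density (mu i) (nu i) theta (mx i) (mk i) (@g_diff i).
Let r0 i := density_ge0 (k_ge0 i) (dens i) Ag_gt0 (g_bnd i).

Definition log_lik_ratio i u y := ln (posterior (mu i) (r i) x0 (lik_ratio (xt i) (g i) theta u) y).

Definition centered_log_lik u w :=
  \sum_i (log_lik_ratio i u (Y i w) - \int[P]_w' log_lik_ratio i u (Y i w')).

Let ell u w := loss g x k mu nu (fun i => Y i w) u.

Let bounded_log_lik i u : bounded_mfun (fun w => log_lik_ratio i u (Y i w)).
Proof.
apply: (bounded_mfun_comp (measurable_funPT (Y i))).
exact: (bounded_mfun_ln_posterior (mu i) x0 (mr i) (r0 i) theta (mxt i) (xt_le i)
  (@g_diff i) Ag_gt0 AgBg (g_bnd i) (dg_bnd i) (dg_lip i) u).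
Qed.

Lemma bounded_mfun_centered_log_lik u : bounded_mfun (centered_log_lik u).
Proof.
apply: (bounded_mfun_sum _ (F := fun i w =>
  log_lik_ratio i u (Y i w) - \int[P]_w' log_lik_ratio i u (Y i w'))) => i.
by apply: bounded_mfunB; [exact: bounded_log_lik|exact: bounded_mfun_cst].
Qed.

Lemma centered_log_lik_lip u u' w :
  `|centered_log_lik u w - centered_log_lik u' w| <=
  2 * N%:R * (Bg / Ag * (F1 / Ag * MX)) * norm1 (u - u').
Proof.
set K := _ / _ * _.
have lip i y : `|log_lik_ratio i u y - log_lik_ratio i u' y| <= K * norm1 (u - u').
  have := ln_posterior_lip (mu i) x0 (mr i) (r0 i) theta (mxt i) (xt_le i)
    (@g_diff i) Ag_gt0 AgBg (g_bnd i) (dg_bnd i) u u' y.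
  by rewrite /K !mulrA.
rewrite /centered_log_lik -sumrB.
rewrite (_ : 2 * N%:R * K * norm1 _ = \sum_(i < N) 2 * (K * norm1 (u - u'))); last first.
  by rewrite sumr_const card_ord -mulr_natr; ring.
apply: le_trans (ler_norm_sum _ _ _) _; apply: ler_sum => i _.
rewrite opprB addrACA [_ - log_lik_ratio i u' _]addrC -addrA.
rewrite (_ : _ + _ = (log_lik_ratio i u (Y i w) - log_lik_ratio i u' (Y i w)) -
  (\int[P]_w' log_lik_ratio i u (Y i w') - \int[P]_w' log_lik_ratio i u' (Y i w')));
  last by ring.
rewrite -probability_RintegralB//.
apply: le_trans (ler_normB _ _) _; rewrite mulr_natl mulr2n lerD//.
have bB : bounded_mfun (fun w' => log_lik_ratio i u (Y i w') - log_lik_ratio i u' (Y i w')).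
  exact: bounded_mfunB.
rewrite ler_norml; apply/andP; split.
  apply: probability_Rintegral_ge => // w'.
  by have := lip i (Y i w'); rewrite ler_norml => /andP[].
apply: probability_Rintegral_le => // w'.
by have := lip i (Y i w'); rewrite ler_norml => /andP[].
Qed.

Let mlik i u : measurable_fun setT
  (fun w => ln (fine (\int[mu i]_z (g i (dotv (x i z) u) * k i z (Y i w))%:E)%E)).
Proof.
have mg : measurable_fun setT (fun z => g i (dotv (x i z) u)).
  exact: measurableT_comp (measurable_derivable (@g_diff i)) (measurable_dotv (mx i) u).
have m1 : measurable_fun setT
    (fun y => (\int[mu i]_z (g i (dotv (x i z) u) * k i z y)%:E)%E).
  apply: (measurable_partial_integral (mu i)
    (F := fun zy => (g i (dotv (x i zy.1) u) * k i zy.1 zy.2)%:E)).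
    apply/measurable_EFinP/measurable_funM => //.
    exact: measurableT_comp mg measurable_fst.
  move=> zy; rewrite lee_fin mulr_ge0//.
  by have /andP[h _] := g_bnd i (dotv (x i zy.1) u); exact: le_trans (ltW Ag_gt0) h.
apply: measurableT_comp => //; apply: measurableT_comp => //.
exact: measurableT_comp m1 (measurable_funPT (Y i)).
Qed.

Let log_lik_theta i y : log_lik_ratio i theta y = 0.
Proof.
rewrite /log_lik_ratio (_ : lik_ratio _ _ _ _ = cst 1).
  by rewrite (posterior_cst (mu i) x0 (mr i) (r0 i)) ln1.
apply/funext => z; rewrite /lik_ratio divff// lt0r_neq0//.
by have /andP[h _] := g_bnd i (dotv (xt i z) theta); exact: lt_le_trans h.
Qed.

(** The factor Z_i(theta) and the evidence of Y_i are common to u and theta and cancel. What remains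
    besides the log-ratios is deterministic, hence disappears on centering. *)
Lemma loss_log_likE : {ae P, forall w, forall u, ell u w - ell theta w =
  - \sum_i log_lik_ratio i u (Y i w) +
  (\sum_i ln (normalizer (g i) (x i) (k i) (mu i) (nu i) u) -
   \sum_i ln (normalizer (g i) (x i) (k i) (mu i) (nu i) theta))}.
Proof.
have xb i : {ae P, forall w, `|x i (omega i w)| <= MX} by apply: filterS x_bnd => w; apply.
have h i := marginal_likelihoodE x0 (mx i) (mk i) (k_ge0 i) (dens i) MX_ge0 (xb i)
  (@g_diff i) Ag_gt0 AgBg (g_bnd i).
apply: filterS (ae_ord h) => w hw u; rewrite /ell /loss opprD addrACA; congr (_ + _).
rewrite opprK addrC -sumrB -sumrN; apply: eq_bigr => i _.
have [ev0 lE] := hw i; rewrite !lE.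
have Z0 := normalizer_gt0 (k_ge0 i) (dens i) Ag_gt0 (g_bnd i).
have post_gt0 u' : 0 < posterior (mu i) (r i) x0 (lik_ratio (xt i) (g i) theta u') (Y i w).
  have /andP[lo _] := posterior_lik_ratio_itv (mu i) x0 (mr i) (r0 i) theta (mxt i)
    (@g_diff i) Ag_gt0 AgBg (g_bnd i) u' (Y i w).
  by apply: lt_le_trans lo; rewrite divr_gt0// (lt_trans Ag_gt0).
rewrite !lnM ?posrE ?mulr_gt0//.
have := log_lik_theta i (Y i w); rewrite /log_lik_ratio => ->.
by rewrite addr0 opprD addrA subrr add0r.
Qed.

Lemma centered_lossE : {ae P, forall w, forall u,
  centered P (fun w' => ell u w' - ell theta w') w = - centered_log_lik u w}.
Proof.
apply: filterS loss_log_likE => w hw u; rewrite /centered hw.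
set c := _ - \sum_i ln _.
have bS : bounded_mfun (fun w' => \sum_i log_lik_ratio i u (Y i w')).
  by apply: (bounded_mfun_sum _ (F := fun i w' => log_lik_ratio i u (Y i w'))).
have bF : bounded_mfun (fun w' => - \sum_i log_lik_ratio i u (Y i w') + c).
  by apply: bounded_mfunD; [exact: bounded_mfunN|exact: bounded_mfun_cst].
have mell u' : measurable_fun setT (ell u').
  apply: measurable_funD => //; apply: measurable_funN.
  apply: (@measurable_sum _ _ _ _ _ _ (fun i w' => ln (fine (\int[mu i]_z
    (g i (dotv (x i z) u') * k i z (Y i w'))%:E)%E))) => i; exact: mlik.
have -> : fine ('E_P[fun w' => (ell u w' - ell theta w')%R])%E =
    \int[P]_w' (- \sum_i log_lik_ratio i u (Y i w') + c).
  rewrite unlock; congr fine; apply: ae_eq_integral => //.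
  - by apply/measurable_EFinP/measurable_funB; exact: mell.
  - by apply/measurable_EFinP; case: bF.
  - by apply: filterS loss_log_likE => w' hw' _; rewrite hw'.
rewrite probability_RintegralD; [|exact: bounded_mfunN|exact: bounded_mfun_cst].
rewrite probability_RintegralN// probability_Rintegral_cst.
rewrite (probability_Rintegral_sum P _ (F := fun i w' => log_lik_ratio i u (Y i w')))//.
by rewrite /centered_log_lik sumrB; ring.
Qed.

Let SX w := max_col_norm (fun i => x i (omega i w)).
Let St w := \big[Num.max/0]_(j < p) Num.sqrt (\sum_i xt i (omega i w) 0 j ^+ 2).

Let bcoord i j : bounded_mfun (fun w => xt i (omega i w) 0 j).
Proof.
exact: (bounded_mfun_comp (measurable_funPT (omega i)) (bounded_mfun_coord (mxt i) (xt_le i) j)).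
Qed.

Let bSt : bounded_mfun St.
Proof.
rewrite /St; elim: (index_enum _) => [|j s IH].
  by under eq_fun do rewrite big_nil; exact: bounded_mfun_cst.
under eq_fun do rewrite big_cons; apply: bounded_mfun_max => //.
apply: bounded_mfun_sqrt.
apply: (bounded_mfun_sum _ (F := fun i w => xt i (omega i w) 0 j ^+ 2)) => i.
by under eq_fun do rewrite expr2; exact: bounded_mfunM.
Qed.

Let mSX : measurable_fun setT SX.
Proof.
rewrite /SX /max_col_norm; elim: (index_enum _) => [|j s IH].
  by under eq_fun do rewrite big_nil; exact: measurable_cst.
under eq_fun do rewrite big_cons; apply: measurable_maxr => //.
apply: measurableT_comp; first by apply: continuous_measurable_fun; exact: sqrt_continuous.
apply: (@measurable_sum _ _ _ _ _ _ (fun i w => x i (omega i w) 0 j ^+ 2)) => i.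
apply: measurable_funX; exact: measurableT_comp (mx i j) (measurable_funPT (omega i)).
Qed.

Lemma expectation_SX : ('E_P[SX] = (\int[P]_w St w)%:E)%E.
Proof.
rewrite EFin_Rintegral// unlock; apply: ae_eq_integral => //.
- exact/measurable_EFinP.
- by apply/measurable_EFinP; case: bSt.
apply: filterS x_bnd => w xw _; congr EFin; apply: eq_bigr => j _; congr Num.sqrt.
by apply: eq_bigr => i _; rewrite /xt truncated_id.
Qed.

(** The given events need not be nested. They lie in the events [F n] that the first n points obey
    the bound; these decrease, and continuity from above applies. *)
Lemma countable_points_bound (pts : nat -> 'rV[R]_p) (beta : R) (c : \bar R) :
  (forall n, exists Ev : set T, [/\ measurable Ev, (c <= P Ev)%E &
    forall w, Ev w -> forall i, (i < n)%N ->
      `|centered_log_lik (pts i) w| <= norm1 (pts i - theta) * beta]) ->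
  exists Ev : set T, [/\ measurable Ev, (c <= P Ev)%E & forall w, Ev w ->
    forall i, `|centered_log_lik (pts i) w| <= norm1 (pts i - theta) * beta].
Proof.
move=> fin; pose A i := [set w | `|centered_log_lik (pts i) w| <= norm1 (pts i - theta) * beta].
have mA i : measurable (A i).
  have -> : A i = ~` [set w | norm1 (pts i - theta) * beta < `|centered_log_lik (pts i) w|].
    by apply/seteqP; split=> w; rewrite /A /= leNgt => /negP.
  apply/measurableC/measurable_superlevel; apply: measurableT_comp => //.
  by case: (bounded_mfun_centered_log_lik (pts i)).
pose F n := \bigcap_(i < n) A i.
have mF n : measurable (F n) by apply: bigcap_measurableType => i _; exact: mA.
have mFF : measurable (\bigcap_n F n) by apply: bigcap_measurableType => i _; exact: mF.
have PF n : (c <= P (F n))%E.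
  have [Ev [mEv cEv Ev_le]] := fin n; apply: le_trans cEv _.
  by apply: le_measure; rewrite ?inE// => w Ew i /= ni; exact: Ev_le Ew _ ni.
exists (\bigcap_n F n); split=> //.
  have cvgF : P \o F @ \oo --> P (\bigcap_n F n).
    apply: nonincreasing_cvg_mu => //.
      by rewrite (le_lt_trans (probability_le1 _ _))// ltry.
    move=> m n mn; apply/subsetPset => w Fw i im.
    by apply: Fw; exact: leq_trans im mn.
  rewrite -(cvg_lim _ cvgF)//; apply: lime_ge; first by apply/cvg_ex; eexists; exact: cvgF.
  by apply: nearW => n; exact: PF.
by move=> w Fw i; exact: (Fw i.+1 Logic.I i (leqnn _)).
Qed.

Lemma dense_points_bound (D : set 'rV[R]_p) (beta : R) (c : \bar R) : 0 <= beta -> D theta ->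
  (forall (pts : nat -> 'rV[R]_p) n, (forall i, D (pts i)) ->
    exists Ev : set T, [/\ measurable Ev, (c <= P Ev)%E & forall w, Ev w ->
      forall i, (i < n)%N ->
      `|centered_log_lik (pts i) w| <= norm1 (pts i - theta) * beta]) ->
  exists Ev : set T, [/\ measurable Ev, (c <= P Ev)%E & forall w, Ev w -> forall u, D u ->
    `|centered P (fun w' => ell u w' - ell theta w') w| <= norm1 (u - theta) * beta].
Proof.
move=> beta0 Dth fin; have [pts [Dpts dense]] := countable_dense_norm1 Dth.
have [Ev [mEv cEv Ev_le]] := countable_points_bound (fun n => fin pts n Dpts).
have [Ev' [mEv' cEv' Ev'E]] := probability_ae_restrict mEv cEv centered_lossE.
exists Ev'; split=> // w /Ev'E [Ew cE] u Du; rewrite cE normrN.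
pose K := 2 * N%:R * (Bg / Ag * (F1 / Ag * MX)).
have [n0|N0] := leqP N 0.
  rewrite /centered_log_lik big1 ?normr0 ?mulr_ge0 ?norm1_ge0// => i _.
  by have := leq_trans (ltn_ord i) n0.
have K0 : 0 <= K.
  have F10 : 0 <= F1 by exact: le_trans (dg_bnd (Ordinal N0) 0).
  have Bg0 : 0 < Bg by exact: lt_trans AgBg.
  by rewrite !mulr_ge0// ?invr_ge0 ltW.
apply/ler_addgt0Pr => e e0.
(* Moving from u to a point of the sequence costs beta times the distance in the norm and K times
   the distance in the log-likelihood; the 1 keeps the denominator positive. *)
have d0 : 0 < e / (beta + K + 1) by rewrite divr_gt0// ltr_wpDl// addr_ge0.
have [n un] := dense u _ Du d0; set de := e / _ in d0 un.
have h1 := centered_log_lik_lip u (pts n) w; have h2 := Ev_le w Ew n.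
have h3 : norm1 (pts n - theta) <= norm1 (u - theta) + de.
  apply: le_trans (_ : norm1 (u - theta) + norm1 (u - pts n) <= _); last by rewrite lerD2l ltW.
  rewrite /norm1 -big_split; apply: ler_sum => j _; rewrite /= !mxE.
  rewrite (_ : _ - _ = (u 0 j - theta 0 j) - (u 0 j - pts n 0 j)); last by ring.
  exact: ler_normB.
have h4 : `|centered_log_lik u w| <=
    `|centered_log_lik (pts n) w| + `|centered_log_lik u w - centered_log_lik (pts n) w|.
  by apply: le_trans (ler_normD _ _); rewrite [X in _ <= `|X|]addrC subrK.
have h5 : K * norm1 (u - pts n) <= K * de by rewrite ler_wpM2l// ltW.
have h6 : norm1 (pts n - theta) * beta <= (norm1 (u - theta) + de) * beta by rewrite ler_wpM2r.
have h7 : (beta + K) * de <= e.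
  rewrite /de mulrCA -{2}[e]mulr1 ler_wpM2l ?(ltW e0)// ler_pdivrMr ?ltr_wpDl ?addr_ge0//.
  by rewrite mul1r lerDl.
apply: le_trans h4 _; apply: le_trans (lerD h2 h1) _; rewrite -/K; lra.
Qed.

Section finite_points.
Hypotheses (N0 : (0 < N)%N) (p0 : (0 < p)%N) (F1_gt0 : 0 < F1).
Context {I : finType} (i0 : I) (pt : I -> 'rV[R]_p) (rho psi3 : R).
Hypothesis pt0 : pt i0 = theta.
Hypothesis pt_rho : forall u, norm1 (pt u - theta) <= rho.
Hypothesis psi3P : 2 * F1 <= psi3 * Ag \/ F2 * MX / 2 * rho <= psi3 * Ag.
Hypothesis psi3_ge0 : 0 <= psi3.

Local Notation psi4 :=
  ((F1 / Ag * varrho0 Ag Bg + psi3 * (1 + varrho0 Ag Bg)) * MX).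
Local Notation C := (score_lip MX Ag Bg F1 F2).

Let h i j u (e : Om * Yc) := score_rem (mu i) (r i) x0 (xt i) (g i) theta j (pt u) e.2.
Let a i j (e : Om * Yc) := score_coef (mu i) (r i) x0 (xt i) (g i) theta j theta e.2.

Let psi4_gt0 : 0 < psi4.
Proof.
have v0 := varrho0_gt0 Ag_gt0 AgBg.
rewrite mulr_gt0// ltr_wpDr//; first by rewrite mulr_ge0// addr_ge0// ltW.
by rewrite mulr_gt0// divr_gt0.
Qed.

Let bh i j u : bounded_mfun (h i j u).
Proof.
apply: (bounded_mfun_comp measurable_snd).
exact: (bounded_mfun_score_rem (mu i) x0 (mr i) (r0 i) theta (mxt i) (xt_le i)
  (@g_diff i) Ag_gt0 AgBg (g_bnd i) (dg_bnd i) (dg_lip i) j (pt u)).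
Qed.

Let ba i j : bounded_mfun (a i j).
Proof.
apply: (bounded_mfun_comp measurable_snd).
exact: (bounded_mfun_score_coef (mu i) x0 (mr i) (r0 i) theta (mxt i) (xt_le i)
  (@g_diff i) Ag_gt0 (g_bnd i) (dg_bnd i) (dg_lip i) j theta).
Qed.

Let bXt i j : bounded_mfun (fun e : Om * Yc => xt i e.1 0 j).
Proof. exact: (bounded_mfun_comp measurable_fst (bounded_mfun_coord (mxt i) (xt_le i) j)). Qed.

Let vv i u w := C * \sum_j xt i (omega i w) 0 j * (pt u - theta) 0 j.

Let vvE i u w : vv i u w = C * shift (xt i) theta (pt u) (omega i w).
Proof. by []. Qed.

Let bshift i u : bounded_mfun (shift (xt i) theta u).
Proof. exact: (bounded_mfun_shift theta (mxt i) (xt_le i)). Qed.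

Let bvv i u : bounded_mfun (vv i u).
Proof. exact: (bounded_mfunZ C (bounded_mfun_comp (measurable_funPT (omega i)) (bshift i (pt u)))). Qed.

Let inc i u u' := mean_increment (mu i) (r i) x0 (xt i) theta (pt u) (pt u').

Let binc i u u' : bounded_mfun (fun w => C * inc i u u' (Y i w)).
Proof.
apply: bounded_mfunZ; apply: (bounded_mfun_comp (measurable_funPT (Y i))).
exact: (bounded_mfun_mean_increment (mu i) x0 (mr i) (r0 i) theta (mxt i) (xt_le i)).
Qed.

Let C_ge0 : 0 <= C.
Proof. exact: (score_lip_ge0 MX_ge0 Ag_gt0 AgBg (dg_bnd (Ordinal N0)) (dg_lip (Ordinal N0))). Qed.

(* Jensen's inequality for the posterior mean, and the tower property. *)
Let inc_jensen i L : \int[P]_w fmax (i0, i0)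
    (fun z => L z.1 + L z.2 + 2 * (C * inc i z.1 z.2 (Y i w))) <=
  \int[P]_w fmax (i0, i0) (fun z => L z.1 + L z.2 + 2 * `|vv i z.1 w - vv i z.2 w|).
Proof.
pose K z := fmax (i0, i0) (fun q => L q.1 + L q.2 + 2 * C *
  `|shift (xt i) theta (pt q.1) z - shift (xt i) theta (pt q.2) z|).
have bterm q : bounded_mfun (fun z => L q.1 + L q.2 + 2 * C *
    `|shift (xt i) theta (pt q.1) z - shift (xt i) theta (pt q.2) z|).
  apply: bounded_mfunD; first exact: bounded_mfun_cst.
  exact/bounded_mfunZ/bounded_mfun_norm/bounded_mfunB.
have bK : bounded_mfun K.
  exact: (bounded_mfun_fmax (i0, i0) (F := fun q z => L q.1 + L q.2 + 2 * C *
    `|shift (xt i) theta (pt q.1) z - shift (xt i) theta (pt q.2) z|)).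
have KE w : fmax (i0, i0) (fun z => L z.1 + L z.2 + 2 * `|vv i z.1 w - vv i z.2 w|) =
    K (omega i w).
  congr fmax; apply/funext => q; rewrite !vvE -mulrBr normrM (ger0_norm C_ge0).
  by rewrite mulrA.
under [leRHS]eq_Rintegral do rewrite KE.
rewrite -(Rintegral_posterior x0 (mr i) (r0 i) (density_law (dens i)) bK).
apply: probability_le_Rintegral.
- apply: (bounded_mfun_fmax (i0, i0) (F := fun z w =>
    L z.1 + L z.2 + 2 * (C * inc i z.1 z.2 (Y i w)))) => q.
  by apply: bounded_mfunD; [exact: bounded_mfun_cst|exact: bounded_mfunZ].
- exact: (bounded_mfun_comp (measurable_funPT (Y i))
    (bounded_mfun_posterior (mu i) x0 (mr i) (r0 i) bK)).
move=> w; apply: fmax_le => q.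
have bs := bounded_mfun_norm (bounded_mfunB (bshift i (pt q.1)) (bshift i (pt q.2))).
apply: (@le_trans _ _ (posterior (mu i) (r i) x0 (fun z => L q.1 + L q.2 + 2 * C *
    `|shift (xt i) theta (pt q.1) z - shift (xt i) theta (pt q.2) z|) (Y i w))).
  rewrite (posteriorD (mu i) x0 (mr i) (r0 i)); [|exact: bounded_mfun_cst|exact: bounded_mfunZ].
  rewrite (posterior_cst (mu i) x0 (mr i) (r0 i)) (posteriorZ (mu i) x0 (mr i) (r0 i))//.
  by rewrite mulrA.
apply: (posterior_le (mu i) x0 (mr i) (r0 i)) => // z.
exact: (fmax_ge (i0, i0) (fun q => L q.1 + L q.2 + 2 * C *
  `|shift (xt i) theta (pt q.1) z - shift (xt i) theta (pt q.2) z|) q).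
Qed.

Let rem_lip i j u u' w :
  `|h i j u (omega i w, Y i w) - h i j u' (omega i w, Y i w)| <= C * inc i u u' (Y i w).
Proof.
exact: (score_rem_lip (mu i) x0 (mr i) (r0 i) theta (mxt i) (xt_le i)
  (@g_diff i) Ag_gt0 AgBg (g_bnd i) (dg_bnd i) (dg_lip i)).
Qed.

Let mZ i : measurable_fun setT (fun w => (omega i w, Y i w)).
Proof. by apply: measurable_fun_pair. Qed.

Let bhZ i j u : bounded_mfun (fun w => h i j u (omega i w, Y i w)).
Proof. exact: (bounded_mfun_comp (mZ i) (bh i j u)). Qed.

Lemma finite_points_bound q0 q1 : 0 < q0 < 1 -> 0 < q1 < 1 ->
  exists Ev : set T, [/\ measurable Ev, ((1 - q0 - q1)%:E <= P Ev)%E &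
    forall w, Ev w -> forall u, `|centered_log_lik (pt u) w| <= norm1 (pt u - theta) *
      (2 * (2 * C * rho * Num.sqrt (2 * ln (2 * p%:R)) * \int[P]_w St w) +
       Num.sqrt (2 * N%:R) * (MX * (F1 / Ag) * Num.sqrt (ln (2 * p%:R / q0)) +
         psi4 * Num.sqrt (ln (p%:R / q1))))].
Proof.
move=> q001 q101.
have ca0 : 0 < MX * (F1 / Ag) by rewrite mulr_gt0// divr_gt0.
have a_le i j e : `|a i j e| <= MX * (F1 / Ag).
  exact: (normr_score_coef_le (mu i) x0 (mr i) (r0 i) theta (mxt i) (xt_le i)
    (@g_diff i) Ag_gt0 (g_bnd i) (dg_bnd i) (dg_lip i)).
have h_le i j u e : `|h i j u e| <= psi4.
  exact: (normr_score_rem_le (mu i) x0 (mr i) (r0 i) (mxt i) MX_ge0 (xt_le i)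
    (@g_diff i) Ag_gt0 AgBg (g_bnd i) (dg_bnd i) (dg_lip i) j e.2 psi3P (pt_rho u)).
have h_i0 i j e : h i j i0 e = 0.
  rewrite /h pt0; exact: (score_rem_theta (mu i) x0 (mr i) (r0 i) (xt i) theta Ag_gt0 (g_bnd i)).
have dom i j : sign_dominated P i0 (fun u w => h i j u (omega i w, Y i w))
    (fun u w => 2 * vv i u w).
  exact: (increments_sign_dominated (bhZ i j) (bvv i) (binc i) (rem_lip i j) (inc_jensen i)).
have domN i j : sign_dominated P i0 (fun u w => - h i j u (omega i w, Y i w))
    (fun u w => 2 * vv i u w).
  have remN u u' w : `|- h i j u (omega i w, Y i w) - - h i j u' (omega i w, Y i w)| <=
      C * inc i u u' (Y i w) by rewrite -opprD normrN; exact: rem_lip.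
  exact: (increments_sign_dominated (fun u => bounded_mfunN (bhZ i j u)) (bvv i) (binc i)
    remN (inc_jensen i)).
have [Ev [mEv PEv Ev_le]] := finite_supremum_bound (dir := fun u j => (pt u - theta) 0 j)
  mZ indep N0 p0 pt_rho ba bXt bh ca0 psi4_gt0 C_ge0 a_le h_le h_i0 dom domN q001 q101.
exists Ev; split=> // w Ew u; apply: le_trans (Ev_le w Ew u).
rewrite le_eqVlt; apply/orP; left; apply/eqP; congr Num.norm; apply: eq_bigr => i _.
(* The point [x0] only fills the first component, since [a] and [h] read the second. *)
have llE y : log_lik_ratio i (pt u) y =
    \sum_j (pt u - theta) 0 j * (a i j (x0, y) + h i j u (x0, y)).
  exact: (ln_posterior_lik_ratio (mu i) x0 (mr i) (r0 i) theta (mxt i) (xt_le i)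
    (@g_diff i) Ag_gt0 AgBg (g_bnd i) (dg_bnd i) (dg_lip i)).
by rewrite llE; under eq_Rintegral do rewrite llE.
Qed.

End finite_points.

End model.

(** * Degenerate cases, and bounded or unbounded domains *)

Lemma loss_empty_sample (R : realType) (N p : nat) d1 (Om : measurableType d1)
    d2 (Yc : measurableType d2) (g : 'I_N -> R -> R) (x : 'I_N -> Om -> 'rV[R]_p)
    (k : 'I_N -> Om -> Yc -> R) (mu : 'I_N -> set Om -> \bar R)
    (nu : 'I_N -> set Yc -> \bar R) (Y : 'I_N -> Yc) u u' : N = 0 ->
  loss g x k mu nu Y u = loss g x k mu nu Y u'.
Proof.
move=> N0; have sumE (f f' : 'I_N -> R) : \sum_i f i = \sum_i f' i.
  by apply: eq_bigr => -[m mN]; exfalso; rewrite N0 in mN.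
exact: (f_equal2 (fun s t => - s + t) (sumE _ _) (sumE _ _)).
Qed.

Unset Implicit Arguments.
Set Strict Implicit.

Theorem theorem5p1 (R : realType) (N p : nat)
    (d : measure_display) (T : measurableType d) (P : probability T R)
    (d1 : measure_display) (Om : measurableType d1)
    (d2 : measure_display) (Yc : measurableType d2)
    (omega : 'I_N -> {mfun T >-> Om}) (Y : 'I_N -> {mfun T >-> Yc})
    (mu : 'I_N -> {sfinite_measure set Om -> \bar R})
    (nu : 'I_N -> {sfinite_measure set Yc -> \bar R})
    (g : 'I_N -> R -> R) (x : 'I_N -> Om -> 'rV[R]_p)
    (k : 'I_N -> Om -> Yc -> R)
    (D : set 'rV[R]_p) (theta : 'rV[R]_p)
    (MX Ag Bg F1 F2 : R)
    (mx : forall i j, measurable_fun [set: Om] (fun z => x i z 0 j))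
    (mk : forall i, measurable_fun [set: Om * Yc] (fun zy => k i zy.1 zy.2))
    (k_ge0 : forall i z y, 0 <= k i z y)
    (indep : mutually_independent P (fun i w => (omega i w, Y i w)))
    (dens : forall i, has_density P (omega i) (Y i)
                        (g i) (x i) (k i) (mu i) (nu i) theta)
    (thetaD : D theta)
    (MX_gt0 : 0 < MX)
    (x_bnd : {ae P, forall w, forall i, `|x i (omega i w)| <= MX})
    (g_diff : forall i t, derivable (g i) t 1)
    (Ag_gt0 : 0 < Ag) (AgBg : Ag < Bg)
    (g_bnd : forall i t, Ag <= g i t <= Bg)
    (dg_bnd : forall i t, `|derive1 (g i) t| <= F1)
    (dg_lip : forall i t s, `|derive1 (g i) t - derive1 (g i) s| <= F2 * `|t - s|)
    (q0 q1 : R) (q0_01 : 0 < q0 < 1) (q1_01 : 0 < q1 < 1)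
    (q01 : q0 + q1 < 1) :
  let ell u w := loss g x k mu nu (fun i => Y i w) u in
  let SX w := max_col_norm (fun i => x i (omega i w)) in
  let RD := radius1 D theta in
  let rho0 := varrho0 Ag Bg in
  let rho1 := varrho1 Ag Bg in
  let psi1 := F1 / Ag in
  let psi2 := F2 * MX / (2 * Ag) in
  let psi3 := fine (Order.min (2 * F1)%:E ((F2 * MX / 2)%:E * RD)%E) / Ag in
  let psi4 := (psi1 * rho0 + psi3 * (1 + rho0)) * MX in
  let psi5 := 2 * psi1 * MX * rho1 in
  let psi6 := 2 * (rho0 + psi3 * MX * rho1) in
  let A := ((2 * psi2 * (1 + psi6))%:E
            + (psi1%:E + (2 * psi2)%:E * RD + (2 * psi3)%:E)
              * (psi5 + psi6)%:E)%E in
  let bound :=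
    ((2 * Num.sqrt 2)%:E * RD * 'E_P[SX]
       * (A * (Num.sqrt (ln (2 * p%:R)))%:E
          + (2 * psi3 * (psi5 + psi6))%:E)
     + (Num.sqrt (2 * N%:R)
          * (psi1 * MX * Num.sqrt (ln (2 * p%:R / q0))
             + 2 * psi4 * Num.sqrt (ln (p%:R / q1))))%:E)%E in
  exists E : set T,
    [/\ measurable E,
        ((1 - q0 - q1)%:E <= P E)%E
      & forall w, E w ->
          (ereal_sup
             [set (`|centered P (fun w' => ell u w' - ell theta w') w|
                   / norm1 (u - theta))%:E | u in D `\ theta]
           <= bound)%E].
Proof.
move=> ell SX RD rho0 rho1 psi1 psi2 psi3 psi4 psi5 psi6 A bound.
have Bg0 : 0 < Bg by exact: lt_trans AgBg.
have RD0 : (0 <= RD)%E.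
  apply: ereal_sup_ubound; exists theta => //.
  by rewrite subrr /norm1 big1// => j _; rewrite mxE normr0.
have SX0 w : 0 <= SX w by exact: bigmax_ge_id.
have ESX0 : (0 <= 'E_P[SX])%E by exact: expectation_ge0.
(* Shared by the cases N = 0, F1 <= 0 and p = 0, where the loss does not depend on u. *)
have triv : (0 <= bound)%E -> (forall u w, ell u w = ell theta w) ->
    exists E : set T, [/\ measurable E, ((1 - q0 - q1)%:E <= P E)%E
      & forall w, E w -> (ereal_sup [set (`|centered P (fun w' => ell u w' - ell theta w') w|
          / norm1 (u - theta))%:E | u in D `\ theta] <= bound)%E].
  move=> b0 ellE; exists setT; split=> //.
    by rewrite probability_setT lee_fin; case/andP: q0_01 => ? _; case/andP: q1_01 => ? _; lra.
  move=> w _; apply: ge_ereal_sup => _ [u _ <-].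
  have -> : (fun w' => ell u w' - ell theta w') = cst 0.
    by apply/funext => w'; rewrite ellE subrr.
  by rewrite /centered expectation_cst subrr normr0 mul0r.
have [N_0|N0] := posnP N.
  have noI (i : 'I_N) : False by case: i => m; rewrite N_0.
  apply: triv => [|u w]; last first.
    exact: loss_empty_sample.
  have SXE : SX = cst 0.
    apply/funext => w; apply/eqP; rewrite eq_le SX0 andbT.
    apply: bigmax_le => // j _; rewrite big1 ?sqrtr0// => i _; case: (noI i).
  by rewrite /bound SXE expectation_cst mule0 mul0e add0e N_0 mulr0 sqrtr0 mul0r.
pose i1 : 'I_N := Ordinal N0.
have F10 : 0 <= F1 by exact: le_trans (dg_bnd i1 0).
have F20 : 0 <= F2.
  by have := le_trans (normr_ge0 _) (dg_lip i1 1 0); rewrite subr0 normr1 mulr1.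
have rho0_gt0 : 0 < rho0 := varrho0_gt0 Ag_gt0 AgBg.
have rho1_ge0 : 0 <= rho1 := varrho1_ge0 Ag_gt0 AgBg.
have MX0 : 0 <= MX := ltW MX_gt0.
have psi1_ge0 : 0 <= psi1 by rewrite divr_ge0// ltW.
have psi2_ge0 : 0 <= psi2 by rewrite divr_ge0 ?mulr_ge0// ltW.
have psi3_ge0 : 0 <= psi3.
  rewrite divr_ge0 ?(ltW Ag_gt0)//; apply: fine_ge0.
  by rewrite le_min lee_fin mulr_ge0// mule_ge0// lee_fin divr_ge0// mulr_ge0.
have psi4_ge0 : 0 <= psi4.
  by rewrite mulr_ge0// addr_ge0// mulr_ge0// ?addr_ge0// ltW.
have psi5_ge0 : 0 <= psi5 by rewrite mulr_ge0// mulr_ge0// mulr_ge0.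
have psi6_gt0 : 0 < psi6 by rewrite mulr_gt0// ltr_wpDr// mulr_ge0// mulr_ge0.
have psi56 : 0 < psi5 + psi6 by rewrite ltr_wpDl.
have sN0 : 0 <= Num.sqrt (2 * N%:R) :> R by exact: sqrtr_ge0.
pose beta2 : R := Num.sqrt (2 * N%:R) * (psi1 * MX * Num.sqrt (ln (2 * p%:R / q0))
            + 2 * psi4 * Num.sqrt (ln (p%:R / q1))).
have beta2_ge0 : 0 <= beta2.
  rewrite mulr_ge0// addr_ge0// mulr_ge0 ?sqrtr_ge0//; first by rewrite mulr_ge0.
  by rewrite mulr_ge0.
have RDfac : (0 <= psi1%:E + (2 * psi2)%:E * RD + (2 * psi3)%:E)%E.
  apply: adde_ge0; last by rewrite lee_fin mulr_ge0.
  by apply: adde_ge0; [rewrite lee_fin|rewrite mule_ge0// lee_fin mulr_ge0].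
have A0 : (0 <= A)%E.
  apply: adde_ge0; last by rewrite mule_ge0// lee_fin ltW.
  by rewrite lee_fin mulr_ge0// ?addr_ge0// ?(ltW psi6_gt0)// mulr_ge0.
have brk0 : (0 <= A * (Num.sqrt (ln (2 * p%:R)))%:E + (2 * psi3 * (psi5 + psi6))%:E)%E.
  apply: adde_ge0; first by rewrite mule_ge0// lee_fin sqrtr_ge0.
  by rewrite lee_fin mulr_ge0 ?(ltW psi56)// mulr_ge0.
have bound0 : (0 <= bound)%E.
  apply: adde_ge0; last by rewrite lee_fin.
  by do 3 (apply: mule_ge0 => //); rewrite lee_fin mulr_ge0// sqrtr_ge0.
(* If F1 vanishes, every g_i is constant. From here on F1 > 0 makes psi_1 M_X and psi_4 positive, as
   McDiarmid's inequality asks of its constants. *)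
have [F1_0|F1_gt0] := leP F1 0.
  apply: triv; first exact: bound0.
  move=> u w; have [c gE] : exists c, g = fun i => cst (c i).
    exists (fun i => g i 0); apply/funext => i; apply/funext => t /=.
    apply: is_derive_0_is_cst => s; split; first exact: g_diff.
    apply/eqP; rewrite -normr_le0 -derive1E.
    exact: le_trans (dg_bnd i s) F1_0.
  by rewrite /ell gE.
have [p_0|p0] := posnP p.
  apply: triv; first exact: bound0.
  move=> u w; have -> : u = theta.
    by apply/rowP => j; have := leq_trans (ltn_ord j) (eq_leq p_0).
  reflexivity.
have [w0 _] : [set: T] !=set0.
  apply/set0P/negP => /eqP T0; have := probability_setT P.
  by rewrite T0 measure0 => /eqP; rewrite eqe eq_sym oner_eq0.
(* A base point for the default value of the conditional mean; T is nonempty because P has mass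
   1. *)
pose x0 := omega i1 w0.
have ESXE := expectation_SX mx MX_gt0 x_bnd.
set S := (\int[P]_w _) in ESXE.
have S0 : 0 <= S by rewrite -lee_fin -ESXE.
pose C := score_lip MX Ag Bg F1 F2.
pose bnd_fin rho ps3 := 2 * (2 * C * rho * Num.sqrt (2 * ln (2 * p%:R)) * S) +
  Num.sqrt (2 * N%:R) * (MX * (F1 / Ag) * Num.sqrt (ln (2 * p%:R / q0)) +
  (F1 / Ag * rho0 + ps3 * (1 + rho0)) * MX * Num.sqrt (ln (p%:R / q1))).
(* Reduction to finite families of points of D. The radius rho may depend on the family, which lets
   unbounded domains in. *)
have core beta : 0 <= beta -> (beta%:E <= bound)%E ->
    (forall (I : finType) (pt : I -> 'rV[R]_p), (forall u, D (pt u)) ->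
      exists rho, [/\ forall u, norm1 (pt u - theta) <= rho,
        2 * F1 <= psi3 * Ag \/ F2 * MX / 2 * rho <= psi3 * Ag & bnd_fin rho psi3 <= beta]) ->
    exists E : set T, [/\ measurable E, ((1 - q0 - q1)%:E <= P E)%E
      & forall w, E w -> (ereal_sup [set (`|centered P (fun w' => ell u w' - ell theta w') w|
          / norm1 (u - theta))%:E | u in D `\ theta] <= bound)%E].
  move=> beta0 bb fin.
  have finE (pts : nat -> 'rV[R]_p) n : (forall i, D (pts i)) ->
      exists Ev : set T, [/\ measurable Ev, ((1 - q0 - q1)%:E <= P Ev)%E & forall w, Ev w ->
        forall i, (i < n)%N ->
        `|centered_log_lik P Y mu nu g x k theta MX x0 (pts i) w| <=
        norm1 (pts i - theta) * beta].
    (* The extra index [None] stands for theta, the point where the remainder vanishes. *)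
    move=> Dpts; pose pt (o : option 'I_n) := if o is Some i then pts i else theta.
    have Dpt u : D (pt u) by case: u => [i|]; [exact: Dpts|exact: thetaD].
    have [rho [h1 h2 h3]] := fin _ pt Dpt.
    have [Ev [mEv PEv Ev_le]] := finite_points_bound x0 mx mk k_ge0 indep dens MX_gt0
      g_diff Ag_gt0 AgBg g_bnd dg_bnd dg_lip N0 p0 F1_gt0 (i0 := None) (pt := pt)
      erefl h1 h2 psi3_ge0 q0_01 q1_01.
    exists Ev; split=> // w Ew i ni.
    apply: le_trans (Ev_le w Ew (Some (Ordinal ni))) _.
    by apply: ler_wpM2l h3; exact: norm1_ge0.
  have [Ev [mEv PEv Ev_le]] := dense_points_bound mx mk k_ge0 dens MX_gt0 x_bnd g_diff
    Ag_gt0 AgBg g_bnd dg_bnd dg_lip beta0 thetaD finE.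
  exists Ev; split=> // w Ew; apply: ge_ereal_sup => _ [u [Du _] <-].
  apply: le_trans bb; rewrite lee_fin.
  have [n0|n0] := eqVneq (norm1 (u - theta)) 0; first by rewrite n0 invr0 mulr0.
  rewrite ler_pdivrMr ?lt0r ?n0 ?norm1_ge0// mulrC.
  exact: Ev_le.
(* The argument yields psi_4 where the statement allows 2 psi_4. *)
have second_le ps3 : ps3 = psi3 -> Num.sqrt (2 * N%:R) *
    (MX * (F1 / Ag) * Num.sqrt (ln (2 * p%:R / q0)) +
     (F1 / Ag * rho0 + ps3 * (1 + rho0)) * MX * Num.sqrt (ln (p%:R / q1))) <= beta2.
  move=> ->; rewrite /beta2 ler_wpM2l// [MX * _]mulrC lerD2l -/psi1 -/psi4.
  rewrite ler_wpM2r ?sqrtr_ge0//; lra.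
have RD_ge u : D u -> ((norm1 (u - theta))%:E <= RD)%E.
  by move=> Du; apply: ereal_sup_ubound; exists u.
case RDE : RD => [rd| |]; last by move: RD0; rewrite RDE.
- have rd0 : 0 <= rd by rewrite -lee_fin -RDE.
  have psi3E : psi3 * Ag = Num.min (2 * F1) (F2 * MX / 2 * rd).
    by rewrite /psi3 RDE -EFinM -EFin_min/= divfK// lt0r_neq0.
  pose Ar := 2 * psi2 * (1 + psi6) + (psi1 + 2 * psi2 * rd + 2 * psi3) * (psi5 + psi6).
  pose sl : R := Num.sqrt (ln (2 * p%:R)).
  pose beta := 2 * Num.sqrt 2 * rd * S * (Ar * sl + 2 * psi3 * (psi5 + psi6)) + beta2.
  have boundE : bound = beta%:E.
    by rewrite /bound /A RDE ESXE -!(EFinM, EFinD).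
  have sl0 : 0 <= sl by exact: sqrtr_ge0.
  have Ar0 : 0 <= Ar by rewrite -lee_fin; move: A0; rewrite /A RDE -!(EFinM, EFinD).
  have s20 : 0 <= Num.sqrt 2 :> R by exact: sqrtr_ge0.
  have p530 : 0 <= 2 * psi3 * (psi5 + psi6).
    by rewrite mulr_ge0 ?(ltW psi56)// mulr_ge0.
  have S2 : 0 <= 2 * Num.sqrt 2 * rd * S by do 3 apply: mulr_ge0 => //.
  apply: (core beta).
  + by rewrite addr_ge0// mulr_ge0// addr_ge0// mulr_ge0.
  + by rewrite boundE.
  move=> I pt Dpt; exists rd; split.
  + by move=> u; have := RD_ge _ (Dpt u); rewrite RDE lee_fin.
  + by rewrite psi3E; case: (leP (2 * F1) (F2 * MX / 2 * rd)) => _; [left|right].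
  rewrite /bnd_fin /beta; apply: lerD; last exact: second_le.
  (* The two terms of 2 C = 2 psi_2 (1 + rho0) + psi_1 psi_5 are compared with those of A, using
     rho0 <= psi_6 for the first and enlarging both factors of the second. *)
  have C2 : 2 * C <= Ar.
    have -> : 2 * C = 2 * (1 + rho0) * psi2 + psi1 * psi5.
      by rewrite /C /score_lip /psi2 /psi1 /psi5 /psi1 -/rho0 -/rho1; ring.
    rewrite /Ar (_ : 2 * (1 + rho0) * psi2 = 2 * psi2 * (1 + rho0)); last by ring.
    apply: lerD.
      apply: ler_wpM2l; first exact: mulr_ge0.
      rewrite lerD2l /psi6.
      have : 0 <= psi3 * MX * rho1 by do 2 apply: mulr_ge0 => //.
      by move: rho0_gt0; lra.
    apply: ler_pM => //; last by rewrite lerDl ltW.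
    by rewrite -addrA lerDl; apply: addr_ge0; [do 2 apply: mulr_ge0 => //|exact: mulr_ge0].
  rewrite sqrtrM// -/sl.
  rewrite (_ : 2 * (2 * C * rd * (Num.sqrt 2 * sl) * S) =
    2 * Num.sqrt 2 * rd * S * (2 * C * sl)); last by ring.
  rewrite ler_wpM2l//.
  by apply: le_trans (ler_wpM2r sl0 C2) _; rewrite lerDl.
(* For infinite R_D and E S_X = 0 the convention +oo * 0 = 0 leaves the finite bound [beta2], which
   has to be proved. The term with S vanishes whatever the radius of the finite family. *)
have [S_0|S_neq0] := eqVneq S 0.
  apply: (core beta2) => //.
    by rewrite /bound RDE ESXE S_0 mule0 mul0e add0e.
  move=> I pt Dpt; exists (\big[Num.max/0]_u norm1 (pt u - theta)); split.
  + by move=> u; exact: (le_bigmax _ (fun u => norm1 (pt u - theta))).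
  + rewrite /psi3 RDE divfK ?lt0r_neq0//.
    (* At infinite radius psi_3 Ag is 0 if F2 = 0, again by 0 * +oo = 0, and 2 F1 otherwise. *)
    have [F2_0|F2_neq0] := eqVneq F2 0.
      right; rewrite F2_0 !mul0r mul0e.
      by have -> : Order.min (2 * F1)%:E 0%E = 0%E :> \bar R;
        [apply/min_idPr; rewrite lee_fin mulr_ge0|].
    left; rewrite gt0_muley ?lte_fin ?divr_gt0 ?mulr_gt0// ?lt0r ?F2_neq0//.
    by rewrite (min_idPl (leey _)).
  rewrite /bnd_fin S_0 !mulr0 add0r; exact: second_le.
have S_gt0 : 0 < S by rewrite lt0r S_neq0.
(* The factor multiplying R_D must be strictly positive, which follows from E S_X > 0, F1 > 0, psi_6
   > 0 and ln (2p) > 0. *)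
have boundE : bound = +oo%E.
  rewrite /bound RDE ESXE gt0_muley ?lte_fin ?mulr_gt0 ?sqrtr_gt0//.
  rewrite gt0_mulye ?lte_fin//.
  have psi1_gt0 : 0 < psi1 by rewrite divr_gt0.
  have A_gt0 : (0 < A)%E.
    apply: (@lt_le_trans _ _ (psi1 * (psi5 + psi6))%:E); first by rewrite lte_fin mulr_gt0.
    rewrite /A -[leLHS]add0e; apply: leeD.
      rewrite lee_fin; apply: mulr_ge0; first exact: mulr_ge0.
      by apply: addr_ge0 => //; exact: ltW.
    rewrite [leLHS](EFinM psi1); apply: (@lee_wpmul2r _ (psi5 + psi6)%:E); first by rewrite lee_fin ltW.
    rewrite -addeA leeDl//; apply: adde_ge0; last by rewrite lee_fin; exact: mulr_ge0.
    by rewrite mule_ge0// lee_fin; exact: mulr_ge0.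
  have brk_gt0 :
      (0 < A * (Num.sqrt (ln (2 * p%:R)))%:E + (2 * psi3 * (psi5 + psi6))%:E)%E.
    have sl_gt0 : (0 < (Num.sqrt (ln (2 * p%:R)))%:E :> \bar R)%E.
      rewrite lte_fin sqrtr_gt0 ln_gt0//.
      have : 1 <= p%:R :> R by rewrite ler1n.
      by lra.
    have c_ge0 : 0 <= 2 * psi3 * (psi5 + psi6).
      by apply: mulr_ge0; [exact: mulr_ge0|exact: ltW].
    apply: lt_le_trans (mule_gt0 A_gt0 sl_gt0) _.
    by rewrite leeDl// lee_fin.
  by rewrite (gt0_mulye brk_gt0) addye// ltNye.
exists setT; split=> //.
  by rewrite probability_setT lee_fin; case/andP: q0_01 => ? _; case/andP: q1_01 => ? _; lra.
by move=> w _; rewrite boundE leey.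
Qed.
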